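(* Let $p>0$, let $\mathbf{X}=(X_1,\ldots,X_n)$ have cone measure $\mathcal{C}_p^n$ on the sphere $S(\ell_p^n)$, and let $$Y=\sum_{i=1}^n\theta_iX_i$$ be the one-dimensional projection of $\mathbf{X}$ along the direction $\boldsymbol{\theta}=(\theta_1,\ldots,\theta_n)\in\mathbf{R}^n$ with Euclidean norm $\|\boldsymbol{\theta}\|=1$. Let $$\sigma_{n,p}^2=\mathrm{Var}(X_1)=\frac{\Gamma(3/p)\Gamma(n/p)}{\Gamma(1/p)\Gamma((n+2)/p)},\qquad m_{n,p}=E|X_1^1|=\frac{\Gamma(4/p)\Gamma((n+2)/p)}{\Gamma(3/p)\Gamma((n+3)/p)},$$ where $X_1^1$ has the square bias distribution of $X_1$. Then, with $F$ the distribution function of the normalized sum $W=Y/\sigma_{n,p}$ and $\Phi$ the cumulative distribution function of the standard normal, $$\|F-\Phi\|_1\le3\left(\frac{m_{n,p}}{\sigma_{n,p}}\right)\sum_{i=1}^n|\theta_i|^3+\left(\frac1p\vee1\right)\frac{4}{n+2}.$$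
   Context: For distribution functions $F,G$ on $\mathbf{R}$, $\|F-G\|_1=\int_{-\infty}^\infty|F(t)-G(t)|\,dt$. $\Gamma(\cdot)$ is the Gamma function and $a\vee b=\max(a,b)$. Cone measure: let $S(\ell_p^n)=\{\mathbf{x}\in\mathbf{R}^n:\sum_{i=1}^n|x_i|^p=1\}$ and $B(\ell_p^n)=\{\mathbf{x}\in\mathbf{R}^n:\sum_{i=1}^n|x_i|^p\le1\}$. With $\mu^n$ Lebesgue measure on $\mathbf{R}^n$, the cone measure of (measurable) $A\subset S(\ell_p^n)$ is $\mathcal{C}_p^n(A)=\mu^n([0,1]A)/\mu^n(B(\ell_p^n))$, where $[0,1]A=\{ta:a\in A,\ 0\le t\le1\}$. Square bias distribution: for a mean zero variable $X$ with variance $\sigma^2\in(0,\infty)$, $X^1$ has the square bias distribution of $X$ if $E[X^2f(X)]=\sigma^2E[f(X^1)]$ for all $f$ for which the left-hand expectation exists. *)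

(* Defs.v *)
From HB Require Import structures.
From mathcomp Require Import all_boot all_order all_algebra.
From mathcomp Require Import all_classical all_reals all_analysis.
From mathcomp Require Import measurable_realfun.

Set Implicit Arguments.
Unset Strict Implicit.
Unset Printing Implicit Defensive.

Import Order.TTheory GRing.Theory Num.Theory.
Import numFieldNormedType.Exports.

Local Open Scope classical_set_scope.
Local Open Scope ring_scope.

(* Points of R^n are tuples [n.-tuple R], which carry the product (= Borel)
   sigma-algebra. *)

(* The measure [lebesgue_measure \x mu] on R * R^n, transported to R^(n+1). *)
Section lebesgue_tuple_step.
Context {R : realType} (n : nat).
Variable mu : {sigma_finite_measure set (n.-tuple R) -> \bar R}.

Definition tuple_cons (x : measurableTypeR R * n.-tuple R) : n.+1.-tuple R :=
  [tuple of x.1 :: x.2].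

Lemma measurable_tuple_cons : measurable_fun setT tuple_cons.
Proof.
apply: (@measurable_cons _ _ _ R fst n snd); last exact: measurable_snd.
exact: measurable_fst.
Qed.

Definition lebesgue_tuple_step : set (n.+1.-tuple R) -> \bar R :=
  pushforward (lebesgue_measure \x mu)%E tuple_cons.

Let lebesgue_tuple_step0 : lebesgue_tuple_step set0 = 0%E.
Proof. by rewrite /lebesgue_tuple_step /pushforward preimage_set0 measure0. Qed.

Let lebesgue_tuple_step_ge0 A : (0 <= lebesgue_tuple_step A)%E.
Proof. by rewrite /lebesgue_tuple_step /pushforward measure_ge0. Qed.

Let lebesgue_tuple_step_sigma_additive :
  semi_sigma_additive lebesgue_tuple_step.
Proof.
move=> F mF tF mUF; rewrite /lebesgue_tuple_step /pushforward preimage_bigcup.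
apply: measure_semi_sigma_additive.
- by move=> k; rewrite -[X in measurable X]setTI; exact: measurable_tuple_cons.
- apply/trivIsetP => /= i j _ _ ij; rewrite -preimage_setI.
  by move/trivIsetP : tF => /(_ _ _ _ _ ij) ->//; rewrite preimage_set0.
- rewrite -preimage_bigcup -[X in measurable X]setTI.
  exact: measurable_tuple_cons.
Qed.

HB.instance Definition _ := isMeasure.Build _ _ _ lebesgue_tuple_step
  lebesgue_tuple_step0 lebesgue_tuple_step_ge0
  lebesgue_tuple_step_sigma_additive.

Let lebesgue_tuple_step_sigma_finite :
  sigma_finite setT lebesgue_tuple_step.
Proof.
have /sigma_finiteP[F [TF ndF Foo]] := sigma_finiteT (@lebesgue_measure R).
have /sigma_finiteP[G [TG ndG Goo]] := sigma_finiteT mu.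
pose hd (t : n.+1.-tuple R) : measurableTypeR R := thead t.
pose tl (t : n.+1.-tuple R) := [tuple of behead t].
have tlK x : tl (tuple_cons x) = x.2 by apply: val_inj.
exists (fun k => hd @^-1` F k `&` tl @^-1` G k).
  rewrite predeqE => t; split=> // _.
  have [i _ Fi] : (\bigcup_i F i) (hd t) by rewrite -TF.
  have [j _ Gj] : (\bigcup_i G i) (tl t) by rewrite -TG.
  exists (maxn i j) => //; split.
  - have : F i `<=` F (maxn i j) by exact/subsetPset/ndF/leq_maxl.
    exact.
  - have : G j `<=` G (maxn i j) by exact/subsetPset/ndG/leq_maxr.
    exact.
move=> k; have [mF Fk] := Foo k; have [mG Gk] := Goo k; split.
  apply: measurableI; rewrite -[X in measurable X]setTI.
    exact: (@measurable_tnth _ R n.+1 ord0).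
  exact: measurable_behead.
rewrite /lebesgue_tuple_step /pushforward.
rewrite (_ : _ @^-1` _ = F k `*` G k).
  by rewrite product_measure1E// lte_mul_pinfty// ge0_fin_numE.
by apply/seteqP; split => x /=; rewrite tlK.
Qed.

HB.instance Definition _ := Measure_isSigmaFinite.Build _ _ _
  lebesgue_tuple_step lebesgue_tuple_step_sigma_finite.

End lebesgue_tuple_step.

(* Lebesgue measure on R^n, as the n-fold product measure; [lebesgue_tuple_box]
   is its characteristic property. *)
Fixpoint lebesgue_tuple (R : realType) (n : nat) :
    {sigma_finite_measure set (n.-tuple R) -> \bar R} :=
  match n with
  | 0 => \d_([tuple] : 0.-tuple R)
  | m.+1 => lebesgue_tuple_step (lebesgue_tuple R m)
  end.

Lemma lebesgue_tuple_box (R : realType) (n : nat) (A : 'I_n -> set R) :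
  (forall i, measurable (A i)) ->
  lebesgue_tuple R n [set x | forall i, A i (tnth x i)] =
  (\prod_(i < n) lebesgue_measure (A i))%E.
Proof.
elim: n A => [A _|n IHn A mA].
  rewrite big_ord0 /= diracE mem_set//=.
  by case.
pose B := [set x : n.-tuple R | forall i, A (lift ord0 i) (tnth x i)].
have mB : measurable B.
  have -> : B = \bigcap_(i in setT)
      ((fun x : n.-tuple R => tnth x i) @^-1` A (lift ord0 i)).
    by apply/seteqP; split => x Bx i; [move=> _|]; exact: Bx.
  apply: fin_bigcap_measurable => // i _; rewrite -[_ @^-1` _]setTI.
  exact: measurable_tnth.
rewrite big_ord_recl -(IHn (fun i => A (lift ord0 i)))// -/B.
rewrite /= /lebesgue_tuple_step /pushforward (_ : _ @^-1` _ = A ord0 `*` B).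
  by rewrite product_measure1E//; exact: mA.
apply/seteqP; split => -[x t] /=.
  move=> Axt; split; first exact: (Axt ord0).
  by move=> i; have := Axt (lift ord0 i); rewrite tnthS.
by move=> [Ax At] i; case: (unliftP ord0 i) => [j|] -> //; rewrite tnthS.
Qed.

Section cone_measure.
Context {R : realType}.
Variables (p : R) (n : nat).

Definition lp_sphere : set (n.-tuple R) :=
  [set x | \sum_(i < n) `|tnth x i| `^ p = 1].

Definition lp_ball : set (n.-tuple R) :=
  [set x | \sum_(i < n) `|tnth x i| `^ p <= 1].

Definition cone (A : set (n.-tuple R)) : set (n.-tuple R) :=
  [set [tuple t * tnth a i | i < n] | t in `[0, 1] & a in A].

Definition cone_measure (A : set (n.-tuple R)) : \bar R :=
  (lebesgue_tuple R n (cone A) / lebesgue_tuple R n lp_ball)%E.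

Definition has_cone_measure d (T : measurableType d) (P : probability T R)
    (X : {RV P >-> n.-tuple R}) : Prop :=
  forall A, measurable A -> A `<=` lp_sphere ->
    distribution P X A = cone_measure A.

End cone_measure.

Section coordinates_and_projections.
Context {R : realType} d (T : measurableType d) (P : probability T R) (n : nat).
Variable X : {RV P >-> n.-tuple R}.

Definition coord_RV (i : 'I_n) : T -> R := fun w => tnth (X w) i.

Lemma measurable_coord_RV i : measurable_fun setT (coord_RV i).
Proof.
by apply: (measurableT_comp (measurable_tnth i)); exact: measurable_funPT.
Qed.

HB.instance Definition _ i :=
  isMeasurableFun.Build _ _ _ _ (coord_RV i) (measurable_coord_RV i).

Definition projection (theta : n.-tuple R) : T -> R :=
  fun w => \sum_(i < n) tnth theta i * coord_RV i w.

Lemma measurable_projection theta : measurable_fun setT (projection theta).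
Proof.
by apply: measurable_sum => i; apply: measurable_funM => //.
Qed.

HB.instance Definition _ theta := isMeasurableFun.Build _ _ _ _
  (projection theta) (measurable_projection theta).

End coordinates_and_projections.

(* The functions [f] for which [E[X^2 f(X)]] exists are the measurable ones
   making [X^2 f(X)] integrable.  The notion is meant for [X] of mean zero and
   variance in ]0, +oo[; these are facts about [X] and are not part of the
   relation. *)
Definition has_square_bias_of (R : realType)
    d (T : measurableType d) (P : probability T R) (X : {RV P >-> R})
    d' (T' : measurableType d') (P' : probability T' R)
    (X' : {RV P' >-> R}) : Prop :=
  forall f : R -> R, measurable_fun setT f ->
    P.-integrable setT (fun w => (X w ^+ 2 * f (X w))%:E) ->
    ('E_P[fun w => (X w ^+ 2 * f (X w))%R] = 'V_P[X] * 'E_P'[f \o X'])%E.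

Definition Gamma (R : realType) (x : R) : R :=
  \int[lebesgue_measure]_(t in `]0, +oo[) (t `^ (x - 1) * expR (- t)).

Definition sigma2 (R : realType) (n : nat) (p : R) : R :=
  (Gamma (3 / p) * Gamma (n%:R / p)) /
  (Gamma (1 / p) * Gamma (n.+2%:R / p)).

Definition sigma (R : realType) (n : nat) (p : R) : R := Num.sqrt (sigma2 n p).

Definition m_np (R : realType) (n : nat) (p : R) : R :=
  (Gamma (4 / p) * Gamma (n.+2%:R / p)) /
  (Gamma (3 / p) * Gamma (n.+3%:R / p)).

Definition euclidean_norm (R : realType) (n : nat) (x : n.-tuple R) : R :=
  Num.sqrt (\sum_(i < n) tnth x i ^+ 2).

(* Distribution functions are [\bar R]-valued, as is the library's [cdf]. *)
Definition L1_dist (R : realType) (F G : R -> \bar R) : \bar R :=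
  (\int[lebesgue_measure]_t `|F t - G t|)%E.

Definition std_normal_cdf (R : realType) (t : R) : \bar R :=
  normal_prob 0 1 `]-oo, t].

(* Main.v *)
Require Import Defs.
From HB Require Import structures.
From mathcomp Require Import all_boot all_order all_algebra.
From mathcomp Require Import all_classical all_reals all_analysis.
From mathcomp Require Import measurable_realfun.
From mathcomp Require Import ring lra.

(* Stein's method with the square bias coupling.  Writing W = sum_j w_j X_j
   with w = theta / sigma, symmetry in the j-th coordinate gives
     E[W F(W)] = sum_j w_j^2 E[X_j^2 k_j],
   where k_j is the mean of F' over [S_j - w_j X_j, S_j + w_j X_j] and S_j
   collects the other terms of W.  In polar coordinates the cone law is the
   direction of a vector with independent coordinates whose p-th powers of
   absolute values are Gamma(1/p); biasing one coordinate by its square amounts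
   to adding an independent Gamma(2/p) variable to its p-th power.  Hence under
   the bias of X_j the remaining coordinates are only multiplied by
   r = (t / (t + g))^(1/p), with t and g independent Gamma(n/p) and Gamma(2/p),
   and E(1 - r) <= max(1/p, 1) * 2 / (n + 2).  For a solution F of the Stein
   equation with F' 2-Lipschitz, this bounds E[W F(W) - F'(W)].  Finally
   ||F_W - Phi||_1 is a limit of differences Nh - E h(W) with h 1-Lipschitz and
   bounded. *)

Set Implicit Arguments.
Unset Strict Implicit.
Unset Printing Implicit Defensive.

Import Order.TTheory GRing.Theory Num.Theory.
Import numFieldNormedType.Exports.

Local Open Scope classical_set_scope.
Local Open Scope ring_scope.

(** * The measures a t^(a-1) dt and the Gamma function *)

(** Gamma variables enter as exp(-t) times the measure that gives mass t^a to ]-oo, t]. A function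
    whose sublevel sets scale like t^a is then known in law up to one constant, so sums, radii and
    weights need no Jacobian. The change of law under the bias is carried out with nonnegative
    integrals in [\bar R], where Tonelli asks for no integrability. This requires F' >= 0, whereas
    the Stein solution f only has |f'| <= 4. Hence F is f(x) + 4x; the added terms 4 W^2 and 4 have
    equal expectation because E W^2 = 1. Constants: f'(x) = x f(x) + h(x) - Nh is 2-Lipschitz
    because x f(x) and h are both 1-Lipschitz. In 3 = 2 * (1/2 + 1), the 1/2 is the mean distance to
    the centre of the interval in k_j, and the 1 comes from the term w_j X_j of W that this centre
    lacks, with E X_j^2 E|X_j| <= E|X_j|^3. The last term is 2 times the bound on E(1 - r), since
    E|S_j| <= 1. *)

Section push_on.
Context d d' (T : measurableType d) (T' : measurableType d') (R : realType).
Variables (mu : {measure set T -> \bar R}) (D : set T) (f : T -> T').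

(** The image under f of mu restricted to D. Both measurability proofs are arguments, so that the
    measure structure can be attached to this very term. *)
Definition push_on of measurable D & measurable_fun [set: T] f :=
  fun A => mu (f @^-1` A `&` D).

Hypotheses (mD : measurable D) (mf : measurable_fun [set: T] f).

Let push_on_measurable A : measurable A -> measurable (f @^-1` A `&` D).
Proof. by move=> mA; apply: measurableI => //; rewrite -[_ @^-1` _]setTI; exact: mf. Qed.

Let push_on0 : push_on mD mf set0 = 0%E.
Proof. by rewrite /push_on preimage_set0 set0I measure0. Qed.

Let push_on_ge0 A : (0 <= push_on mD mf A)%E.
Proof. exact: measure_ge0. Qed.

Let push_on_sigma_additive : semi_sigma_additive (push_on mD mf).
Proof.
move=> F mF tF mU; rewrite /push_on preimage_bigcup setI_bigcupl.
apply: measure_semi_sigma_additive => [n||].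
- exact: push_on_measurable.
- apply/trivIsetP => i j _ _ ij; rewrite setIACA -preimage_setI.
  by move/trivIsetP : tF => /(_ _ _ _ _ ij) -> //; rewrite preimage_set0 set0I.
- by rewrite -setI_bigcupl -preimage_bigcup; exact: push_on_measurable.
Qed.

HB.instance Definition _ := isMeasure.Build _ _ _ (push_on mD mf)
  push_on0 push_on_ge0 push_on_sigma_additive.

Lemma ge0_integral_push_on (phi : T' -> \bar R) :
  measurable_fun [set: T'] phi -> (forall y, 0 <= phi y)%E ->
  (\int[push_on mD mf]_y phi y = \int[mu]_(x in D) phi (f x))%E.
Proof.
move=> mphi phi0.
have -> : (\int[push_on mD mf]_y phi y = \int[pushforward (mrestr mu mD) f]_y phi y)%E.
  by apply: eq_measure_integral.
rewrite ge0_integral_pushforward//= preimage_setT -(setUv D).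
have mphif : measurable_fun setT (phi \o f) by exact: measurableT_comp.
rewrite ge0_integral_setU//=; [|exact: measurableC| by rewrite setUv| exact/disj_set2P/setICr].
rewrite [X in (_ + X)%E](null_set_integral _ _)//; last 3 first.
- exact: measurableC.
- exact: measurable_funTS.
- by rewrite /= /mrestr setICl measure0.
rewrite adde0; apply: eq_measure_integral => A mA AD.
by rewrite /= /mrestr setIidl.
Qed.

End push_on.

Section power_measure.
Context {R : realType}.
Implicit Types a b c t : R.

Lemma ler_powRV a z t : 0 < a -> 0 <= z -> 0 <= t ->
  (z `^ a^-1 <= t) = (z <= t `^ a).
Proof.
move=> a0 z0 t0; apply/idP/idP => h.
- rewrite -[z]powRr1// -(mulVf (lt0r_neq0 a0)) powRrM.
  by apply: ge0_ler_powR; rewrite ?nnegrE ?powR_ge0// ltW.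
- rewrite -[t]powRr1// -(mulfV (lt0r_neq0 a0)) powRrM.
  by apply: ge0_ler_powR; rewrite ?nnegrE ?powR_ge0// invr_ge0 ltW.
Qed.

(* The measure a t^(a-1) dt on ]0, +oo[, as the image of Lebesgue measure under
   t |-> t^(1/a); it gives mass t^a to ]-oo, t].  The exponent is replaced by 1
   when a <= 0, so that every power_measure is sigma-finite. *)
Let exponent a := if 0 < a then a else 1.

Let exponent_gt0 a : 0 < exponent a.
Proof. by rewrite /exponent; case: ifP. Qed.

Definition power_measure a : set R -> \bar R :=
  push_on (@lebesgue_measure R) (measurable_itv `]0, +oo[)
    (measurable_powR (exponent a)^-1).

HB.instance Definition _ a := Measure.copy (power_measure a)
  (push_on (@lebesgue_measure R) (measurable_itv `]0, +oo[)
    (measurable_powR (exponent a)^-1)).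

Lemma power_measure_itv a t : 0 < a ->
  power_measure a `]-oo, t] = (if 0 <= t then (t `^ a)%:E else 0%E).
Proof.
move=> a0; rewrite /power_measure /push_on /exponent a0.
case: ifPn => t0; last first.
  rewrite (_ : _ `&` _ = set0) ?measure0//.
  apply/seteqP; split => z //=; rewrite !in_itv/= => -[zt _].
  by move: t0; rewrite (le_trans (powR_ge0 _ _) zt).
rewrite (_ : _ `&` _ = `]0, t `^ a]%classic).
  rewrite [LHS]lebesgue_measure_itv/= lte_fin; case: ltP => [|h]; first by rewrite oppr0 adde0.
  by congr EFin; apply/eqP; rewrite eq_le powR_ge0 h.
apply/seteqP; split => z /=; rewrite !in_itv/= ?andbT.
  by move=> [zt z0]; rewrite z0 -ler_powRV// ltW.
by move=> /andP[z0 zt]; rewrite ler_powRV// ltW.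
Qed.

Lemma ge0_integral_power_measureE a (phi : R -> \bar R) : 0 < a ->
  measurable_fun [set: R] phi -> (forall y, 0 <= phi y)%E ->
  (\int[power_measure a]_y phi y =
   \int[lebesgue_measure]_(z in `]0%R, +oo[) phi (z `^ a^-1)%R)%E.
Proof. by move=> a0 mphi phi0; rewrite ge0_integral_push_on// /exponent a0. Qed.

Let power_measure_sigma_finite a : sigma_finite setT (power_measure a).
Proof.
exists (fun k => `]-oo, k%:R]%classic).
  apply/seteqP; split => // x _; exists (Num.truncn x).+1 => //=.
  by rewrite in_itv/= ltW// truncnS_gt.
move=> k; split; first exact: measurable_itv.
(* [exponent] is idempotent, so the mass formula for positive exponents applies. *)
have -> : power_measure a = power_measure (exponent a).
  by rewrite /power_measure /exponent; case: (ltP 0 a) => [->|_]; rewrite ?ltr01.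
by rewrite power_measure_itv// ler0n ltry.
Qed.

HB.instance Definition _ a := Measure_isSigmaFinite.Build _ _ _
  (power_measure a) (@power_measure_sigma_finite a).

End power_measure.

Lemma measurable_eq_ray (R : realType) :
  (@ocitv R).-sigma.-measurable =
  <<s [set A : set R | exists x, A = `]-oo, x]%classic] >>.
Proof.
rewrite RGenOInfty.measurableE; apply/seteqP; split => A.
- apply: smallest_sub; first exact: smallest_sigma_algebra.
  move=> _ [x ->]; rewrite -setCitvl.
  have [_ sC _] := @smallest_sigma_algebra _ setT
    [set A : set R | exists x, A = `]-oo, x]%classic].
  by rewrite -setTD; apply: sC; apply: sub_sigma_algebra; exists x.
- apply: smallest_sub; first exact: smallest_sigma_algebra.
  move=> _ [x ->]; rewrite -setCitvr.
  have [_ sC _] := @smallest_sigma_algebra _ setT (@RGenOInfty.G R).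
  by rewrite -setTD; apply: sC; apply: sub_sigma_algebra; exists x.
Qed.

Lemma measure_eq_ray (R : realType) (m1 m2 : {measure set R -> \bar R}) :
  (forall x, m1 `]-oo, x]%classic = m2 `]-oo, x]%classic) ->
  (forall x, m1 `]-oo, x]%classic < +oo)%E ->
  forall A, measurable A -> m1 A = m2 A.
Proof.
move=> m12 m1oo; apply: (measure_unique
  [set A : set R | exists x, A = `]-oo, x]%classic]
  (fun k => `]-oo, k%:R]%classic)) => //.
- exact: measurable_eq_ray.
- move=> _ _ [x ->] [y ->]; exists (Num.min x y).
  by apply/seteqP; split => z /=; rewrite !in_itv/= le_min => /andP.
- by move=> i; exists i%:R.
- apply/seteqP; split => // x _; exists (Num.truncn x).+1 => //=.
  by rewrite in_itv/= ltW// truncnS_gt.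
- by move=> _ [x ->].
Qed.

Lemma measurable_sublevel d (T : measurableType d) (R : realType) (f : T -> R)
    (t : R) : measurable_fun [set: T] f -> measurable [set x | f x <= t].
Proof.
move=> mf; have := mf measurableT _ (measurable_itv `]-oo, t]).
by rewrite setTI.
Qed.

(** A measure that is finite on left rays is determined by them, so the masses of the sublevel sets
    of f give its whole law. The changes of variables below (scaling, homogeneous functions, radius,
    |x|^p) are instances. *)
Lemma ge0_integral_power_law d (T : measurableType d) (R : realType)
    (mu : {measure set T -> \bar R}) (D : set T) (f : T -> R) (a c : R)
    (phi : R -> \bar R) : 0 < a -> 0 <= c ->
  measurable D -> measurable_fun [set: T] f ->
  mu (D `&` [set x | f x <= 0]) = 0%E ->
  (forall t : R, 0 < t -> mu (D `&` [set x | f x <= t]) = (c * t `^ a)%:E) ->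
  measurable_fun [set: R] phi -> (forall y, 0 <= phi y)%E ->
  (\int[mu]_(x in D) phi (f x) = c%:E * \int[power_measure a]_y phi y)%E.
Proof.
move=> a0 c0 mD mf mu0 mut mphi phi0.
rewrite -(ge0_integral_push_on mu mD mf)//.
pose c' := NngNum c0.
transitivity (\int[mscale c' (power_measure a)]_y phi y)%E; last first.
  by rewrite ge0_integral_mscale.
have mE x : push_on mu mD mf `]-oo, x] =
    (if 0 <= x then (c * x `^ a)%:E else 0%E).
  have -> : push_on mu mD mf `]-oo, x] = mu (D `&` [set y | f y <= x]).
    by rewrite /push_on setIC.
  have [x0|x0|->] := ltgtP x 0.
  - apply/eqP; rewrite eq_le measure_ge0 andbT -mu0; apply: le_measure.
    + by rewrite inE; apply: measurableI => //; exact: measurable_sublevel.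
    + by rewrite inE; apply: measurableI => //; exact: measurable_sublevel.
    + by apply: setIS => y /= /le_trans; apply; exact: ltW.
  - by rewrite -mut.
  - by rewrite powR0 ?mulr0 ?gt_eqF// -mu0.
apply: eq_measure_integral => A mA _; apply: measure_eq_ray => // x.
- rewrite [LHS]mE; transitivity (c%:E * power_measure a `]-oo, x])%E => //.
  rewrite power_measure_itv//.
  by case: ifPn => // _; rewrite mule0.
- by rewrite [ltLHS]mE; case: ifPn => // _; rewrite ltry.
Qed.

Section power_measure_integrals.
Context {R : realType}.
Implicit Types (a b c t s : R) (phi psi : R -> \bar R).

Lemma power_measure_ray0 a : 0 < a -> power_measure a `]-oo, 0] = 0%E.
Proof. by move=> a0; rewrite power_measure_itv// lexx powR0// gt_eqF. Qed.

(** Positive points suffice because []-oo, 0]] is null. *)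
Lemma eq_power_integral a phi psi : 0 < a ->
  measurable_fun [set: R] phi -> measurable_fun [set: R] psi ->
  (forall y, 0 <= phi y)%E -> (forall y, 0 <= psi y)%E ->
  (forall y, 0 < y -> phi y = psi y) ->
  (\int[power_measure a]_y phi y = \int[power_measure a]_y psi y)%E.
Proof.
move=> a0 mphi mpsi phi0 psi0 e.
apply: ge0_ae_eq_integral => //.
exists `]-oo, 0%R]%classic; split => //.
- by have := power_measure_ray0 a0.
- move=> y /= /not_implyP[_] ne; rewrite in_itv/= leNgt; apply/negP => y0.
  by apply: ne; rewrite e.
Qed.

Lemma ge0_integral_power_scale a s phi : 0 < a -> 0 < s ->
  measurable_fun [set: R] phi -> (forall y, 0 <= phi y)%E ->
  (\int[power_measure a]_y phi (s * y)%R =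
   (s `^ (- a))%:E * \int[power_measure a]_y phi y)%E.
Proof.
move=> a0 s0 mphi phi0; apply: ge0_integral_power_law => //.
- exact: powR_ge0.
- rewrite setTI -[RHS](power_measure_ray0 a0); congr (power_measure a _).
  by apply/seteqP; split => y /=; rewrite in_itv/= pmulr_rle0.
move=> t t0; rewrite setTI.
transitivity (power_measure a `]-oo, s^-1 * t]).
  congr (power_measure a _).
  by apply/seteqP; split => y /=; rewrite in_itv/= ler_pdivlMl.
rewrite power_measure_itv// ifT; last by rewrite mulr_ge0// ?invr_ge0 ltW.
by rewrite powRM ?invr_ge0 ?ltW// powRN -powR_inv1 ?ltW// -powRrM mulN1r powRN.
Qed.

End power_measure_integrals.

(** * Homogeneous functions of two variables *)

Section power_measure_homogeneous.
Context {R : realType}.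
Implicit Types (a b c t s : R) (phi psi : R -> \bar R).

Lemma product_measureE d1 d2 (T1 : measurableType d1) (T2 : measurableType d2)
    (m1 : {sigma_finite_measure set T1 -> \bar R})
    (m2 : {sigma_finite_measure set T2 -> \bar R}) (E : set (T1 * T2)) :
  measurable E ->
  ((m1 \x m2) E = \int[m1]_x \int[m2]_y (\1_E (x, y))%:E)%E.
Proof.
move=> mE; rewrite -[in LHS](setIT E) -integral_indic// fubini_tonelli1//.
exact/measurable_EFinP/measurable_indic.
Qed.

Lemma power_measure2_scale a b s (E E' : set (R * R)) : 0 < a -> 0 < b -> 0 < s ->
  measurable E -> measurable E' ->
  (forall y g, E' (y, g) <-> E (s * y, s * g)) ->
  ((power_measure a \x power_measure b) E' =
   (s `^ (- (a + b)))%:E * (power_measure a \x power_measure b) E)%E.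
Proof.
move=> a0 b0 s0 mE mE' EE'.
rewrite !product_measureE//.
have m1E : measurable_fun setT (fun z : R * R => (\1_E z : R)%:E).
  exact/measurable_EFinP/measurable_indic.
pose h (y : R) := (\int[power_measure b]_g (\1_E (y, g) : R)%:E)%E.
have mh : measurable_fun setT h.
  apply: (measurable_fun_fubini_tonelli_F (m2 := power_measure b)
    (fun z : R * R => (\1_E z : R)%:E) m1E).
  by move=> z; rewrite lee_fin.
have h0 y : (0 <= h y)%E by apply: integral_ge0 => g _; rewrite lee_fin.
transitivity (\int[power_measure a]_y ((s `^ (- b))%:E * h (s * y)%R))%E.
  apply: eq_integral => y _.
  rewrite -(@ge0_integral_power_scale _ b s (fun g => (\1_E (s * y, g))%:E))//.
  - apply: eq_integral => g _; rewrite !indicE; congr (_%:R%:E).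
    congr (nat_of_bool _).
    by apply/idP/idP; rewrite !inE => /EE'.
  - exact: (measurableT_comp m1E (measurable_pair1 (s * y))).
have mhs : measurable_fun setT (fun y : R => h (s * y)).
  by apply: (measurableT_comp mh); exact: measurable_funM.
rewrite (ge0_integralZl_EFin _ measurableT (fun y _ => h0 (s * y)) mhs (powR_ge0 _ _)).
rewrite (ge0_integral_power_scale a0 s0 mh h0) muleA -EFinM.
by rewrite opprD addrC powRD// (gt_eqF s0) implybT.
Qed.

(** The product measure scales with exponent a + b. On a cone D, a positive function homogeneous of
    degree 1 therefore has sublevel sets of mass proportional to t^(a+b). *)
Lemma ge0_integral_power_measure2 a b (D : set (R * R)) (f : R * R -> R) phi :
  0 < a -> 0 < b -> measurable D -> measurable_fun [set: R * R] f ->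
  (forall z, D z -> 0 < f z) ->
  (forall s z, 0 < s -> D z -> D (s * z.1, s * z.2)) ->
  (forall s z, f (s * z.1, s * z.2) = s * f z) ->
  ((power_measure a \x power_measure b) (D `&` [set z | (f z <= 1)%R]) < +oo)%E ->
  measurable_fun [set: R] phi -> (forall y, 0 <= phi y)%E ->
  (\int[power_measure a \x power_measure b]_(z in D) phi (f z) =
   (power_measure a \x power_measure b) (D `&` [set z | (f z <= 1)%R]) *
     \int[power_measure (a + b)]_y phi y)%E.
Proof.
move=> a0 b0 mD mf f0 Ds fs; set P := (_ \x _)%E => Poo mphi phi0.
have mDf t : measurable (D `&` [set z | f z <= t]).
  by apply: measurableI => //; exact: measurable_sublevel.
have Pfin : P (D `&` [set z | (f z <= 1)%R]) \is a fin_num.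
  by rewrite ge0_fin_numE.
rewrite -(fineK Pfin); apply: ge0_integral_power_law => //.
- exact: addr_gt0.
- exact: fine_ge0.
- rewrite (_ : _ `&` _ = set0) ?measure0//.
  by apply/seteqP; split => z //= -[/f0]; rewrite ltNge => /negP.
move=> t t0; rewrite EFinM fineK// muleC.
have ti0 : 0 < t^-1 by rewrite invr_gt0.
(* Multiplication by 1/t carries the sublevel set at t to the one at 1. *)
rewrite [LHS](@power_measure2_scale a b t^-1 (D `&` [set z | (f z <= 1)%R]))//.
  by rewrite -[t^-1]powR_inv1 ?ltW// -powRrM mulN1r opprK.
move=> y g; split => -[/= Dz fz].
- split; first exact: (Ds _ (y, g)).
  by rewrite /= (fs _ (y, g)) ler_pdivrMl ?mulr1.
- split.
    have := Ds t _ t0 Dz; rewrite /= !mulrA mulfV ?gt_eqF// !mul1r.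
    exact.
  by move: fz; rewrite (fs _ (y, g)) ler_pdivrMl ?mulr1.
Qed.

End power_measure_homogeneous.

Section power_weight.
Context {R : realType}.
Implicit Types (a b c t s : R) (phi psi : R -> \bar R).

Lemma derivable_oo_LRcontinuous_powR s : 0 < s ->
  derivable_oo_LRcontinuous (fun z : R => z `^ s) 0 1.
Proof.
move=> s0; have dp (z : R) : 0 < z -> derivable ((@powR R) ^~ s) z 1.
  by move=> z0; apply: derivable_powR; rewrite in_itv/= z0.
split.
- by move=> z; rewrite in_itv/= => /andP[z0 _]; exact: dp.
- by rewrite powR0 ?gt_eqF//; exact: powR_cvg0.
- apply: cvg_at_left_filter.
  by have /derivable1_diffP/differentiable_continuous := dp 1 ltr01.
Qed.

Lemma integral_powR01 s : 0 <= s ->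
  (\int[lebesgue_measure]_(z in `[0%R, 1%R]) (z `^ s)%:E = ((s + 1)^-1)%:E)%E.
Proof.
rewrite le_eqVlt => /predU1P[<-|s0].
  under eq_integral do rewrite powRr0.
  rewrite integral_cst//= lebesgue_measure_itv/= lte_fin ltr01 mul1e.
  by rewrite oppr0 adde0 add0r invr1.
have s1 : 0 < s + 1 by rewrite addr_gt0.
have [d1 d2 d3] := derivable_oo_LRcontinuous_powR s1.
rewrite (continuous_FTC2 (F := fun z => (s + 1)^-1 * z `^ (s + 1)) ltr01).
- by rewrite -EFinB powR1 powR0 ?gt_eqF// mulr0 mulr1 subr0.
- exact: derivable_oo_LRcontinuous_within (derivable_oo_LRcontinuous_powR s0).
- split.
  + by move=> z z01; apply: derivableM => //; exact: d1.
  + exact: cvgMr.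
  + exact: cvgMr.
- move=> z z01; rewrite derive1E deriveM//; last exact: d1.
  rewrite derive_cst scaler0 addr0 -derive1E powR_derive1.
    by rewrite addrK -[LHS]/(_ * (_ * _)) mulKf ?gt_eqF.
  by move: z01; rewrite !in_itv/= => /andP[->].
Qed.

End power_weight.

Lemma measurable_set_ler d (T : measurableType d) (R : realType) (f g : T -> R) :
  measurable_fun [set: T] f -> measurable_fun [set: T] g ->
  measurable [set x | f x <= g x].
Proof.
move=> mf mg; rewrite -[X in measurable X]setTI.
exact: (measurable_fun_ler mf mg measurableT (Y := [set true])).
Qed.

Lemma measurable_set_ltr d (T : measurableType d) (R : realType) (f g : T -> R) :
  measurable_fun [set: T] f -> measurable_fun [set: T] g ->
  measurable [set x | f x < g x].
Proof.
move=> mf mg.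
rewrite (_ : [set _ | _] = ~` [set x | g x <= f x]).
  exact/measurableC/measurable_set_ler.
by apply/seteqP; split => x /=; rewrite ltNge => /negP.
Qed.

Section power_weight2.
Context {R : realType}.
Implicit Types (a b c t s : R) (phi psi : R -> \bar R).

Lemma ge0_integral_fst_xsection d1 d2 (T1 : measurableType d1)
    (T2 : measurableType d2)
    (m1 : {sigma_finite_measure set T1 -> \bar R})
    (m2 : {sigma_finite_measure set T2 -> \bar R})
    (D : set (T1 * T2)) (phi : T1 -> \bar R) :
  measurable D -> measurable_fun [set: T1] phi -> (forall x, 0 <= phi x)%E ->
  (\int[m1 \x m2]_(z in D) phi z.1 =
   \int[m1]_x (phi x * m2 (xsection D x)))%E.
Proof.
move=> mD mphi phi0.
have m1D : measurable_fun setT (fun z => (\1_D z : R)%:E).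
  exact/measurable_EFinP/measurable_indic.
rewrite integral_mkcond epatch_indic fubini_tonelli1; last 2 first.
- apply: emeasurable_funM => //; apply: (measurableT_comp mphi).
  exact: measurable_fst.
- by move=> z; rewrite mule_ge0// lee_fin.
apply: eq_integral => x _; rewrite /fubini_F.
have m1Dx : measurable_fun setT (fun y => (\1_D (x, y) : R)%:E).
  exact: (measurableT_comp m1D (measurable_pair1 x)).
transitivity (\int[m2]_y (phi x * (\1_D (x, y) : R)%:E))%E => //.
rewrite (ge0_integralZl _ measurableT m1Dx)//.
by congr (_ * _)%E; exact: (congr1 (fun f => f x) (indic_fubini_tonelli_FE m2 mD)).
Qed.

Let triangle : set (R * R) := [set z | 0 < z.1 /\ z.2 <= z.1].

Let mtriangle : measurable triangle.
Proof.
apply: measurableI; first by apply: measurable_set_ltr => //; exact: measurable_fst.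
by apply: measurable_set_ler; [exact: measurable_snd|exact: measurable_fst].
Qed.

Let xsection_triangle b y : 0 < b -> 0 < y ->
  power_measure b (xsection triangle y) = (y `^ b)%:E.
Proof.
move=> b0 y0.
have -> : xsection triangle y = `]-oo, y]%classic.
  apply/seteqP; split => g /=; rewrite xsectionE/= in_itv/=; first by case.
  by split.
by rewrite power_measure_itv// ltW.
Qed.

(** y^b is the mass of ]-oo, y] under [power_measure b], so the left-hand side integrates phi(y)
    over the triangle g <= y. There the first coordinate is homogeneous, and the constant is the
    mass of the part with y <= 1. *)
Lemma ge0_integral_power_weight a b phi : 0 < a -> 0 <= b ->
  measurable_fun [set: R] phi -> (forall y, 0 <= phi y)%E ->
  (\int[power_measure a]_y ((y `^ b)%:E * phi y) =
   (a / (a + b))%:E * \int[power_measure (a + b)]_y phi y)%E.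
Proof.
move=> a0; rewrite le_eqVlt => /predU1P[<-|b0] mphi phi0.
  rewrite addr0 divff ?gt_eqF// mul1e.
  by apply: eq_integral => y _; rewrite powRr0 mul1e.
have mpow : measurable_fun [set: R] (fun y : R => (y `^ b)%:E).
  by apply/measurable_EFinP; exact: measurable_powR.
have m1 : measurable_fun setT (fun y : R => power_measure b (xsection triangle y)).
  exact: (measurable_fun_xsection (power_measure b) mtriangle).
have triE psi : measurable_fun [set: R] psi -> (forall y, 0 <= psi y)%E ->
    (\int[power_measure a \x power_measure b]_(z in triangle) psi z.1 =
     \int[power_measure a]_y ((y `^ b)%:E * psi y))%E.
  move=> mpsi psi0; rewrite ge0_integral_fst_xsection//.
  apply: eq_power_integral => //.
  - exact: emeasurable_funM.
  - exact: emeasurable_funM.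
  - by move=> y; rewrite mule_ge0.
  - by move=> y; rewrite mule_ge0// lee_fin powR_ge0.
  - by move=> y y0; rewrite muleC; congr (_ * _)%E; exact: xsection_triangle.
have c2 : ((power_measure a \x power_measure b)
    (triangle `&` [set z | (z.1 <= 1)%R]) = (a / (a + b))%:E)%E.
  have m01 : measurable_fun setT (fun y : R => (\1_(`]-oo, 1]%classic) y : R)%:E).
    exact/measurable_EFinP/measurable_indic.
  have m1fst : measurable [set z : R * R | (z.1 <= 1)%R].
    by apply: measurable_sublevel; exact: measurable_fst.
  rewrite setIC -integral_indic//.
  transitivity (\int[power_measure a \x power_measure b]_(z in triangle)
    (\1_(`]-oo, 1]%classic) z.1 : R)%:E)%E.
    by apply: eq_integral => z _; rewrite !indicE; congr (_%:R%:E).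
  rewrite (triE (fun y => (\1_(`]-oo, 1]%classic) y : R)%:E))//.
  rewrite ge0_integral_power_measureE//; last 2 first.
  - exact: emeasurable_funM.
  - by move=> y; rewrite mule_ge0// lee_fin powR_ge0.
  (* With y = z^(1/a), the mass of the triangle is the integral of z^(b/a) over ]0, 1], that is a/(a
     + b). *)
  transitivity (\int[lebesgue_measure]_(z in `]0%R, 1%R]) (z `^ (b / a))%:E)%E.
    rewrite integral_mkcond [RHS]integral_mkcond; apply: eq_integral => z _.
    rewrite !patchE !mem_setE !in_itv/= andbT; case: ltP => //= z0.
    rewrite indicE mem_setE in_itv/= ler_powRV ?powR1 ?ler01//; last exact: ltW.
    by case: ifPn => _; rewrite ?mule0// mule1 -powRrM mulrC.
  rewrite integral_itv_obnd_cbnd.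
    rewrite integral_powR01 ?divr_ge0 ?ltW//; congr EFin.
    by rewrite -(divff (lt0r_neq0 a0)) -mulrDl invf_div addrC.
  apply/measurable_EFinP/measurable_funTS; exact: measurable_powR.
rewrite -triE//; rewrite -c2; apply: ge0_integral_power_measure2 => //.
- by move=> z [].
- by move=> s z s0 [/= z0 z1]; split => /=; rewrite ?mulr_gt0// ler_pM2l.
- by rewrite c2 ltry.
Qed.

End power_weight2.

Section power_conv.
Context {R : realType}.
Implicit Types (a b c t s : R) (phi psi : R -> \bar R).

Let quadrant : set (R * R) := [set z | 0 < z.1 /\ 0 < z.2].

Let mquadrant : measurable quadrant.
Proof.
apply: measurableI; apply: measurable_set_ltr => //.
Qed.

(** The sum is homogeneous of degree 1 on the quadrant. Its constant stays abstract here and is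
    identified in [power_conv_Gamma] by testing against exp(-y). *)
Lemma power_measure_conv a b : 0 < a -> 0 < b ->
  exists2 c : R, 0 <= c & forall phi, measurable_fun [set: R] phi ->
    (forall y, 0 <= phi y)%E ->
  (\int[power_measure a]_y \int[power_measure b]_g phi (y + g)%R =
   c%:E * \int[power_measure (a + b)]_y phi y)%E.
Proof.
move=> a0 b0.
have ray1 (e : R) : 0 < e -> power_measure e `]-oo, 1%R] = 1%E.
  by move=> e0; rewrite power_measure_itv// ler01 powR1.
have madd : measurable_fun [set: R * R] (fun z : R * R => z.1 + z.2).
  exact: measurable_funD.
have msq : measurable (quadrant `&` [set z : R * R | z.1 + z.2 <= 1]).
  by apply: measurableI => //; exact: measurable_sublevel.
have Poo : ((power_measure a \x power_measure b)
    (quadrant `&` [set z : R * R | (z.1 + z.2 <= 1)%R]) < +oo)%E.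
  apply: (@le_lt_trans _ _ ((power_measure a \x power_measure b)
    (`]-oo, 1%R]%classic `*` `]-oo, 1%R]%classic))%E); last first.
    rewrite product_measure1E//.
    apply: (@le_lt_trans _ _ (1 * 1)%E); last by rewrite mule1 ltry.
    by apply: lee_pmul => //; [rewrite -(ray1 a a0) lexx|rewrite -(ray1 b b0) lexx].
  apply: le_measure; rewrite ?inE//; first exact: measurableX.
  move=> [y g] /= [[/= y0 g0]] yg; split; rewrite /= in_itv/=.
    by rewrite (le_trans _ yg)// lerDl ltW.
  by rewrite (le_trans _ yg)// lerDr ltW.
exists (fine ((power_measure a \x power_measure b)
    (quadrant `&` [set z : R * R | (z.1 + z.2 <= 1)%R])%E)).
  exact: fine_ge0.
move=> phi mphi phi0.
rewrite fineK ?ge0_fin_numE// -ge0_integral_power_measure2//; last 3 first.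
- by move=> z [z1 z2]; rewrite addr_gt0.
- by move=> s z s0 [z1 z2]; split; rewrite /= mulr_gt0.
- by move=> s z; rewrite /= mulrDr.
have m2 : measurable_fun [set: R * R] (fun z : R * R => phi (z.1 + z.2)).
  exact: (measurableT_comp mphi madd).
have mD : measurable_fun [set: R * R] (fun z => (\1_quadrant z : R)%:E).
  exact/measurable_EFinP/measurable_indic.
have m2D : measurable_fun [set: R * R]
    (fun z : R * R => phi (z.1 + z.2)%R * (\1_quadrant z)%:E)%E.
  exact: emeasurable_funM.
have p2D (z : R * R) : (0 <= phi (z.1 + z.2)%R * (\1_quadrant z)%:E)%E.
  by rewrite mule_ge0// lee_fin.
rewrite [RHS]integral_mkcond epatch_indic.
rewrite (fubini_tonelli1 _ m2D p2D).
apply: eq_power_integral => //.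
- exact: (measurable_fun_fubini_tonelli_F (m2 := power_measure b) _ m2).
- exact: (measurable_fun_fubini_tonelli_F (m2 := power_measure b) _ m2D).
- by move=> y; exact: integral_ge0.
- by move=> y; apply: integral_ge0.
move=> y y0; apply: eq_power_integral => //.
- exact: (measurableT_comp m2 (measurable_pair1 y)).
- exact: (measurableT_comp m2D (measurable_pair1 y)).
- by move=> g g0; rewrite /= indicE mem_set ?mule1//.
Qed.

End power_conv.

(** * Gamma integrals against the power measures *)

Section gamma.
Context {R : realType}.
Implicit Types (a b c t s : R).

Let mexpRN : measurable_fun [set: R] (fun y : R => (expR (- y))%:E).
Proof. by apply/measurable_EFinP; apply: measurableT_comp. Qed.

Let mpow b : measurable_fun [set: R] (fun y : R => (y `^ b)%:E).
Proof. by apply/measurable_EFinP; exact: measurable_powR. Qed.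

Let expRN_ge0 (y : R) : (0 <= (expR (- y))%:E)%E.
Proof. by rewrite lee_fin expR_ge0. Qed.

Let powR_gee0 b (y : R) : (0 <= (y `^ b)%:E)%E.
Proof. by rewrite lee_fin powR_ge0. Qed.

(** This is a Gamma(a), kept in [\bar R] until it is known to be finite. *)
Definition power_gamma a := (\int[power_measure a]_y (expR (- y))%:E)%E.

Let power_gamma1 : power_gamma 1 = 1%E.
Proof.
rewrite /power_gamma ge0_integral_power_measureE//.
rewrite -(integral_exponential_pdf (@ltr01 R)) [RHS](_ : _ =
    \int[lebesgue_measure]_(x in `[0%R, +oo[) (expR (- x))%:E)%E; last first.
  rewrite [RHS]integral_mkcond; apply: eq_integral => x _.
  by rewrite /exponential_pdf !patchE; case: ifPn => //; rewrite mul1r mulN1r.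
rewrite -integral_itv_obnd_cbnd; last exact: measurable_funTS.
apply: eq_integral => x; rewrite inE/= in_itv/= andbT => x0.
by rewrite invr1 powRr1// ltW.
Qed.

Let power_gamma_prod a b :
  (\int[power_measure a]_y \int[power_measure b]_g (expR (- (y + g)))%:E =
   power_gamma a * power_gamma b)%E.
Proof.
rewrite /power_gamma -(ge0_integralZr _ measurableT mexpRN); last 2 first.
- by [].
- exact: integral_ge0.
apply: eq_integral => y _.
rewrite -(ge0_integralZl _ measurableT mexpRN); [|by []|by []].
by apply: eq_integral => g _; rewrite -EFinM -expRD opprD.
Qed.

Let power_gamma_conv a b : 0 < a -> 0 < b ->
  exists2 c : R, 0 <= c & (power_gamma a * power_gamma b =
                           c%:E * power_gamma (a + b))%E.
Proof.
move=> a0 b0; have [c c0 cE] := power_measure_conv a0 b0.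
by exists c; [exact: c0|rewrite -power_gamma_prod (cE _ mexpRN expRN_ge0)].
Qed.

Let power_gamma_gt0 a : 0 < a -> (0 < power_gamma a)%E.
Proof.
move=> a0; apply: (@lt_le_trans _ _ (expR (- 1) : R)%:E).
  by rewrite lte_fin expR_gt0.
have <- : (\int[power_measure a]_(y in `]-oo, 1%R]) (expR (- 1))%:E)%E =
    (expR (- 1) : R)%:E.
  rewrite integral_cst// -[RHS]mule1; congr (_ * _)%E.
  by have := power_measure_itv 1 a0; rewrite ler01 powR1.
apply: (@le_trans _ _ (\int[power_measure a]_(y in `]-oo, 1%R]) (expR (- y))%:E)%E).
  apply: ge0_le_integral => //; first exact: measurable_funTS.
  by move=> y /=; rewrite in_itv/= => y1; rewrite lee_fin ler_expR lerN2.
exact: ge0_subset_integral.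
Qed.

(** Convolution with exponent 1 gives [power_gamma] at k as a multiple c >= 0 of [power_gamma] at k
    + 1. If the latter were infinite, the former would be 0 or +oo, against positivity or the
    induction hypothesis. *)
Let power_gamma_nat_lty n : (power_gamma n.+1%:R < +oo)%E.
Proof.
elim: n => [|n ih]; first by rewrite power_gamma1 ltry.
have [c c0] := power_gamma_conv (ltr0Sn R n) ltr01.
rewrite power_gamma1 mule1 natr1 => e.
rewrite ltey; apply/eqP => g.
move: (power_gamma_gt0 (ltr0Sn R n)) ih; rewrite e g.
move: c0; rewrite le_eqVlt => /predU1P[<-|c0]; first by rewrite mul0e ltxx.
by rewrite gt0_muley ?lte_fin// ltxx.
Qed.

(** Here exp(-y) is at most 1 on ]0, 1] and at most y^b exp(-y) beyond 1. The exponent b lifts a to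
    the next integer, where finiteness is known. *)
Lemma power_gamma_lty a : 0 < a -> (power_gamma a < +oo)%E.
Proof.
move=> a0; pose k := Num.truncn a; pose b := k.+1%:R - a.
have b0 : 0 < b by rewrite subr_gt0 truncnS_gt.
apply: (@le_lt_trans _ _ (\int[power_measure a]_y ((\1_`]-oo, 1%R]%classic y : R)%:E +
    (y `^ b)%:E * (expR (- y))%:E))%E).
  rewrite (_ : power_gamma a =
    \int[power_measure a]_y ((\1_`]0%R, +oo[%classic y : R)%:E * (expR (- y))%:E))%E.
    apply: ge0_le_integral => //.
    - apply: emeasurable_funM => //; exact/measurable_EFinP/measurable_indic.
    - apply: emeasurable_funD; first exact/measurable_EFinP/measurable_indic.
      exact: emeasurable_funM.
    move=> y _; rewrite !indicE !mem_setE !in_itv/= andbT -!EFinM -EFinD lee_fin.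
    have [y0|y0] := ltP 0 y; last first.
      by rewrite mul0r addr_ge0 ?mulr_ge0 ?powR_ge0 ?expR_ge0.
    rewrite mul1r; have [y1|y1] := leP y 1.
      rewrite ler_wpDr ?mulr_ge0 ?powR_ge0 ?expR_ge0//.
      by rewrite -[leRHS]expR0 ler_expR oppr_le0 ltW.
    rewrite add0r ler_peMl ?expR_ge0//.
    by rewrite -(powRr0 y) ler_powR// ltW.
  apply: eq_power_integral => //.
  - apply: emeasurable_funM => //; exact/measurable_EFinP/measurable_indic.
  - by move=> y y0; rewrite indicE mem_setE in_itv/= y0 mul1e.
have m1 : measurable_fun [set: R] (fun y : R => (\1_`]-oo, 1%R]%classic y : R)%:E).
  exact/measurable_EFinP/measurable_indic.
have m2 : measurable_fun [set: R] (fun y : R => ((y `^ b)%:E * (expR (- y))%:E)%E).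
  exact: emeasurable_funM.
have m20 (y : R) : (0 <= (y `^ b)%:E * (expR (- y))%:E)%E by rewrite mule_ge0.
rewrite (ge0_integralD _ measurableT _ m1 (fun y _ => m20 y) m2)//.
rewrite integral_indic// setIT.
rewrite ge0_integral_power_weight// ?ltW// -/(power_gamma _).
have -> : a + b = k.+1%:R by rewrite addrC subrK.
apply: lte_add_pinfty.
  have r1 := power_measure_itv 1 a0; rewrite ler01 powR1 in r1.
  by apply: (@le_lt_trans _ _ 1%E); rewrite ?ltry// -r1.
apply: lte_mul_pinfty; rewrite ?lee_fin ?divr_ge0 ?ltW//.
Qed.

(** [ge0_integral_power_weight] only takes nonnegative exponents. For a >= 1 the factor y^(a-1)
    weights [power_measure 1]; for a <= 1 the lemma is used in the other direction, weighting
    [power_measure a] by y^(1-a). *)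
Let integral_gamma a : 0 < a ->
  (\int[lebesgue_measure]_(y in `]0%R, +oo[) (y `^ (a - 1) * expR (- y))%:E =
   a^-1%:E * power_gamma a)%E.
Proof.
move=> a0.
have mpe e : measurable_fun [set: R] (fun y : R => (y `^ e * expR (- y))%:E).
  by apply/measurable_EFinP; apply: measurable_funM => //;
    exact: measurableT_comp.
have pe0 e (y : R) : (0 <= (y `^ e * expR (- y))%:E)%E.
  by rewrite lee_fin mulr_ge0 ?powR_ge0 ?expR_ge0.
have -> : (\int[lebesgue_measure]_(y in `]0%R, +oo[) (y `^ (a - 1) * expR (- y))%:E =
    \int[power_measure 1]_y (y `^ (a - 1) * expR (- y))%:E)%E.
  rewrite (ge0_integral_power_measureE ltr01 (mpe (a - 1)) (pe0 (a - 1))).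
  apply: eq_integral => y; rewrite inE/= in_itv/= andbT => y0.
  by rewrite invr1 powRr1// ltW.
have [a1|/ltW a1] := leP 1 a.
  under eq_integral do rewrite EFinM.
  have a10 : 0 <= a - 1 by rewrite subr_ge0.
  rewrite (ge0_integral_power_weight ltr01 a10 mexpRN expRN_ge0).
  have -> : 1 + (a - 1) = a by rewrite addrC subrK.
  by rewrite mul1r.
have a10 : 0 <= 1 - a by rewrite subr_ge0.
have := ge0_integral_power_weight a0 a10 (mpe (a - 1)) (pe0 (a - 1)).
have -> : a + (1 - a) = 1 by rewrite addrC subrK.
rewrite divr1 => e.
have {e}-> : power_gamma a =
    (a%:E * \int[power_measure 1]_y (y `^ (a - 1) * expR (- y))%:E)%E.
  rewrite -e; apply: eq_power_integral => //.
  - exact: emeasurable_funM.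
  - by move=> y; rewrite mule_ge0.
  move=> y y0; rewrite -EFinM mulrA -powRD ?(gt_eqF y0) ?implybT//.
  by rewrite addrC addrA subrK subrr powRr0 mul1r.
by rewrite muleA -EFinM mulVf ?gt_eqF// mul1e.
Qed.

Lemma power_gammaE a : 0 < a -> power_gamma a = (a * Gamma a)%:E.
Proof.
move=> a0; rewrite /Gamma /Rintegral integral_gamma//.
have pf : power_gamma a \is a fin_num.
  by rewrite ge0_fin_numE ?power_gamma_lty// ltW ?power_gamma_gt0.
by rewrite -(fineK pf) -EFinM /= mulrA divff ?gt_eqF// mul1r.
Qed.

Lemma Gamma1 : Gamma (1 : R) = 1.
Proof.
have := power_gamma1; rewrite power_gammaE// mul1r => -[].
by [].
Qed.

Lemma Gamma_gt0 a : 0 < a -> 0 < Gamma a.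
Proof.
move=> a0; have := power_gamma_gt0 a0.
by rewrite power_gammaE// lte_fin pmulr_rgt0.
Qed.

Lemma integral_power_gamma a b : 0 < a -> 0 <= b ->
  (\int[power_measure a]_y (y `^ b * expR (- y))%:E = (a * Gamma (a + b))%:E)%E.
Proof.
move=> a0 b0; under eq_integral do rewrite EFinM.
rewrite (ge0_integral_power_weight a0 b0 mexpRN expRN_ge0) -/(power_gamma _).
have ab0 : 0 < a + b by rewrite ltr_wpDr.
by rewrite power_gammaE// -EFinM mulrA divfK// gt_eqF.
Qed.

Lemma power_conv_Gamma a b : 0 < a -> 0 < b ->
  let c := a * Gamma a * (b * Gamma b) / ((a + b) * Gamma (a + b)) in
  forall phi : R -> \bar R, measurable_fun [set: R] phi -> (forall y, 0 <= phi y)%E ->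
  (\int[power_measure a]_y \int[power_measure b]_g phi (y + g)%R =
   c%:E * \int[power_measure (a + b)]_y phi y)%E.
Proof.
move=> a0 b0; have [c c0 cE] := power_measure_conv a0 b0.
have ab0 := addr_gt0 a0 b0.
have := cE _ mexpRN expRN_ge0; rewrite -/(power_gamma _).
rewrite power_gamma_prod.
rewrite !power_gammaE// -!EFinM => -[e] /=.
have -> : a * Gamma a * (b * Gamma b) / ((a + b) * Gamma (a + b)) = c.
  by rewrite e mulfK// gt_eqF// mulr_gt0 ?Gamma_gt0.
exact: cE.
Qed.

End gamma.

Section gamma_recursion.
Context {R : realType}.
Implicit Types (a b c t s : R).

Let mexpRN : measurable_fun [set: R] (fun y : R => (expR (- y))%:E).
Proof. by apply/measurable_EFinP; apply: measurableT_comp. Qed.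

Let power_measure_ray1 a : 0 < a -> power_measure a `]-oo, 1] = 1%E.
Proof. by move=> a0; rewrite power_measure_itv// ler01 powR1. Qed.

(** No integration by parts: the convolution of exponents a and 1 is tested against the indicator of
    ]-oo, 1]. The inner integral is (1 - y)^+, and (1 - y) + y = 1 on ]0, 1], so the convolution
    constant a Gamma(a) / ((a+1) Gamma(a+1)) plus a/(a+1) equals 1. *)
Lemma GammaS a : 0 < a -> Gamma (a + 1) = a * Gamma a.
Proof.
move=> a0; have a10 : 0 < a + 1 by rewrite addr_gt0.
pose u (y : R) : \bar R := (\1_`]-oo, 1%R]%classic y : R)%:E.
have mu : measurable_fun [set: R] u by exact/measurable_EFinP/measurable_indic.
have u0 y : (0 <= u y)%E by rewrite lee_fin.
have intu e : 0 < e -> (\int[power_measure e]_y u y = 1)%E.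
  move=> e0; rewrite integral_indic// setIT.
  exact: power_measure_ray1.
have := power_conv_Gamma a0 ltr01 mu u0; rewrite intu// mule1.
pose h (y : R) := (\int[power_measure 1]_g u (y + g)%R)%E.
rewrite -[X in X = _]/(\int[power_measure a]_y h y)%E => hE.
have hy y : h y = (if y <= 1 then (1 - y)%:E else 0%E).
  rewrite /h (_ : (fun g : R => u (y + g)) =
      (fun g => (\1_`]-oo, 1 - y]%classic g : R)%:E)); last first.
    apply/funext => g; rewrite /u !indicE !mem_setE !in_itv/=.
    by rewrite lerBrDl.
  rewrite integral_indic// setIT.
  have := power_measure_itv (1 - y) ltr01; rewrite subr_ge0.
  by case: ifPn => y1; rewrite ?powRr1 ?subr_ge0.
have h0 y : (0 <= h y)%E by rewrite hy; case: ifP => // y1; rewrite lee_fin subr_ge0.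
have mh : measurable_fun [set: R] h.
  rewrite (_ : h = fun y => (Num.max (1 - y) 0)%:E).
    by apply/measurable_EFinP; apply: measurable_maxr => //; exact: measurable_funB.
  apply/funext => y; rewrite hy; case: leP => y1.
    by rewrite max_l// subr_ge0.
  by rewrite max_r// subr_le0 ltW.
have mpow : measurable_fun [set: R] (fun y : R => (y `^ 1)%:E).
  by apply/measurable_EFinP; exact: measurable_powR.
have : (\int[power_measure a]_y (h y + (y `^ 1)%:E * u y) = 1)%E.
  rewrite -(intu a a0); apply: eq_power_integral => //.
  - by apply: emeasurable_funD => //; exact: emeasurable_funM.
  - by move=> y; rewrite adde_ge0// mule_ge0// lee_fin powR_ge0.
  move=> y y0; rewrite hy /u indicE mem_setE in_itv/=.
  case: ifP => _; last by rewrite mule0 adde0.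
  by rewrite mule1 -EFinD powRr1 ?ltW// subrK.
have m2 : measurable_fun [set: R] (fun y : R => ((y `^ 1)%:E * u y)%E).
  exact: emeasurable_funM.
have p2 (y : R) : (0 <= (y `^ 1)%:E * u y)%E.
  by rewrite mule_ge0// lee_fin powR_ge0.
rewrite (ge0_integralD _ measurableT (fun y _ => h0 y) mh (fun y _ => p2 y) m2).
rewrite hE (ge0_integral_power_weight a0 ler01 mu u0) intu// mule1 -EFinD.
rewrite Gamma1 !mulr1 => -[e].
have : a * Gamma a / Gamma (a + 1) = 1.
  have g := lt0r_neq0 (Gamma_gt0 a10); have a1 := lt0r_neq0 a10.
  have : (a * Gamma a / ((a + 1) * Gamma (a + 1)) + a / (a + 1)) * (a + 1) = a + 1.
    by rewrite e mul1r.
  by rewrite invfM mulrDl divfK// mulrA mulrAC mulfVK// addrC => /addrI.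
by move/(congr1 ( *%R^~ (Gamma (a + 1)))); rewrite mul1r divfK// gt_eqF// Gamma_gt0.
Qed.

(** Up to normalization, E[g / (t + g)] = b / (a + b) for independent Gamma(a) and Gamma(b)
    variables t and g. The factor g raises the exponent b to b + 1, after which only t + g occurs.
    Absolute values make the integrand nonnegative on the whole plane. *)
Lemma integral_power_ratio a b : 0 < a -> 0 < b ->
  (\int[power_measure a]_t \int[power_measure b]_g
     (`|g| * `|t + g| `^ (-1) * expR (- (t + g)))%:E =
   (b / (a + b) * (a * Gamma a * (b * Gamma b)))%:E)%E.
Proof.
move=> a0 b0; have ab0 : 0 < a + b by rewrite addr_gt0.
have b10 : 0 < b + 1 by rewrite addr_gt0.
have ab10 : 0 < a + (b + 1) by rewrite addr_gt0.
pose psi (z : R) := (`|z| `^ (-1) * expR (- z))%:E.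
have mpsi : measurable_fun [set: R] psi.
  apply/measurable_EFinP; apply: measurable_funM; last exact: measurableT_comp.
  by apply: (measurableT_comp (measurable_powR _)); exact: normr_measurable.
have psi0 z : (0 <= psi z)%E by rewrite lee_fin mulr_ge0 ?expR_ge0 ?powR_ge0.
have madd t : measurable_fun [set: R] (fun g : R => psi (t + g)).
  by apply: (measurableT_comp mpsi); exact: measurable_funD.
transitivity (\int[power_measure a]_t ((b / (b + 1))%:E *
    \int[power_measure (b + 1)]_g psi (t + g)%R))%E.
  apply: eq_integral => t _.
  rewrite -(ge0_integral_power_weight b0 ler01 (madd t) (fun g => psi0 (t + g))).
  apply: eq_power_integral => //.
  - apply: (eq_measurable_fun (fun g : R => (`|g|)%:E * psi (t + g)%R)%E).
      by move=> g _; rewrite -EFinM mulrA.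
    by apply: emeasurable_funM => //; apply/measurable_EFinP.
  - by apply: emeasurable_funM => //; apply/measurable_EFinP; exact: measurable_powR.
  - by move=> g; rewrite mule_ge0// lee_fin powR_ge0.
  - by move=> g g0; rewrite powRr1 ?ltW// -EFinM mulrA ger0_norm// ltW.
have mI : measurable_fun [set: R]
    (fun t : R => \int[power_measure (b + 1)]_g psi (t + g)%R)%E.
  apply: (measurable_fun_fubini_tonelli_F (m2 := power_measure (b + 1))
    (fun z : R * R => psi (z.1 + z.2))) => //.
  by apply: (measurableT_comp mpsi); exact: measurable_funD.
have I0 (t : R) : (0 <= \int[power_measure (b + 1)]_g psi (t + g)%R)%E.
  by apply: integral_ge0 => g _.
have c0 : (0 <= (b / (b + 1))%:E)%E by rewrite lee_fin divr_ge0// ltW.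
rewrite (ge0_integralZl _ measurableT mI (fun t _ => I0 t) c0).
rewrite (power_conv_Gamma a0 b10 mpsi psi0).
(* z psi(z) = exp(-z) on the positive axis. Read through the weight formula, this gives the integral
   of psi for the exponent a + b + 1. *)
have : (\int[power_measure (a + b)]_z ((z `^ 1)%:E * psi z) =
    power_gamma (a + b))%E.
  apply: eq_power_integral => //.
  - apply: emeasurable_funM => //; apply/measurable_EFinP; exact: measurable_powR.
  - by move=> z; rewrite mule_ge0// lee_fin powR_ge0.
  - move=> z z0; rewrite powRr1 ?ltW// -EFinM mulrA gtr0_norm// powR_inv1 ?ltW// mulfV ?mul1r//.
    by rewrite gt_eqF.
rewrite (ge0_integral_power_weight ab0 ler01 mpsi psi0) power_gammaE//.
rewrite -addrA => e.
have {e}-> : (\int[power_measure (a + (b + 1))]_y psi y =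
    ((a + (b + 1)) * Gamma (a + b))%:E)%E.
  rewrite -[LHS]mul1e -[X in (X%:E * _)%E](@mulfV _ ((a + b) / (a + (b + 1)))).
    by rewrite mulrC EFinM -muleA e -EFinM invf_div mulrA divfK// gt_eqF.
  by rewrite mulf_neq0// ?invr_eq0 gt_eqF.
rewrite -!EFinM; congr EFin.
rewrite (GammaS b0) addrA (GammaS ab0).
have := Gamma_gt0 ab0.
move: (Gamma a) (Gamma b) (Gamma (a + b)) => x y z z0.
by field; rewrite !gt_eqF// -addrA.
Qed.

End gamma_recursion.

(** * Polar integration for the cone law *)

Section tuple_measure.
Context {R : realType}.

Definition tuple_box n (A : 'I_n -> set R) : set (n.-tuple R) :=
  [set x | forall i, A i (tnth x i)].

Lemma measurable_tuple_box n (A : 'I_n -> set R) :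
  (forall i, measurable (A i)) -> measurable (tuple_box A).
Proof.
move=> mA; rewrite (_ : tuple_box A = \bigcap_(i in setT)
    ((fun x : n.-tuple R => tnth x i) @^-1` A i)).
  apply: fin_bigcap_measurable => // i _; rewrite -[_ @^-1` _]setTI.
  exact: measurable_tnth.
by apply/seteqP; split => x Bx i; [move=> _|]; exact: Bx.
Qed.

Lemma measurable_tuple_boxE n : @measurable _ (n.-tuple R) =
  <<s [set tuple_box A | A in [set A | forall i, measurable (A i)]] >>.
Proof.
apply/seteqP; split => E.
- apply: smallest_sub; first exact: smallest_sigma_algebra.
  rewrite -bigcup_seq => F [i _ [B mB <-]].
  apply: sub_sigma_algebra.
  exists (fun j => if j == i then B else setT).
    by move=> j; case: ifP.
  apply/seteqP; split => x /=.
    by move=> /(_ i); rewrite eqxx.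
  by move=> [_ Bx] j; case: eqP => [->|].
- apply: smallest_sub; first exact: sigma_algebra_measurable.
  by move=> _ [A mA <-]; exact: measurable_tuple_box.
Qed.

Lemma lebesgue_tuple_unique n (mu : {measure set (n.-tuple R) -> \bar R}) :
  (forall A, (forall i, measurable (A i)) ->
     mu (tuple_box A) = \prod_(i < n) lebesgue_measure (A i))%E ->
  forall E, measurable E -> mu E = lebesgue_tuple R n E.
Proof.
move=> muE.
pose C (k : nat) (i : 'I_n) : set R := `]- k%:R, k%:R[%classic.
apply: (measure_unique
  [set tuple_box A | A in [set A : 'I_n -> set R | forall i, measurable (A i)]]
  (fun k => tuple_box (C k))).
- exact: measurable_tuple_boxE.
- move=> _ _ [A mA <-] [B mB <-]; exists (fun i => A i `&` B i).
    by move=> i; exact: measurableI.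
  apply/seteqP; split => x /=; first by move=> h; split => i; case: (h i).
  by move=> [hA hB] i; split.
- by move=> k; exists (C k) => // i; exact: measurable_itv.
- apply/seteqP; split => // x _.
  exists (\max_(i < n) (Num.truncn `|tnth x i|).+1) => //= i.
  rewrite /C/= in_itv/= -ltr_norml (lt_le_trans (truncnS_gt _))//.
  by rewrite ler_nat (leq_bigmax i).
- move=> _ [A mA <-]; rewrite muE//.
  by rewrite -[RHS]/(lebesgue_tuple R n [set x | _]) lebesgue_tuple_box.
- move=> k; rewrite muE; last by move=> i; exact: measurable_itv.
  rewrite (eq_bigr (fun=> (2 * k%:R)%:E)).
    by rewrite prodEFin ltry.
  move=> i _; rewrite lebesgue_measure_itv/= lte_fin.
  case: ltP => [|h]; first by rewrite -EFinB opprK mulr_natl mulr2n.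
  have -> : k%:R = 0 :> R.
    apply/eqP; rewrite eq_le ler0n andbT.
    by move: h; rewrite lerNr -subr_le0 opprK -mulr2n pmulrn_lle0.
  by rewrite mulr0.
Qed.

Lemma ge0_integral_lebesgue_tuple d (T : measurableType d)
    (mu : {measure set T -> \bar R}) n (f : T -> n.-tuple R)
    (F : n.-tuple R -> \bar R) :
  measurable_fun [set: T] f ->
  (forall A, (forall i, measurable (A i)) ->
     mu (f @^-1` tuple_box A) = \prod_(i < n) lebesgue_measure (A i))%E ->
  measurable_fun [set: n.-tuple R] F -> (forall x, 0 <= F x)%E ->
  (\int[mu]_x F (f x) = \int[lebesgue_tuple R n]_x F x)%E.
Proof.
move=> mf muf mF F0.
rewrite -(ge0_integral_push_on mu measurableT mf)//.
apply: eq_measure_integral => E mE _.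
apply: lebesgue_tuple_unique => // A mA.
by rewrite -muf// -[LHS]/(mu (_ `&` setT)) setIT.
Qed.

End tuple_measure.

Section tuple_maps.
Context {R : realType}.

Lemma lebesgue_measure_scale (s : R) (A : set R) : 0 < s -> measurable A ->
  (lebesgue_measure ( *%R s @^-1` A) = s^-1%:E * lebesgue_measure A)%E.
Proof.
move=> s0 mA.
have ms : measurable_fun [set: measurableTypeR R]
    ( *%R s : measurableTypeR R -> measurableTypeR R) by exact: measurable_funM.
pose nu : {measure set (measurableTypeR R) -> \bar R} := mscale (NngNum (ltW s0)) (push_on (@lebesgue_measure R) measurableT ms).
have nuE B : nu B = (s%:E * lebesgue_measure ( *%R s @^-1` B))%E.
  by rewrite -[LHS]/(_ * lebesgue_measure (_ `&` setT))%E setIT.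
have -> : lebesgue_measure A = nu A.
  apply: (lebesgue_measure_unique (mu := nu)) => // _ [[a b] _ <-]; rewrite nuE.
  rewrite (_ : _ @^-1` _ = `]s^-1 * a, s^-1 * b]%classic); last first.
    apply/seteqP; split => x /=; rewrite !in_itv/=;
      by rewrite ltr_pdivrMl// ler_pdivlMl.
  rewrite !lebesgue_measure_itv/= !lte_fin ltr_pM2l ?invr_gt0//.
  case: ifP => _; last by rewrite mule0.
  by rewrite -!EFinB -EFinM -mulrBr mulVKf// gt_eqF.
by rewrite nuE muleA -EFinM mulVf ?mul1e// gt_eqF.
Qed.

Definition tuple_scale n (s : R) (x : n.-tuple R) : n.-tuple R :=
  [tuple s * tnth x i | i < n].

Definition tuple_flip n (j : 'I_n) (x : n.-tuple R) : n.-tuple R :=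
  [tuple (if i == j then - tnth x i else tnth x i) | i < n].

Definition tuple_insert n (j : 'I_n.+1) (z : R * n.-tuple R) : n.+1.-tuple R :=
  [tuple (if unlift j i is Some k then tnth z.2 k else z.1) | i < n.+1].

Definition tuple_remove n (j : 'I_n.+1) (x : n.+1.-tuple R) : n.-tuple R :=
  [tuple tnth x (lift j k) | k < n].

Lemma tnth_scale n s (x : n.-tuple R) i : tnth (tuple_scale s x) i = s * tnth x i.
Proof. by rewrite tnth_mktuple. Qed.

Lemma tnth_flip n (j : 'I_n) x i :
  tnth (tuple_flip j x) i = if i == j then - tnth x i else tnth x i.
Proof. by rewrite tnth_mktuple. Qed.

Lemma tnth_insert n (j : 'I_n.+1) z : tnth (tuple_insert j z) j = z.1.
Proof. by rewrite tnth_mktuple unlift_none. Qed.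

Lemma tnth_insert_lift n (j : 'I_n.+1) z k :
  tnth (tuple_insert j z) (lift j k) = tnth z.2 k.
Proof. by rewrite tnth_mktuple liftK. Qed.

Lemma tnth_remove n (j : 'I_n.+1) (x : n.+1.-tuple R) k :
  tnth (tuple_remove j x) k = tnth x (lift j k).
Proof. by rewrite tnth_mktuple. Qed.

Lemma tuple_insertK n (j : 'I_n.+1) z : tuple_remove j (tuple_insert j z) = z.2.
Proof. by apply: eq_from_tnth => k; rewrite tnth_remove tnth_insert_lift. Qed.

Lemma measurable_mktuple d (T : measurableType d) n (f : 'I_n -> T -> R) :
  (forall i, measurable_fun [set: T] (f i)) ->
  measurable_fun [set: T] (fun x => [tuple f i x | i < n]).
Proof.
move=> mf; apply/measurable_fun_tnthP => i.
by apply: eq_measurable_fun (mf i) => x _; rewrite /= tnth_mktuple.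
Qed.

Lemma measurable_tuple_scale n (s : R) :
  measurable_fun [set: n.-tuple R] (tuple_scale s).
Proof.
apply: measurable_mktuple => i; apply: measurable_funM => //.
exact: measurable_tnth.
Qed.

Lemma measurable_tuple_flip n (j : 'I_n) :
  measurable_fun [set: n.-tuple R] (tuple_flip j).
Proof.
apply: measurable_mktuple => i; case: eqP => _; last exact: measurable_tnth.
by apply: measurableT_comp => //; exact: measurable_tnth.
Qed.

Lemma measurable_tuple_insert n (j : 'I_n.+1) :
  measurable_fun [set: R * n.-tuple R] (tuple_insert j).
Proof.
apply: measurable_mktuple => i; case: unlift => [k|]; last exact: measurable_fst.
exact: (measurableT_comp (measurable_tnth k)).
Qed.

Lemma measurable_tuple_remove n (j : 'I_n.+1) :
  measurable_fun [set: n.+1.-tuple R] (tuple_remove j).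
Proof. by apply: measurable_mktuple => i; exact: measurable_tnth. Qed.

Lemma lebesgue_tuple_scale n (s : R) (E : set (n.-tuple R)) : 0 < s ->
  measurable E ->
  (lebesgue_tuple R n (tuple_scale s @^-1` E) = (s ^- n)%:E * lebesgue_tuple R n E)%E.
Proof.
move=> s0 mE.
have sn0 : 0 <= s ^+ n by rewrite exprn_ge0 ?ltW.
pose nu := mscale (NngNum sn0) (push_on (lebesgue_tuple R n) measurableT
  (@measurable_tuple_scale n s)).
have nuE B : nu B = ((s ^+ n)%:E * lebesgue_tuple R n (tuple_scale s @^-1` B))%E.
  by rewrite -[LHS]/(_ * lebesgue_tuple R n (_ `&` setT))%E setIT.
have -> : lebesgue_tuple R n E = nu E.
  apply/esym; apply: lebesgue_tuple_unique => // A mA; apply: (etrans (nuE _)).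
  rewrite (_ : _ @^-1` _ = [set x | forall i, ( *%R s @^-1` A i) (tnth x i)]).
    rewrite (lebesgue_tuple_box (A := fun i => *%R s @^-1` A i)); last first.
      move=> i; rewrite -[_ @^-1` _]setTI.
      have ms : measurable_fun [set: R] ( *%R s) by exact: measurable_funM.
      exact: ms.
    rewrite (eq_bigr (fun i => s^-1%:E * lebesgue_measure (A i))%E); last first.
      by move=> i _; rewrite lebesgue_measure_scale.
    rewrite big_split/= prodEFin prodr_const card_ord muleA -EFinM exprVn.
    by rewrite mulfV ?mul1e// expf_neq0// gt_eqF.
  by apply/seteqP; split => x /= h i; move: (h i); rewrite tnth_scale.
by rewrite nuE muleA -EFinM mulVf ?mul1e// expf_neq0// gt_eqF.
Qed.

Lemma ge0_integral_tuple_flip n (j : 'I_n) (F : n.-tuple R -> \bar R) :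
  measurable_fun [set: n.-tuple R] F -> (forall x, 0 <= F x)%E ->
  (\int[lebesgue_tuple R n]_x F (tuple_flip j x) = \int[lebesgue_tuple R n]_x F x)%E.
Proof.
apply: ge0_integral_lebesgue_tuple; first exact: measurable_tuple_flip.
move=> A mA.
pose B (i : 'I_n) : set R := if i == j then -%R @^-1` A i else A i.
rewrite (_ : _ @^-1` _ = [set x : n.-tuple R | forall i : 'I_n, B i (tnth x i)]).
  apply: etrans; first apply: (lebesgue_tuple_box (A := B)).
    move=> i; rewrite /B; case: eqP => // _; rewrite -[_ @^-1` _]setTI.
    by have mN : measurable_fun [set: R] -%R by []; exact: mN.
  apply: eq_bigr => i _; rewrite /B; case: eqP => // _.
  exact: (lebesgue_measureN (mA i)).
apply/seteqP; split => x /= h i; move: (h i); rewrite tnth_flip /B;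
  by case: eqP.
Qed.

(** Tonelli with the j-th coordinate singled out instead of the first. Boxes decide, and their mass
    does not depend on the order of the factors. *)
Lemma ge0_integral_tuple_insert n (j : 'I_n.+1) (F : n.+1.-tuple R -> \bar R) :
  measurable_fun [set: n.+1.-tuple R] F -> (forall x, 0 <= F x)%E ->
  (\int[lebesgue_tuple R n.+1]_x F x =
   \int[lebesgue_tuple R n]_y \int[lebesgue_measure]_x F (tuple_insert j (x, y)))%E.
Proof.
move=> mF F0.
have mFi : measurable_fun [set: measurableTypeR R * n.-tuple R]
    (fun z => F (tuple_insert j z)).
  exact: (measurableT_comp mF (measurable_tuple_insert j)).
transitivity (\int[lebesgue_measure \x lebesgue_tuple R n]_z
    F (tuple_insert j z))%E; last first.
  exact: (fubini_tonelli2 _ mFi (fun z => F0 _)).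
apply/esym; apply: ge0_integral_lebesgue_tuple => //.
  exact: measurable_tuple_insert.
move=> A mA.
pose B : set (n.-tuple R) := [set y | forall k, A (lift j k) (tnth y k)].
rewrite (_ : _ @^-1` _ = A j `*` B).
  have mB : measurable B.
    by apply: (@measurable_tuple_box _ _ (fun k => A (lift j k))) => k.
  transitivity (lebesgue_measure (A j) * lebesgue_tuple R n B)%E.
    apply: (product_measure1E (@lebesgue_measure R) (lebesgue_tuple R n) _ mB).
    exact: (mA j).
  rewrite [in RHS](bigD1_ord j)//=; congr (_ * _)%E.
  by rewrite -lebesgue_tuple_box.
apply/seteqP; split => -[x y] /=.
  move=> h; split; first by move: (h j); rewrite tnth_insert.
  by move=> k; move: (h (lift j k)); rewrite tnth_insert_lift.
move=> [hx hy] i; case: (unliftP j i) => [k|] ->; first by rewrite tnth_insert_lift.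
by rewrite tnth_insert.
Qed.

End tuple_maps.

(** * Polar coordinates: the direction and the p-th power of the norm *)

Section lp_polar.
Context {R : realType} (p : R) (p0 : 0 < p) (n : nat).
Implicit Types x : n.-tuple R.

(** The radius is kept as a p-th power: in this form coordinates add up, and the radial law is a
    multiple of [power_measure (n / p)]. *)
Definition lp_pow x : R := \sum_(i < n) `|tnth x i| `^ p.

Definition lp_dir x : n.-tuple R := tuple_scale (lp_pow x `^ (- p^-1)) x.

Lemma lp_pow_ge0 x : 0 <= lp_pow x.
Proof. by apply: sumr_ge0 => i _; exact: powR_ge0. Qed.

Lemma measurable_lp_pow : measurable_fun [set: n.-tuple R] lp_pow.
Proof.
apply: measurable_sum => i; apply: (measurableT_comp (measurable_powR _)).
by apply: measurableT_comp => //; exact: measurable_tnth.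
Qed.

Lemma measurable_lp_dir : measurable_fun [set: n.-tuple R] lp_dir.
Proof.
apply: measurable_mktuple => i; apply: measurable_funM; last exact: measurable_tnth.
exact: (measurableT_comp (measurable_powR _) measurable_lp_pow).
Qed.

Lemma lp_pow_scale (s : R) x : 0 <= s -> lp_pow (tuple_scale s x) = s `^ p * lp_pow x.
Proof.
move=> s0; rewrite /lp_pow mulr_sumr; apply: eq_bigr => i _.
by rewrite tnth_scale normrM (ger0_norm s0) powRM.
Qed.

Lemma lp_dir_scale (s : R) x : 0 < s -> lp_dir (tuple_scale s x) = lp_dir x.
Proof.
move=> s0; apply: eq_from_tnth => i.
rewrite !tnth_scale lp_pow_scale ?ltW// powRM ?powR_ge0 ?lp_pow_ge0//.
rewrite -powRrM mulrN mulfV ?gt_eqF// powR_inv1 ?ltW//.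
by rewrite mulrACA mulrA mulVf ?mul1r ?gt_eqF// mulrC.
Qed.

Lemma lp_pow_dir x : 0 < lp_pow x -> lp_pow (lp_dir x) = 1.
Proof.
move=> N0; rewrite lp_pow_scale ?powR_ge0// -powRrM mulNr mulVf ?gt_eqF//.
by rewrite powR_inv1 ?ltW// mulVf// gt_eqF.
Qed.

Lemma tnth_lp_dir x i : tnth (lp_dir x) i = lp_pow x `^ (- p^-1) * tnth x i.
Proof. by rewrite tnth_scale. Qed.

Lemma lp_coord_le x i : `|tnth x i| `^ p <= lp_pow x.
Proof.
rewrite /lp_pow (bigD1 i)//= lerDl.
by apply: sumr_ge0 => j _; exact: powR_ge0.
Qed.

Lemma lp_coord_le1 x i : lp_pow x <= 1 -> `|tnth x i| <= 1.
Proof.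
move=> h; rewrite leNgt; apply/negP => x1.
have := le_trans (lp_coord_le x i) h; rewrite leNgt => /negP; apply.
have := gt0_ltr_powR p0 _ _ x1; rewrite !nnegrE powR1; apply => //.
Qed.

Hypothesis n0 : (0 < n)%N.

Let lambda : {measure set (n.-tuple R) -> \bar R} := lebesgue_tuple R n.

Lemma lebesgue_tuple_lp_pow0 : lambda [set x | lp_pow x <= 0] = 0%E.
Proof.
rewrite (_ : [set _ | _] = [set x : n.-tuple R | forall i : 'I_n, [set 0] (tnth x i)]).
  apply: etrans; first exact: (lebesgue_tuple_box (A := fun=> [set 0])).
  by rewrite (bigD1 (Ordinal n0))//= lebesgue_measure_set1 mul0e.
apply/seteqP; split => x /= h.
  move=> i; have := le_trans (lp_coord_le x i) h.
  by rewrite le_eqVlt ltNge powR_ge0 orbF => /eqP /powR_eq0_eq0/normr0_eq0.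
by rewrite /lp_pow big1// => i _; rewrite h normr0 powR0// gt_eqF.
Qed.

(** The infinite cone over A without its apex. Its measurability is immediate from that of A, which
    is not so for [cone A]. *)
Let sector (A : set (n.-tuple R)) := [set x | 0 < lp_pow x /\ A (lp_dir x)].

Let msector A : measurable A -> measurable (sector A).
Proof.
move=> mA; apply: measurableI.
  by apply: measurable_set_ltr => //; exact: measurable_lp_pow.
by rewrite -[X in measurable X]setTI; exact: measurable_lp_dir.
Qed.

Let mlevel t : measurable [set x | lp_pow x <= t].
Proof. exact: measurable_sublevel measurable_lp_pow. Qed.

Lemma lebesgue_tuple_lp_ball_lty : (lambda (@lp_ball R p n) < +oo)%E.
Proof.
pose B (i : 'I_n) : set R := `[-1, 1]%classic.
have mB i : measurable (B i) by exact: measurable_itv.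
apply: (@le_lt_trans _ _ (lambda [set x | forall i, B i (tnth x i)])).
  apply: le_measure; rewrite ?inE//.
  - exact: mlevel.
  - exact: measurable_tuple_box mB.
  - move=> x /= h i; rewrite /B/= in_itv/= -ler_norml.
    exact: lp_coord_le1.
rewrite [ltLHS](lebesgue_tuple_box mB).
rewrite (eq_bigr (fun=> 2%:E))%E; first by rewrite prodEFin ltry.
move=> i _; rewrite lebesgue_measure_itv/= lte_fin ifT; last by lra.
by rewrite -EFinB; congr EFin; lra.
Qed.

Lemma lebesgue_tuple_lp_ball_gt0 : (0 < lambda (@lp_ball R p n))%E.
Proof.
pose e : R := n%:R^-1 `^ p^-1.
have e0 : 0 < e by rewrite powR_gt0// invr_gt0 ltr0n.
pose B (i : 'I_n) : set R := `[- e, e]%classic.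
have mB i : measurable (B i) by exact: measurable_itv.
apply: (@lt_le_trans _ _ (lambda [set x | forall i, B i (tnth x i)])).
  rewrite [ltRHS](lebesgue_tuple_box mB).
  rewrite (eq_bigr (fun=> (2 * e)%:E)).
    by rewrite prodEFin lte_fin prodr_gt0// => i _; rewrite mulr_gt0.
  move=> i _; rewrite lebesgue_measure_itv/= lte_fin ifT; last by lra.
  by rewrite -EFinB; congr EFin; lra.
apply: le_measure; rewrite ?inE//.
- exact: measurable_tuple_box mB.
- exact: mlevel.
- move=> x /= h.
  apply: (@le_trans _ _ (\sum_(i < n) n%:R^-1)); last first.
    by rewrite sumr_const card_ord -[_ *+ n]mulr_natr mulVf// pnatr_eq0 -lt0n.
  apply: ler_sum => i _; have := h i; rewrite /B/= in_itv/= -ler_norml => hi.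
  have -> : n%:R^-1 = e `^ p.
    by rewrite /e -powRrM mulVf ?gt_eqF// powRr1// invr_ge0 ler0n.
  by rewrite ge0_ler_powR ?nnegrE ?(ltW p0) ?(ltW e0).
Qed.

Section cone_law.
Variable Q : probability (n.-tuple R) R.
Hypothesis Qcone : forall A, measurable A -> A `<=` @lp_sphere R p n ->
  Q A = cone_measure p A.

Definition ball_volume : R := fine (lebesgue_tuple R n (@lp_ball R p n)).

Lemma ball_volume_gt0 : 0 < ball_volume.
Proof.
by rewrite fine_gt0// lebesgue_tuple_lp_ball_gt0 lebesgue_tuple_lp_ball_lty.
Qed.

Let ball_volumeE : lambda (@lp_ball R p n) = ball_volume%:E.
Proof.
rewrite fineK// ge0_fin_numE ?measure_ge0//.
exact: lebesgue_tuple_lp_ball_lty.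
Qed.

Let coneE (A : set (n.-tuple R)) : A `<=` @lp_sphere R p n ->
  sector A `&` [set x | lp_pow x <= 1] `<=` cone A /\
  cone A `<=` (sector A `&` [set x | lp_pow x <= 1]) `|` [set x | lp_pow x <= 0].
Proof.
move=> AS; split.
  move=> x [[/= x0 Ax] x1]; exists (lp_pow x `^ p^-1).
    rewrite /= in_itv/= powR_ge0/= -(powRr0 (lp_pow x)).
    by rewrite ger_powR ?x0// invr_ge0 ltW.
  exists (lp_dir x) => //; apply: eq_from_tnth => i.
  rewrite tnth_mktuple tnth_lp_dir mulrA -powRD ?subrr ?powRr0 ?mul1r//.
  by rewrite (gt_eqF x0) implybT.
move=> _ [t t01 [a Aa <-]]; move: t01; rewrite /= in_itv/= => /andP[t0 t1].
have Na : lp_pow a = 1 by exact: AS Aa.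
rewrite -/(tuple_scale t a).
move: t0; rewrite le_eqVlt => /predU1P[<-|t0].
  by right; rewrite /= lp_pow_scale// powR0 ?mul0r// gt_eqF.
left; split; last first.
  rewrite /= lp_pow_scale ?(ltW t0)// Na mulr1.
  by have := ge0_ler_powR (ltW p0) _ _ t1; rewrite !nnegrE powR1 ltW//; apply.
split.
  by rewrite lp_pow_scale ?(ltW t0)// Na mulr1 powR_gt0.
rewrite lp_dir_scale// (_ : lp_dir a = a)//.
by apply: eq_from_tnth => i; rewrite tnth_lp_dir Na powR1 mul1r.
Qed.

(** The two sets differ at most by the origin, which is null. An empty A is treated apart, since its
    cone does not contain the origin. *)
Let lambda_cone (A : set (n.-tuple R)) : measurable A -> A `<=` @lp_sphere R p n ->
  lambda (cone A) = lambda (sector A `&` [set x | lp_pow x <= 1]).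
Proof.
move=> mA AS; have [c1 c2] := coneE AS.
set E := sector A `&` _ in c1 c2 *.
have mE : measurable E by apply: measurableI; [exact: msector|exact: mlevel].
have [A0|/set0P[a Aa]] := eqVneq A set0.
  have cone0 : cone (set0 : set (n.-tuple R)) = set0.
    by apply/seteqP; split => x // -[t _ []].
  have E0 : E = set0 by apply/seteqP; split => // x /c1; rewrite A0 cone0.
  by rewrite E0 A0 cone0.
have cE : cone A = E `|` [set x | lp_pow x <= 0].
  apply/seteqP; split => // x [/c1//|/= x0].
  exists 0; first by rewrite /= in_itv/= lexx ler01.
  exists a => //; apply: eq_from_tnth => i; rewrite tnth_mktuple mul0r.
  have := le_trans (lp_coord_le x i) x0.
  by rewrite le_eqVlt ltNge powR_ge0 orbF => /eqP /powR_eq0_eq0/normr0_eq0.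
apply/eqP; rewrite eq_le; apply/andP; split.
  rewrite cE.
  apply: (@le_trans _ _ (lambda E + lambda [set x | (lp_pow x <= 0)%R])%E).
    exact: measureU2.
  by rewrite lebesgue_tuple_lp_pow0 adde0.
by apply: le_measure; rewrite ?inE// cE; apply: measurableU.
Qed.

Lemma cone_law_sector (A : set (n.-tuple R)) : measurable A ->
  A `<=` @lp_sphere R p n ->
  lambda (sector A `&` [set x | lp_pow x <= 1]) = (ball_volume%:E * Q A)%E.
Proof.
move=> mA AS; rewrite -lambda_cone// Qcone// /cone_measure -/lambda.
rewrite ball_volumeE muleCA inver gt_eqF ?ball_volume_gt0// -EFinM mulfV ?mule1//.
by rewrite gt_eqF ?ball_volume_gt0.
Qed.

Let msphere : measurable (@lp_sphere R p n).
Proof.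
rewrite (_ : @lp_sphere R p n = lp_pow @^-1` [set 1]).
  by rewrite -[X in measurable X]setTI; exact: measurable_lp_pow.
by apply/seteqP; split.
Qed.

(** [Qcone] speaks only of subsets of the sphere, so that Q lives on the sphere has to be derived.
    The sector over the whole sphere, cut at radius 1, is the ball up to a null set, so Q gives the
    sphere mass 1. *)
Lemma cone_law_sphere : Q (@lp_sphere R p n) = 1%E.
Proof.
have := cone_law_sector msphere (fun _ h => h).
have mE : measurable (sector (@lp_sphere R p n) `&` [set x | lp_pow x <= 1]).
  by apply: measurableI => //; exact: msector.
have -> : lambda (sector (@lp_sphere R p n) `&` [set x | lp_pow x <= 1]) =
    ball_volume%:E.
  rewrite -ball_volumeE; apply/eqP; rewrite eq_le; apply/andP; split.
    by apply: le_measure; rewrite ?inE//; exact: mlevel.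
  apply: (@le_trans _ _ (lambda (sector (@lp_sphere R p n) `&`
    [set x | (lp_pow x <= 1)%R]) + lambda [set x | (lp_pow x <= 0)%R])%E); last first.
    by rewrite lebesgue_tuple_lp_pow0 adde0.
  apply: (@le_trans _ _ (lambda ((sector (@lp_sphere R p n) `&`
    [set x | (lp_pow x <= 1)%R]) `|` [set x | (lp_pow x <= 0)%R]))%E); last first.
    exact: measureU2.
  apply: le_measure; rewrite ?inE//.
  - exact: mlevel.
  - exact: measurableU.
  - move=> x x1; have [x0|x0] := leP (lp_pow x) 0; first by right.
    by left; do 2 split => //; exact: lp_pow_dir.
have Qf : Q (@lp_sphere R p n) \is a fin_num by exact: fin_num_measure.
rewrite -(fineK Qf) -EFinM => -[e]; congr EFin.
by apply: (mulfI (lt0r_neq0 ball_volume_gt0)); rewrite mulr1 -e.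
Qed.

Let Qsphere (A : set (n.-tuple R)) : measurable A -> Q A = Q (A `&` @lp_sphere R p n).
Proof.
move=> mA; apply/eqP; rewrite eq_le; apply/andP; split; last first.
  by apply: le_measure; rewrite ?inE//; exact: measurableI.
have mAS : measurable (A `&` @lp_sphere R p n) by exact: measurableI.
have mSC : measurable (~` @lp_sphere R p n) by exact: measurableC.
apply: (@le_trans _ _ (Q (A `&` @lp_sphere R p n) + Q (~` @lp_sphere R p n))%E).
  apply: (@le_trans _ _ (Q ((A `&` @lp_sphere R p n) `|` ~` @lp_sphere R p n))).
    apply: le_measure; rewrite ?inE//; first exact: measurableU.
    by move=> x Ax; have [xS|xS] := pselect (@lp_sphere R p n x); [left|right].
  exact: measureU2.
by rewrite probability_setC// cone_law_sphere subee// adde0.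
Qed.

(** Scaling by t^(1/p) takes the part of the sector in the unit ball to the part with [lp_pow] at
    most t, and multiplies volumes by t^(n/p). *)
Lemma ge0_integral_sector (A : set (n.-tuple R)) (phi : R -> \bar R) :
  measurable A -> measurable_fun [set: R] phi -> (forall y, 0 <= phi y)%E ->
  (\int[lambda]_(x in sector A) phi (lp_pow x) =
   ball_volume%:E * Q A * \int[power_measure (n%:R / p)]_t phi t)%E.
Proof.
move=> mA mphi phi0.
have AS : sector A = sector (A `&` @lp_sphere R p n).
  apply/seteqP; split => x [x0 Ax]; split => //; last by case: Ax.
  by split => //; exact: lp_pow_dir.
have np0 : 0 < n%:R / p :> R by rewrite divr_gt0 ?ltr0n.
have msA : measurable (A `&` @lp_sphere R p n) by exact: measurableI.
have l1 : lambda (sector A `&` [set x | lp_pow x <= 1]) = (ball_volume%:E * Q A)%E.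
  by rewrite AS cone_law_sector// -Qsphere.
have QAf : Q A \is a fin_num by exact: fin_num_measure.
rewrite -(fineK QAf) -EFinM; apply: ge0_integral_power_law => //.
- by rewrite mulr_ge0 ?fine_ge0// ltW// ball_volume_gt0.
- exact: msector.
- exact: measurable_lp_pow.
- rewrite (_ : _ `&` _ = set0) ?measure0//.
  by apply/seteqP; split => x //= -[[+ _]]; rewrite ltNge => /negP.
move=> t t0; pose s : R := t `^ p^-1.
have s0 : 0 < s by rewrite powR_gt0.
have mE : measurable (sector A `&` [set x | lp_pow x <= t]).
  by apply: measurableI => //; exact: msector.
have := lebesgue_tuple_scale s0 mE.
rewrite (_ : _ @^-1` _ = sector A `&` [set x | lp_pow x <= 1]); last first.
  have sp : s `^ p = t by rewrite -powRrM mulVf ?gt_eqF// powRr1// ltW.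
  apply/seteqP; split => x [[/= x0 Ax] xt].
    move: x0 Ax xt; rewrite lp_dir_scale// lp_pow_scale ?(ltW s0)// sp pmulr_rgt0//.
    by move=> x0 Ax; rewrite ger_pMr.
  split; [split; [|by rewrite lp_dir_scale]|].
    by rewrite lp_pow_scale ?(ltW s0)// sp pmulr_rgt0.
  by rewrite /= lp_pow_scale ?(ltW s0)// sp ger_pMr.
rewrite -/lambda l1 => e.
have -> : t `^ (n%:R / p) = s ^+ n.
  by rewrite -powR_mulrn ?(ltW s0)// -powRrM mulrC.
transitivity ((s ^+ n)%:E * (ball_volume%:E * Q A))%E.
  by rewrite e muleA -EFinM mulfV ?mul1e// expf_neq0// gt_eqF.
by rewrite -[in LHS](fineK QAf) -!EFinM mulrC.
Qed.

(** Direction and radius are independent: [ge0_integral_sector] shows that the normalized image of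
    Lebesgue measure agrees with the product of Q and the radial measure on rectangles, and such a
    measure is unique. *)
Lemma ge0_integral_polar (Phi : n.-tuple R * R -> \bar R) :
  measurable_fun [set: n.-tuple R * R] Phi -> (forall z, 0 <= Phi z)%E ->
  (\int[lambda]_x Phi (lp_dir x, lp_pow x) =
   ball_volume%:E * \int[Q]_u \int[power_measure (n%:R / p)]_t Phi (u, t))%E.
Proof.
move=> mPhi Phi0; have c0 := ball_volume_gt0.
have ci0 : 0 <= ball_volume^-1 by rewrite invr_ge0 ltW.
have mpos : measurable [set x | 0 < lp_pow x].
  by apply: measurable_set_ltr => //; exact: measurable_lp_pow.
have mpol : measurable_fun [set: n.-tuple R] (fun x => (lp_dir x, lp_pow x)).
  apply/measurable_fun_pairP; split; first exact: measurable_lp_dir.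
  exact: measurable_lp_pow.
pose m' := mscale (NngNum ci0) (push_on lambda mpos mpol).
have m'E X : measurable X -> (Q \x power_measure (n%:R / p))%E X = m' X.
  apply: product_measure_unique => A B mA mB.
  pose u (t : R) : \bar R := (\1_B t : R)%:E.
  have mu : measurable_fun [set: R] u by exact/measurable_EFinP/measurable_indic.
  have u0 t : (0 <= u t)%E by rewrite lee_fin.
  have := ge0_integral_sector mA mu u0.
  have -> : (\int[power_measure (n%:R / p)]_t u t = power_measure (n%:R / p) B)%E.
    by rewrite integral_indic// setIT.
  move=> e; transitivity ((ball_volume^-1)%:E * (\int[lambda]_(x in sector A) u (lp_pow x)))%E.
    transitivity ((ball_volume^-1)%:E * lambda ((lp_pow @^-1` B) `&` sector A))%E.
      rewrite -[LHS]/((ball_volume^-1)%:E * lambda (_ `&` _))%E.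
      by congr (_ * lambda _)%E; apply/seteqP; split => x /=; [move=> [[? ?] ?]|move=> [? [? ?]]].
    congr (_ * _)%E; rewrite -integral_indic//.
      exact: msector.
    by rewrite -[X in measurable X]setTI; exact: measurable_lp_pow.
  by rewrite e !muleA -EFinM mulVf ?gt_eqF// mul1e.
transitivity (\int[lambda]_(x in [set x | (0 < lp_pow x)%R]) Phi (lp_dir x, lp_pow x))%E.
  have mP : measurable_fun [set: n.-tuple R] (fun x => Phi (lp_dir x, lp_pow x)).
    exact: (measurableT_comp mPhi mpol).
  rewrite -[in LHS](setUv [set x | 0 < lp_pow x]) ge0_integral_setU//=; last 3 first.
  - exact: measurableC.
  - by rewrite setUv.
  - exact/disj_set2P/setICr.
  rewrite [X in (_ + X)%E](null_set_integral _ _)//; last 3 first.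
  - exact: measurableC.
  - exact: measurable_funTS.
  - rewrite (_ : ~` _ = [set x | lp_pow x <= 0]); first exact: lebesgue_tuple_lp_pow0.
    by apply/seteqP; split => x /=; rewrite leNgt => /negP.
  by rewrite adde0.
have -> : (\int[Q]_u \int[power_measure (n%:R / p)]_t Phi (u, t) =
    \int[Q \x power_measure (n%:R / p)]_z Phi z)%E.
  by rewrite fubini_tonelli1.
rewrite (eq_measure_integral m'); last by move=> X mX _; exact: m'E.
rewrite ge0_integral_mscale// ge0_integral_push_on// muleA -EFinM mulfV ?mul1e//.
by rewrite gt_eqF.
Qed.

End cone_law.

End lp_polar.

(** * One coordinate against the others *)

Section lp_coordinate.
Context {R : realType} (p : R) (p0 : 0 < p) (m : nat).
Implicit Types (j : 'I_m.+1).

Let pV0 : 0 < p^-1. Proof. by rewrite invr_gt0. Qed.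

(** The set where |x|^p <= t is an interval of length 2 t^(1/p). *)
Lemma ge0_integral_norm_powR (phi : R -> \bar R) :
  measurable_fun [set: R] phi -> (forall y, 0 <= phi y)%E ->
  (\int[lebesgue_measure]_x phi (`|x| `^ p)%R =
   2%:E * \int[power_measure p^-1]_u phi u)%E.
Proof.
move=> mphi phi0.
have nbE (t : R) : 0 <= t -> [set: R] `&` [set x : R | `|x| `^ p <= t] =
    `[- (t `^ p^-1), t `^ p^-1]%classic.
  move=> t0; rewrite setTI; apply/seteqP; split => x /=; rewrite in_itv/= -ler_norml.
    by rewrite -{1}[p]invrK ler_powRV.
  by rewrite -[X in _ -> (_ `^ X <= _)]invrK ler_powRV.
have mu0 (t : R) : 0 <= t -> lebesgue_measure ([set: R] `&` [set x : R | `|x| `^ p <= t]) =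
    (2 * t `^ p^-1)%:E.
  move=> t0; rewrite nbE// lebesgue_measure_itv/= lte_fin.
  have := powR_ge0 t p^-1; case: ltP => h h0.
    by rewrite -EFinB; congr EFin; ring.
  by congr EFin; lra.
apply: (@ge0_integral_power_law _ _ _ (@lebesgue_measure R) setT (fun x : R => `|x| `^ p)) => //.
- apply: (measurableT_comp (measurable_powR _)); exact: normr_measurable.
- by apply: (etrans (mu0 0 (lexx 0))); rewrite powR0 ?mulr0// gt_eqF.
- by move=> t t0; exact: (mu0 t (ltW t0)).
Qed.

Lemma lp_pow_remove j (x : m.+1.-tuple R) :
  lp_pow p x = `|tnth x j| `^ p + lp_pow p (tuple_remove j x).
Proof.
rewrite /lp_pow (bigD1_ord j)//=; congr (_ + _).
by apply: eq_bigr => k _; rewrite tnth_remove.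
Qed.

Lemma ge0_integral_lp_coord j (G : R * m.-tuple R -> \bar R) :
  measurable_fun [set: R * m.-tuple R] G -> (forall z, 0 <= G z)%E ->
  (\int[lebesgue_tuple R m.+1]_x G (`|tnth x j| `^ p, tuple_remove j x)%R =
   2%:E * \int[lebesgue_tuple R m]_y \int[power_measure p^-1]_u G (u, y))%E.
Proof.
move=> mG G0.
have mGx : measurable_fun [set: m.+1.-tuple R]
    (fun x => G (`|tnth x j| `^ p, tuple_remove j x)%R).
  apply: (measurableT_comp mG); apply/measurable_fun_pairP; split.
    apply: (measurableT_comp (measurable_powR p)).
    by apply: (measurableT_comp (@normr_measurable R setT)); exact: measurable_tnth.
  exact: measurable_tuple_remove.
rewrite (ge0_integral_tuple_insert j mGx)//.
have mGy (y : m.-tuple R) : measurable_fun [set: R] (fun u => G (u, y)).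
  exact: (measurableT_comp mG (measurable_pair2 y)).
rewrite -ge0_integralZl//.
- apply: eq_integral => y _.
  rewrite -(ge0_integral_norm_powR (mGy y) (fun u => G0 (u, y))).
  by apply: eq_integral => x _; rewrite tnth_insert tuple_insertK.
- exact: (measurable_fun_fubini_tonelli_G (m1 := power_measure p^-1) _ mG G0).
- by move=> y _; exact: integral_ge0.
Qed.

(** Weighting the exponent a by u^b and adding an independent variable of exponent b both lead to
    the exponent a + b. Each side carries the constant of the other operation. *)
Lemma ge0_integral_lp_coord_bias j (b : R) (H : R * m.-tuple R -> \bar R) : 0 < b ->
  measurable_fun [set: R * m.-tuple R] H -> (forall z, 0 <= H z)%E ->
  let a := p^-1 in
  ((a * Gamma a * (b * Gamma b) / ((a + b) * Gamma (a + b)))%:E *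
     \int[lebesgue_tuple R m.+1]_x
       (((`|tnth x j| `^ p) `^ b)%:E * H (`|tnth x j| `^ p, tuple_remove j x)%R) =
   (a / (a + b))%:E *
     \int[lebesgue_tuple R m.+1]_x \int[power_measure b]_g
       H (`|tnth x j| `^ p + g, tuple_remove j x)%R)%E.
Proof.
move=> b0 mH H0 a.
have ab0 : 0 < a + b by rewrite addr_gt0.
have mHy (y : m.-tuple R) : measurable_fun [set: R] (fun u => H (u, y)).
  exact: (measurableT_comp mH (measurable_pair2 y)).
have mI (e : R) : measurable_fun [set: m.-tuple R]
    (fun y => \int[power_measure e]_u H (u, y))%E.
  exact: (measurable_fun_fubini_tonelli_G (m1 := power_measure e) _ mH H0).
have I0 (e : R) (y : m.-tuple R) : (0 <= \int[power_measure e]_u H (u, y))%E.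
  by apply: integral_ge0 => u _.
pose G (z : R * m.-tuple R) := ((z.1 `^ b)%:E * H z)%E.
have mG : measurable_fun [set: R * m.-tuple R] G.
  apply: emeasurable_funM => //; apply/measurable_EFinP.
  exact: (measurableT_comp (measurable_powR b) measurable_fst).
have G0 z : (0 <= G z)%E by rewrite mule_ge0// lee_fin powR_ge0.
rewrite (ge0_integral_lp_coord j mG G0).
have -> : (\int[lebesgue_tuple R m]_y \int[power_measure p^-1]_u G (u, y) =
    (a / (a + b))%:E * \int[lebesgue_tuple R m]_y \int[power_measure (a + b)]_u H (u, y))%E.
  have c0 : (0 <= (a / (a + b))%:E)%E by rewrite lee_fin divr_ge0// ltW.
  rewrite -(ge0_integralZl _ measurableT (mI (a + b)) (fun y _ => I0 _ y) c0).
  apply: eq_integral => y _.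
  exact: (ge0_integral_power_weight pV0 (ltW b0) (mHy y) (fun u => H0 (u, y))).
pose K (z : R * m.-tuple R) := (\int[power_measure b]_g H (z.1 + g, z.2)%R)%E.
have mK : measurable_fun [set: R * m.-tuple R] K.
  have mH' : measurable_fun [set: (R * m.-tuple R) * R] (fun w => H (w.1.1 + w.2, w.1.2)).
    apply: (measurableT_comp mH); apply/measurable_fun_pairP; split.
      apply: measurable_funD => //.
      exact: (measurableT_comp measurable_fst measurable_fst).
    exact: (measurableT_comp measurable_snd measurable_fst).
  exact: (measurable_fun_fubini_tonelli_F (m2 := power_measure b) _ mH' (fun=> H0 _)).
have K0 z : (0 <= K z)%E by apply: integral_ge0 => g _.
rewrite (ge0_integral_lp_coord j mK K0).
set c := _ / _.
have c0 : (0 <= c%:E)%E.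
  by rewrite lee_fin /c divr_ge0 ?mulr_ge0 ?ltW// Gamma_gt0.
have -> : (\int[lebesgue_tuple R m]_y \int[power_measure p^-1]_u K (u, y) =
    c%:E * \int[lebesgue_tuple R m]_y \int[power_measure (a + b)]_u H (u, y))%E.
  rewrite -(ge0_integralZl _ measurableT (mI (a + b)) (fun y _ => I0 _ y) c0).
  apply: eq_integral => y _.
  exact: (power_conv_Gamma pV0 b0 (mHy y) (fun u => H0 (u, y))).
by rewrite muleCA [RHS]muleCA; congr (_ * _)%E; rewrite muleCA.
Qed.

End lp_coordinate.

(** Cancellation in [\bar R]: the second equation forces y, hence x, to be finite. *)
Lemma eq_mule_ratio (R : realType) (x y : \bar R) (A B C D : R) :
  A != 0 -> D != 0 -> (A%:E * x = C%:E * y)%E -> (B%:E = D%:E * y)%E ->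
  x = (C * B / (D * A))%:E.
Proof.
move=> A0 D0 ex ey.
have -> : x = (A^-1%:E * (C%:E * y))%E by rewrite -ex muleA -EFinM mulVf ?mul1e.
have -> : y = (D^-1 * B)%:E by rewrite EFinM ey muleA -EFinM mulVf ?mul1e.
by rewrite -!EFinM; congr EFin; field; rewrite A0 D0.
Qed.

(** * Symmetry and moments of the cone law *)

Section cone_law_moments.
Context {R : realType} (p : R) (p0 : 0 < p) (m : nat).
Variable Q : probability (m.+1.-tuple R) R.
Hypothesis Qcone : forall A, measurable A -> A `<=` @lp_sphere R p m.+1 ->
  Q A = cone_measure p A.
Implicit Types (j : 'I_m.+1) (x u : m.+1.-tuple R).

Let lambda : {measure set (m.+1.-tuple R) -> \bar R} := lebesgue_tuple R m.+1.
Let vol : R := ball_volume p m.+1.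

Let vol0 : 0 < vol. Proof. by rewrite ball_volume_gt0. Qed.
Let pV0 : 0 < p^-1. Proof. by rewrite invr_gt0. Qed.
Let np0 : 0 < m.+1%:R / p. Proof. by rewrite divr_gt0 ?ltr0n. Qed.

Let mN := @measurable_lp_pow R p m.+1.
Let mdir := @measurable_lp_dir R p m.+1.

Let mexpRN : measurable_fun [set: R] (fun y : R => (expR (- y))%:E).
Proof. by apply/measurable_EFinP; apply: measurableT_comp. Qed.

(** The bridge to independent coordinates: exp(-[lp_pow] x) is a product over the coordinates, while
    in polar form the radial factor integrates to a Gamma value and leaves the cone law. *)
Lemma ge0_integral_cone_law (b : R) (g : m.+1.-tuple R -> \bar R) : 0 <= b ->
  measurable_fun [set: m.+1.-tuple R] g -> (forall u, 0 <= g u)%E ->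
  (\int[lambda]_x (g (lp_dir p x) * (lp_pow p x `^ b * expR (- lp_pow p x))%:E) =
   (vol * (m.+1%:R / p * Gamma (m.+1%:R / p + b)))%:E * \int[Q]_u g u)%E.
Proof.
move=> b0 mg g0.
pose Phi (z : m.+1.-tuple R * R) := (g z.1 * (z.2 `^ b * expR (- z.2))%:E)%E.
have mw : measurable_fun [set: R] (fun t : R => (t `^ b * expR (- t))%:E).
  apply/measurable_EFinP; apply: measurable_funM; first exact: measurable_powR.
  exact: measurableT_comp.
have w0 (t : R) : (0 <= (t `^ b * expR (- t))%:E)%E.
  by rewrite lee_fin mulr_ge0 ?powR_ge0 ?expR_ge0.
have mPhi : measurable_fun [set: m.+1.-tuple R * R] Phi.
  apply: emeasurable_funM; first exact: (measurableT_comp mg measurable_fst).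
  exact: (measurableT_comp mw measurable_snd).
have Phi0 z : (0 <= Phi z)%E by rewrite mule_ge0.
rewrite -[LHS]/(\int[lambda]_x Phi (lp_dir p x, lp_pow p x))%E.
rewrite (ge0_integral_polar p0 _ Qcone mPhi Phi0)// EFinM -muleA; congr (_ * _)%E.
have c0 : (0 <= (m.+1%:R / p * Gamma (m.+1%:R / p + b))%:E)%E.
  by rewrite lee_fin mulr_ge0 ?ltW// Gamma_gt0// ltr_wpDr.
rewrite -(ge0_integralZl _ measurableT mg (fun u _ => g0 u) c0).
apply: eq_integral => u _.
rewrite (ge0_integralZl _ measurableT mw (fun t _ => w0 t) (g0 u)) muleC.
by congr (_ * _)%E; rewrite (integral_power_gamma np0 b0).
Qed.

Let expRN_ge0 x : (0 <= (expR (- lp_pow p x))%:E)%E.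
Proof. by rewrite lee_fin expR_ge0. Qed.

Let weight0 (g : m.+1.-tuple R -> \bar R) :
  measurable_fun [set: m.+1.-tuple R] g -> (forall u, 0 <= g u)%E ->
  (\int[lambda]_x (g (lp_dir p x) * (expR (- lp_pow p x))%:E) =
   (vol * (m.+1%:R / p * Gamma (m.+1%:R / p)))%:E * \int[Q]_u g u)%E.
Proof.
move=> mg g0; have := ge0_integral_cone_law (lexx 0) mg g0; rewrite addr0 => <-.
by apply: eq_integral => x _; rewrite powRr0 mul1r.
Qed.

Let lp_pow_flip j x : lp_pow p (tuple_flip j x) = lp_pow p x.
Proof.
by apply: eq_bigr => i _; rewrite tnth_flip; case: eqP => // _; rewrite normrN.
Qed.

Let lp_dir_flip j x : lp_dir p (tuple_flip j x) = tuple_flip j (lp_dir p x).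
Proof.
apply: eq_from_tnth => i; rewrite tnth_flip !tnth_lp_dir tnth_flip lp_pow_flip.
by case: eqP => // _; rewrite mulrN.
Qed.

(** A flip preserves Lebesgue measure and the radius, and commutes with taking the direction. The
    common constant is then cancelled. *)
Lemma ge0_integral_cone_law_flip j (g : m.+1.-tuple R -> \bar R) :
  measurable_fun [set: m.+1.-tuple R] g -> (forall u, 0 <= g u)%E ->
  (\int[Q]_u g (tuple_flip j u) = \int[Q]_u g u)%E.
Proof.
move=> mg g0.
have mgf : measurable_fun [set: m.+1.-tuple R] (g \o tuple_flip j).
  exact: (measurableT_comp mg (measurable_tuple_flip j)).
have mh : measurable_fun [set: m.+1.-tuple R]
    (fun x => g (lp_dir p x) * (expR (- lp_pow p x))%:E)%E.
  apply: emeasurable_funM; first exact: (measurableT_comp mg mdir).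
  exact: (measurableT_comp mexpRN mN).
have h0 x : (0 <= g (lp_dir p x) * (expR (- lp_pow p x))%:E)%E by rewrite mule_ge0.
have e1 := weight0 mgf (fun u => g0 _); have e2 := weight0 mg g0.
have := ge0_integral_tuple_flip j mh h0.
rewrite [RHS]e2 => e3.
have {}e1 := etrans (esym e1) (etrans _ e3).
have c0 : vol * (m.+1%:R / p * Gamma (m.+1%:R / p)) != 0.
  by rewrite gt_eqF// mulr_gt0// mulr_gt0// Gamma_gt0.
have {}e1 : ((vol * (m.+1%:R / p * Gamma (m.+1%:R / p)))%:E * \int[Q]_u (g \o tuple_flip j) u =
  (vol * (m.+1%:R / p * Gamma (m.+1%:R / p)))%:E * \int[Q]_u g u)%E.
  apply: e1; apply: eq_integral => x _; by rewrite lp_dir_flip lp_pow_flip.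
rewrite -[RHS]mul1e -[LHS]mul1e -(mulVf c0) EFinM -!muleA.
by congr (_ * _)%E.
Qed.

Let mcoord j (k : R) : measurable_fun [set: m.+1.-tuple R]
  (fun u => (`|tnth u j| `^ k)%:E).
Proof.
apply/measurable_EFinP; apply: (measurableT_comp (measurable_powR k)).
by apply: (measurableT_comp (@normr_measurable R setT)); exact: measurable_tnth.
Qed.

Lemma norm_lp_dir x j : `|tnth (lp_dir p x) j| = lp_pow p x `^ (- p^-1) * `|tnth x j|.
Proof. by rewrite tnth_lp_dir normrM ger0_norm ?powR_ge0. Qed.

Lemma lp_pow0_coord x j : lp_pow p x = 0 -> tnth x j = 0.
Proof.
move=> N0; have := lp_coord_le p x j; rewrite N0.
by rewrite le_eqVlt ltNge powR_ge0 orbF => /eqP /powR_eq0_eq0/normr0_eq0.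
Qed.

Lemma norm_lp_dir_pow x j : lp_pow p x `^ p^-1 * `|tnth (lp_dir p x) j| = `|tnth x j|.
Proof.
rewrite norm_lp_dir mulrA.
have [N0|N0] := eqVneq (lp_pow p x) 0.
  by rewrite (lp_pow0_coord _ N0) normr0 mulr0.
by rewrite -powRD ?subrr ?powRr0 ?mul1r// N0 implybT.
Qed.

(** The integral of |x_j|^l exp(-[lp_pow] x) is computed in polar form and as a product over the
    coordinates. Comparing l = k with l = 0 removes what does not depend on l. *)
Lemma cone_law_moment j (k : R) : 0 <= k ->
  (\int[Q]_u (`|tnth u j| `^ k)%:E =
   (Gamma ((1 + k) / p) * Gamma (m.+1%:R / p) /
     (Gamma (1 / p) * Gamma ((m.+1%:R + k) / p)))%:E)%E.
Proof.
move=> k0; have kp0 : 0 <= k / p by rewrite divr_ge0// ltW.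
have moment (l : R) : 0 <= l ->
    ((vol * (m.+1%:R / p * Gamma ((m.+1%:R + l) / p)))%:E * \int[Q]_u (`|tnth u j| `^ l)%:E =
     (2 * (p^-1 * Gamma ((1 + l) / p)))%:E *
       \int[lebesgue_tuple R m]_y (expR (- lp_pow p y))%:E)%E.
  move=> l0; have lp0 : 0 <= l / p by rewrite divr_ge0// ltW.
  have g0 u : (0 <= (`|tnth u j| `^ l)%:E)%E by rewrite lee_fin powR_ge0.
  rewrite mulrDl -(ge0_integral_cone_law lp0 (mcoord j l) g0).
  pose w (v : R) : \bar R := (v `^ (l / p) * expR (- v))%:E.
  have mw : measurable_fun [set: R] w.
    apply/measurable_EFinP; apply: measurable_funM; first exact: measurable_powR.
    exact: measurableT_comp.
  have w0 v : (0 <= w v)%E by rewrite lee_fin mulr_ge0 ?powR_ge0 ?expR_ge0.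
  have mNm := @measurable_lp_pow R p m.
  have me : measurable_fun [set: m.-tuple R] (fun y => (expR (- lp_pow p y))%:E).
    exact: (measurableT_comp mexpRN mNm).
  have e0 (y : m.-tuple R) : (0 <= (expR (- lp_pow p y))%:E)%E.
    by rewrite lee_fin expR_ge0.
  pose G (z : R * m.-tuple R) := (w z.1 * (expR (- lp_pow p z.2))%:E)%E.
  have mG : measurable_fun [set: R * m.-tuple R] G.
    apply: emeasurable_funM; first exact: (measurableT_comp mw measurable_fst).
    exact: (measurableT_comp me measurable_snd).
  have G0 z : (0 <= G z)%E by rewrite mule_ge0.
  transitivity (\int[lambda]_x G (`|tnth x j| `^ p, tuple_remove j x)%R)%E.
    apply: eq_integral => x _; rewrite /G /w/= -!EFinM; congr EFin.
    have -> : (`|tnth x j| `^ p) `^ (l / p) = `|tnth x j| `^ l.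
      by rewrite -powRrM mulrC divfK// gt_eqF.
    rewrite -[RHS]mulrA -expRD -opprD -lp_pow_remove mulrA; congr (_ * _).
    rewrite -(norm_lp_dir_pow x j) powRM ?powR_ge0// -powRrM mulrC.
    by rewrite (mulrC l).
  rewrite (ge0_integral_lp_coord p0 j mG G0).
  have c0 : (0 <= (p^-1 * Gamma ((1 + l) / p))%:E)%E.
    by rewrite lee_fin mulr_ge0 ?ltW// Gamma_gt0// divr_gt0// ltr_wpDr.
  rewrite [(2 * _)%:E]EFinM -muleA; congr (_ * _)%E.
  rewrite -(ge0_integralZl _ measurableT me (fun y _ => e0 y) c0).
  apply: eq_integral => y _.
  rewrite (ge0_integralZr _ measurableT mw (fun v _ => w0 v) (e0 y)).
  congr (_ * _)%E; rewrite (integral_power_gamma pV0 lp0).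
  by rewrite mulrDl div1r.
(* For l = 0 the moment is 1; this determines the integral over the other coordinates in terms of
   the volume of the ball. *)
have := moment 0 (lexx 0); under eq_integral do rewrite powRr0.
have -> : (\int[Q]_(_ in [set: m.+1.-tuple R]) 1 = 1)%E.
  by rewrite integral_cst// mul1e; exact: probability_setT.
rewrite mule1 !addr0 => e0; have ek := moment k k0.
have Gk : 0 < Gamma ((m.+1%:R + k) / p).
  exact: (Gamma_gt0 (divr_gt0 (ltr_wpDr k0 (ltr0Sn R m)) p0)).
have Gn : 0 < Gamma (m.+1%:R / p) by exact: Gamma_gt0.
have G1 : 0 < Gamma (1 / p) by apply: Gamma_gt0; rewrite divr_gt0.
have n0 : 0 < m.+1%:R :> R by rewrite ltr0n.
move: Gk Gn G1 n0 e0 ek vol0.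
move: vol (m.+1%:R : R) (Gamma ((1 + k) / p)) (Gamma (1 / p))
  (Gamma (m.+1%:R / p)) (Gamma ((m.+1%:R + k) / p)).
move=> v n' G1k G1 Gn Gk Gk0 Gn0 G10 n0 e0 ek v0.
have A0 : v * (n' / p * Gk) != 0 by rewrite !mulf_neq0 ?invr_eq0 ?lt0r_neq0.
have D0 : 2 * (p^-1 * G1) != 0 by rewrite !mulf_neq0 ?invr_eq0 ?lt0r_neq0.
rewrite (eq_mule_ratio A0 D0 ek e0); congr EFin.
by field; rewrite !lt0r_neq0.
Qed.

End cone_law_moments.

(** With t the p-th power of the norm, adding g to one p-th power changes it to t + g. The other
    coordinates of the direction are multiplied by this ratio, and the modulus v of the chosen one
    becomes [bias_coord]. *)
Definition shrink_ratio {R : realType} (p t g : R) : R := (t / (t + g)) `^ p^-1.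

Definition bias_coord {R : realType} (p v t g : R) : R :=
  ((t * v `^ p + g) / (t + g)) `^ p^-1.

Lemma powR_inv {R : realType} (x r : R) : 0 <= x -> x^-1 `^ r = x `^ (- r).
Proof. by move=> x0; rewrite -powR_inv1// -powRrM mulN1r. Qed.

Lemma measurable_fun_powR d (T : measurableType d) (R : realType) (f : T -> R) (e : R) :
  measurable_fun [set: T] f -> measurable_fun [set: T] (fun x => f x `^ e).
Proof. by move=> mf; apply: (measurableT_comp (measurable_powR e)). Qed.

Lemma measurable_fun_div d (T : measurableType d) (R : realType) (f g : T -> R) :
  measurable_fun [set: T] f -> measurable_fun [set: T] g ->
  measurable_fun [set: T] (fun x => f x / g x).
Proof.
move=> mf mg.
(* y^-1 = y |y|^-2 holds also at y = 0, where both sides are 0, and real powers are measurable. *)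
apply: (eq_measurable_fun (fun x => f x * (g x * `|g x| `^ (-1) * `|g x| `^ (-1)))).
  move=> x _; rewrite powR_inv1//; congr (_ * _).
  have [->|g0] := eqVneq (g x) 0; first by rewrite mul0r mul0r invr0.
  rewrite -mulrA -invfM -normrM ger0_norm ?mulrr_ge0 ?sqr_ge0// -?expr2 ?sqr_ge0//.
  by rewrite expr2 invfM mulrA mulfV// mul1r.
by repeat (apply: measurable_funM => //); apply: measurable_fun_powR;
  apply: measurableT_comp.
Qed.

Lemma eq_mule_cancel (R : realType) (x y : \bar R) (A B C D : R) :
  A != 0 -> B != 0 -> (A%:E * (B%:E * x) = C%:E * (D%:E * y))%E ->
  x = ((C * D / (A * B))%:E * y)%E.
Proof.
move=> A0 B0; rewrite !muleA -!EFinM => e.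
have AB0 : A * B != 0 by rewrite mulf_neq0.
by rewrite mulrC EFinM -muleA -e muleA -EFinM mulVf// mul1e.
Qed.

(** * Square bias of one coordinate of the cone law *)

Section cone_law_bias.
Context {R : realType} (p : R) (p0 : 0 < p) (m : nat).
Variable Q : probability (m.+1.-tuple R) R.
Hypothesis Qcone : forall A, measurable A -> A `<=` @lp_sphere R p m.+1 ->
  Q A = cone_measure p A.
Implicit Types (j : 'I_m.+1) (x u : m.+1.-tuple R).

Let lambda : {measure set (m.+1.-tuple R) -> \bar R} := lebesgue_tuple R m.+1.

Let pV0 : 0 < p^-1. Proof. by rewrite invr_gt0. Qed.
Let b0 : 0 < 2 / p :> R. Proof. by rewrite divr_gt0. Qed.

Lemma lp_dirK x : tuple_scale (lp_pow p x `^ p^-1) (lp_dir p x) = x.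
Proof.
apply: eq_from_tnth => i; rewrite tnth_scale tnth_lp_dir mulrA.
have [N0|N0] := eqVneq (lp_pow p x) 0; first by rewrite (lp_pow0_coord _ N0) mulr0.
by rewrite -powRD ?subrr ?powRr0 ?mul1r// N0 implybT.
Qed.

Lemma tuple_remove_scale j s x :
  tuple_remove j (tuple_scale s x) = tuple_scale s (tuple_remove j x).
Proof. by apply: eq_from_tnth => k; rewrite tnth_remove !tnth_scale tnth_remove. Qed.

(* Square bias of the j-th coordinate: t and g stand for independent Gamma(n/p)
   and Gamma(2/p) variables, up to normalization. *)
Lemma cone_law_bias j : exists2 kappa : R, 0 < kappa &
  forall (S : m.-tuple R -> R) (K : R -> R -> \bar R),
  measurable_fun [set: m.-tuple R] S ->
  (forall s y, S (tuple_scale s y) = s * S y) ->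
  measurable_fun [set: R * R] (fun z => K z.1 z.2) -> (forall v s, 0 <= K v s)%E ->
  (\int[Q]_u ((`|tnth u j| `^ 2)%:E * K `|tnth u j|%R (S (tuple_remove j u))) =
   kappa%:E * \int[Q]_u \int[power_measure (m.+1%:R / p)]_t
     \int[power_measure (2 / p)]_g
       (K (bias_coord p `|tnth u j| t g) (shrink_ratio p t g * S (tuple_remove j u))%R *
        (expR (- (t + g)))%:E))%E.
Proof.
pose a := p^-1; pose b := 2 / p.
pose c := a * Gamma a * (b * Gamma b) / ((a + b) * Gamma (a + b)).
pose C2 := ball_volume p m.+1 * (m.+1%:R / p * Gamma (m.+1%:R / p + b)).
have v0 : 0 < ball_volume p m.+1 by rewrite ball_volume_gt0.
have n0 : 0 < m.+1%:R / p :> R by rewrite divr_gt0// ltr0n.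
have c0 : 0 < c.
  have [g1 g2] := (Gamma_gt0 pV0, Gamma_gt0 b0).
  have g3 := Gamma_gt0 (addr_gt0 pV0 b0).
  exact: (divr_gt0 (mulr_gt0 (mulr_gt0 pV0 g1) (mulr_gt0 b0 g2))
    (mulr_gt0 (addr_gt0 pV0 b0) g3)).
have C20 : 0 < C2.
  exact: (mulr_gt0 v0 (mulr_gt0 n0 (Gamma_gt0 (addr_gt0 n0 b0)))).
have a0 : 0 < a / (a + b) by exact: (divr_gt0 pV0 (addr_gt0 pV0 b0)).
exists ((a / (a + b)) * ball_volume p m.+1 / (c * C2)).
  exact: (divr_gt0 (mulr_gt0 a0 v0) (mulr_gt0 c0 C20)).
move=> S K mS Sscale mK K0.
have mN := @measurable_lp_pow R p m.
have mexp : measurable_fun [set: R] (fun y : R => (expR (- y))%:E).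
  by apply/measurable_EFinP; apply: measurableT_comp.
have mK2 d (T : measurableType d) (f1 f2 : T -> R) : measurable_fun [set: T] f1 ->
    measurable_fun [set: T] f2 -> measurable_fun [set: T] (fun w => K (f1 w) (f2 w)).
  move=> mf1 mf2; apply: (measurableT_comp mK (g := fun w => (f1 w, f2 w))).
  by apply/measurable_fun_pairP.
have minv d (T : measurableType d) (f : T -> R) (e : R) : measurable_fun [set: T] f ->
    measurable_fun [set: T] (fun w => f w `^ e).
  exact: measurableT_comp (measurable_powR e).
(* [H] sees only the p-th power of the j-th modulus and the other coordinates. It evaluates [K] at
   the normalized vector, and the exponential makes the radial integrals finite. *)
pose H (z : R * m.-tuple R) : \bar R :=
  (K ((z.1 / (z.1 + lp_pow p z.2)) `^ p^-1)%R
     ((z.1 + lp_pow p z.2) `^ (- p^-1) * S z.2)%R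
   * (expR (- (z.1 + lp_pow p z.2)))%:E)%E.
have mH : measurable_fun [set: R * m.-tuple R] H.
  have ms : measurable_fun [set: R * m.-tuple R] (fun z => z.1 + lp_pow p z.2).
    by apply: measurable_funD => //; exact: (measurableT_comp mN measurable_snd).
  apply: emeasurable_funM; last exact: (measurableT_comp mexp ms).
  apply: mK2.
    by apply: minv; exact: measurable_fun_div.
  apply: measurable_funM; first exact: minv.
  exact: (measurableT_comp mS measurable_snd).
have H0 z : (0 <= H z)%E by rewrite mule_ge0// lee_fin expR_ge0.
have mcoord : measurable_fun [set: m.+1.-tuple R] (fun u => `|tnth u j|).
  by apply: (measurableT_comp (@normr_measurable R setT)); exact: measurable_tnth.
have mSr : measurable_fun [set: m.+1.-tuple R] (fun u => S (tuple_remove j u)).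
  exact: (measurableT_comp mS (measurable_tuple_remove j)).
(* The weight |x_j|^2 splits into |u_j|^2, with u the direction of x, and the power 2/p of [lp_pow]
   x, whose radial integral goes into [C2]. *)
have eL : (C2%:E * \int[Q]_u ((`|tnth u j| `^ 2)%:E * K `|tnth u j|%R (S (tuple_remove j u))) =
    \int[lambda]_x (((`|tnth x j| `^ p) `^ b)%:E * H (`|tnth x j| `^ p, tuple_remove j x)%R))%E.
  pose g u := ((`|tnth u j| `^ 2)%:E * K `|tnth u j|%R (S (tuple_remove j u)))%E.
  have mg : measurable_fun [set: m.+1.-tuple R] g.
    apply: emeasurable_funM; last exact: mK2.
    by apply/measurable_EFinP; exact: minv.
  have g0 u : (0 <= g u)%E by rewrite mule_ge0// lee_fin powR_ge0.
  rewrite -(ge0_integral_cone_law p0 Qcone (ltW b0) mg g0).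
  apply: eq_integral => x _; rewrite /g /H/= -lp_pow_remove.
  have N0 := lp_pow_ge0 p x.
  have -> : tuple_remove j (lp_dir p x) = tuple_scale (lp_pow p x `^ (- p^-1)) (tuple_remove j x).
    by rewrite tuple_remove_scale.
  rewrite Sscale.
  have -> : (`|tnth x j| `^ p / lp_pow p x) `^ p^-1 = `|tnth (lp_dir p x) j|.
    rewrite norm_lp_dir mulrC powRM ?powR_ge0 ?invr_ge0// powR_inv//.
    by rewrite -!powRrM mulfV ?gt_eqF// powRr1.
  have -> : (`|tnth x j| `^ p) `^ b = `|tnth (lp_dir p x) j| `^ 2 * lp_pow p x `^ b.
    rewrite -powRrM /b mulrCA mulfV ?gt_eqF// mulr1 -(norm_lp_dir_pow p x j).
    by rewrite powRM ?powR_ge0// -powRrM mulrC (mulrC p^-1).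
  rewrite [X in (_ * X)%E]EFinM [X in _ = (X * _)%E]EFinM -!muleA; congr (_ * _)%E.
  by rewrite muleCA.
pose W (u : m.+1.-tuple R) (t g : R) : \bar R :=
  (K (bias_coord p `|tnth u j| t g) (shrink_ratio p t g * S (tuple_remove j u))%R *
        (expR (- (t + g)))%:E)%E.
have W0 u t g : (0 <= W u t g)%E by rewrite mule_ge0// lee_fin expR_ge0.
have mr d (T : measurableType d) (f1 f2 : T -> R) : measurable_fun [set: T] f1 ->
    measurable_fun [set: T] f2 ->
    measurable_fun [set: T] (fun w => shrink_ratio p (f1 w) (f2 w)).
  move=> mf1 mf2; apply: measurable_fun_powR; apply: measurable_fun_div => //.
  exact: measurable_funD.
have mb d (T : measurableType d) (f0 f1 f2 : T -> R) : measurable_fun [set: T] f0 ->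
    measurable_fun [set: T] f1 -> measurable_fun [set: T] f2 ->
    measurable_fun [set: T] (fun w => bias_coord p (f0 w) (f1 w) (f2 w)).
  move=> mf0 mf1 mf2; apply: measurable_fun_powR; apply: measurable_fun_div.
    apply: measurable_funD => //; apply: measurable_funM => //.
    exact: measurable_fun_powR.
  exact: measurable_funD.
have mW : measurable_fun [set: (m.+1.-tuple R * R) * R] (fun z => W z.1.1 z.1.2 z.2).
  have m1 : measurable_fun [set: (m.+1.-tuple R * R) * R] (fun z => z.1.1).
    exact: (measurableT_comp measurable_fst measurable_fst).
  have m2 : measurable_fun [set: (m.+1.-tuple R * R) * R] (fun z => z.1.2).
    exact: (measurableT_comp measurable_snd measurable_fst).
  have m3 : measurable_fun [set: (m.+1.-tuple R * R) * R] (fun z => z.2).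
    exact: measurable_snd.
  apply: emeasurable_funM; last first.
    by apply: (measurableT_comp mexp); exact: measurable_funD.
  apply: mK2; first by apply: mb => //; exact: (measurableT_comp mcoord m1).
  by apply: measurable_funM; [exact: mr|exact: (measurableT_comp mSr m1)].
pose Phi (z : m.+1.-tuple R * R) : \bar R := (\int[power_measure b]_g W z.1 z.2 g)%E.
have mPhi : measurable_fun [set: m.+1.-tuple R * R] Phi.
  exact: (measurable_fun_fubini_tonelli_F (m2 := power_measure b) _ mW (fun=> W0 _ _ _)).
have Phi0 z : (0 <= Phi z)%E by apply: integral_ge0 => g _.
(* Here g is added before normalizing, so the p-th power of the norm is [lp_pow p x + g];
   homogeneity of S turns this into the factor [shrink_ratio]. *)
have eR : (\int[lambda]_x \int[power_measure b]_g
      H (`|tnth x j| `^ p + g, tuple_remove j x)%R =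
    (ball_volume p m.+1)%:E * \int[Q]_u \int[power_measure (m.+1%:R / p)]_t Phi (u, t))%E.
  rewrite -(ge0_integral_polar p0 (ltn0Sn m) Qcone mPhi Phi0).
  apply: eq_integral => x _; apply: (eq_power_integral b0).
  - apply: (measurableT_comp mH (g := fun g : R => (`|tnth x j| `^ p + g, tuple_remove j x))).
    by apply/measurable_fun_pairP; split; [exact: measurable_funD|exact: measurable_cst].
  - exact: (measurableT_comp mW (measurable_pair1 (lp_dir p x, lp_pow p x))).
  - by move=> g; exact: H0.
  - by move=> g; exact: W0.
  move=> g g0; have N0 := lp_pow_ge0 p x.
  rewrite /H/W/=.
  have -> : `|tnth x j| `^ p + g + lp_pow p (tuple_remove j x) = lp_pow p x + g.
    by rewrite addrAC -lp_pow_remove.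
  have Ng : 0 <= lp_pow p x + g by rewrite addr_ge0// ltW.
  congr (K _ _ * _)%E.
  - rewrite /bias_coord; congr ((_ / _) `^ _); congr (_ + _).
    rewrite -(norm_lp_dir_pow p x j) powRM ?powR_ge0// -powRrM mulVf ?gt_eqF//.
    by rewrite powRr1.
  - rewrite /shrink_ratio powRM ?invr_ge0// powR_inv// -mulrA mulrCA; congr (_ * _).
    rewrite -[in LHS](lp_dirK x) tuple_remove_scale Sscale.
    by [].
have := ge0_integral_lp_coord_bias p0 j b0 mH H0.
rewrite /= -/a -/b -/c -/lambda -eL eR => e.
exact: (eq_mule_cancel (lt0r_neq0 c0) (lt0r_neq0 C20) e).
Qed.

End cone_law_bias.

(** * The square bias coupling *)

Section real_inequalities.
Context {R : realType}.

(** For q <= 1, r <= r^q. For q > 1, Young's inequality for r * 1 with the exponents q and q/(q-1)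
    gives q r <= r^q + q - 1. *)
Lemma one_sub_powR_le (q r : R) : 0 < q -> 0 <= r <= 1 ->
  1 - r `^ q <= Num.max q 1 * (1 - r).
Proof.
move=> q0 /andP[r0 r1]; have [q1|q1] := leP q 1.
  rewrite mul1r lerD2l lerN2; move: r0; rewrite le_eqVlt => /predU1P[<-|r0].
    exact: powR_ge0.
  by apply: ger1_powR; rewrite ?r0.
have q10 : 0 < q - 1 by rewrite subr_gt0.
have q10' : 0 < q / (q - 1) by rewrite divr_gt0.
have := conjugate_powR r0 ler01 q0 q10'.
rewrite powR1 mulr1 div1r !invf_div => /(_ _); rewrite (_ : q^-1 + (q - 1) / q = 1).
  by move=> /(_ erefl); rewrite -mulrDl ler_pdivlMr// => h; lra.
by field; rewrite gt_eqF.
Qed.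

(** These rules are stated for functions given pointwise and with numerical derivatives, so that
    they chain by plain application. *)
Lemma is_derive_sub (f g : R -> R) (x a b : R) : is_derive x 1 f a ->
  is_derive x 1 g b -> is_derive x 1 (fun y => f y - g y) (a - b).
Proof. exact: is_deriveB. Qed.

Lemma is_derive_add (f g : R -> R) (x a b : R) : is_derive x 1 f a ->
  is_derive x 1 g b -> is_derive x 1 (fun y => f y + g y) (a + b).
Proof. exact: is_deriveD. Qed.

Lemma is_derive_mul (f g : R -> R) (x a b : R) : is_derive x 1 f a ->
  is_derive x 1 g b -> is_derive x 1 (fun y => f y * g y) (f x * b + g x * a).
Proof. exact: is_deriveM. Qed.

Lemma is_derive_comp1 (f g : R -> R) (x a b : R) : is_derive (g x) 1 f a ->
  is_derive x 1 g b -> is_derive x 1 (fun y => f (g y)) (a * b).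
Proof. exact: is_derive1_comp. Qed.

Lemma is_derive_const (c x : R) : is_derive x 1 (fun=> c) 0.
Proof. exact: is_derive_cst. Qed.

Lemma is_derive_ident (x : R) : is_derive x 1 (fun y : R => y) 1.
Proof. exact: is_derive_id. Qed.

Lemma is_derive_val (f : R -> R) (x a b : R) : is_derive x 1 f a -> a = b ->
  is_derive x 1 f b.
Proof. by move=> fa <-. Qed.

Lemma is_derive_le0 (f df : R -> R) (a b : R) : a <= b ->
  (forall x : R, is_derive x 1 f (df x)) -> (forall x, a < x < b -> df x <= 0) ->
  f b <= f a.
Proof.
move=> ab fdf df0; have [ab'|ba] := ltP a b; last by rewrite (@le_anti _ _ a b) ?ab.
have cf : {within `[a, b], continuous f}.
  apply: derivable_within_continuous => x _; exact: ex_derive.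
have [c cab e] := MVT ab' (fun x _ => fdf x) cf.
by rewrite -subr_le0 e mulr_le0_ge0 ?subr_ge0// df0//; move: cab; rewrite in_itv.
Qed.

Variables (F F1 : R -> R) (L : R).
Hypothesis F_derive : forall x : R, is_derive x 1 F (F1 x).
Hypothesis F1_ge0 : forall x, 0 <= F1 x.
Hypothesis F1_lip : forall x y, `|F1 x - F1 y| <= L * `|x - y|.

Lemma is_derive_homo : {homo F : x y / x <= y}.
Proof.
move=> x y xy; rewrite -lerN2.
apply: (@is_derive_le0 (fun z => - F z) (fun z => - F1 z)) => // z _.
by rewrite oppr_le0.
Qed.

(* The mean of F' over [s - a, s + a]; it vanishes for a = 0. *)
Definition symmetric_quotient (a s : R) : R := (F (s + a) - F (s - a)) / (2 * a).

Lemma symmetric_quotientN a s : symmetric_quotient (- a) s = symmetric_quotient a s.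
Proof. by rewrite /symmetric_quotient opprK mulrN invrN mulrN -mulNr opprB. Qed.

Lemma symmetric_quotient_norm a s : symmetric_quotient `|a| s = symmetric_quotient a s.
Proof. by case: ger0P => // _; rewrite symmetric_quotientN. Qed.

Lemma symmetric_quotient_ge0 a s : 0 <= symmetric_quotient a s.
Proof.
rewrite -symmetric_quotient_norm; apply: divr_ge0; last by rewrite mulr_ge0.
by rewrite subr_ge0; apply: is_derive_homo; rewrite lerD2l ge0_cp.
Qed.

(** The mean of |z - y| over [s - v, s + v] is at most v/2 + |s - y|. Instead of integrating F', the
    difference [G] of the two sides times 2u is shown to decrease in u from its value 0. For a = 0
    the quotient is 0 and the bound uses F' >= 0. *)
Lemma symmetric_quotient_le a s y :
  symmetric_quotient a s <= F1 y + L * (`|a| / 2 + `|s - y|).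
Proof.
have L0 : 0 <= L.
  by have := F1_lip 1 0; rewrite subr0 normr1 mulr1; exact: le_trans.
have := normr_ge0 a; rewrite -symmetric_quotient_norm; move: `|a| => v.
rewrite le_eqVlt => /predU1P[<-|v0].
  rewrite /symmetric_quotient mulr0 invr0 mulr0 mul0r add0r addr_ge0//.
  by rewrite mulr_ge0.
rewrite /symmetric_quotient ler_pdivrMr ?mulr_gt0//.
pose G (u : R) := F (s + u) - F (s - u) - (2 * F1 y) * u
  - L * (u * u + 2 * `|s - y| * u).
pose G1 (u : R) := F1 (s + u) + F1 (s - u) - 2 * F1 y - L * (u + u + 2 * `|s - y|).
suff : G v <= G 0.
  rewrite /G !addr0 !subr0 !mulr0 !subrr addr0 mulr0 subr0 => h.
  apply: le_trans (_ : 2 * F1 y * v + L * (v * v + 2 * `|s - y| * v) <= _); last first.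
    by rewrite le_eqVlt; apply/orP; left; apply/eqP; field.
  lra.
apply: (@is_derive_le0 G G1); first exact: ltW.
  move=> u.
  have di := is_derive_ident u; have dc c := is_derive_const c u.
  have d1 := @is_derive_comp1 F (fun z => s + z) u _ _ (F_derive (s + u)) (is_derive_add (dc s) di).
  have d2 := @is_derive_comp1 F (fun z => s - z) u _ _ (F_derive (s - u)) (is_derive_sub (dc s) di).
  have d3 := is_derive_mul (dc (2 * F1 y)) di.
  have d4 := is_derive_add (is_derive_mul di di) (is_derive_mul (dc (2 * `|s - y|)) di).
  have dG := is_derive_sub (is_derive_sub (is_derive_sub d1 d2) d3) (is_derive_mul (dc L) d4).
  by apply: (is_derive_val dG); rewrite /G1; ring.
move=> u /andP[u0 _]; rewrite /G1.
have h1 := F1_lip (s + u) y; have h2 := F1_lip (s - u) y.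
have n1 : `|s + u - y| <= `|s - y| + u.
  by rewrite addrAC (le_trans (ler_normD _ _))// (gtr0_norm u0).
have n2 : `|s - u - y| <= `|s - y| + u.
  by rewrite addrAC (le_trans (ler_normB _ _))// (gtr0_norm u0).
have h3 := le_trans (ler_norm _) (le_trans h1 (ler_wpM2l L0 n1)).
have h4 := le_trans (ler_norm _) (le_trans h2 (ler_wpM2l L0 n2)).
by rewrite mulrDr; move: h3 h4; rewrite !mulrDr; lra.
Qed.

End real_inequalities.

Lemma le_power_integral {R : realType} (a : R) (phi psi : R -> \bar R) : 0 < a ->
  measurable_fun [set: R] phi -> measurable_fun [set: R] psi ->
  (forall y, 0 <= phi y)%E -> (forall y, 0 <= psi y)%E ->
  (forall y : R, (0 < y)%R -> phi y <= psi y)%E ->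
  (\int[power_measure a]_y phi y <= \int[power_measure a]_y psi y)%E.
Proof.
move=> a0 mphi mpsi phi0 psi0 le.
(* The comparison is known only at positive points; the minimum lies below psi everywhere and equals
   phi there. *)
pose chi y := mine (phi y) (psi y).
have mchi : measurable_fun [set: R] chi by exact: measurable_mine.
have chi0 y : (0 <= chi y)%E by rewrite /chi le_min phi0 psi0.
rewrite (@eq_power_integral R a phi chi a0 mphi mchi phi0 chi0); last first.
  by move=> y y0; rewrite /chi min_l// le.
apply: (ge0_le_integral _ measurableT) => // y _.
by rewrite /chi ge_min lexx orbT.
Qed.

Section triple_integral.
Context d1 d2 d3 (T1 : measurableType d1) (T2 : measurableType d2)
  (T3 : measurableType d3) (R : realType).
Variables (m1 : {sigma_finite_measure set T1 -> \bar R})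
  (m2 : {sigma_finite_measure set T2 -> \bar R})
  (m3 : {sigma_finite_measure set T3 -> \bar R}).
Implicit Types f g : T1 -> T2 -> T3 -> \bar R.

Definition triple_integral f := (\int[m1]_x \int[m2]_y \int[m3]_z f x y z)%E.

Definition measurable_fun3 f :=
  measurable_fun [set: T1 * T2 * T3] (fun w => f w.1.1 w.1.2 w.2).

Section sections.
Variables (f : T1 -> T2 -> T3 -> \bar R) (mf : measurable_fun3 f).
Hypothesis f0 : forall x y z, (0 <= f x y z)%E.

Lemma measurable_section3 x y : measurable_fun [set: T3] (f x y).
Proof. exact: (measurableT_comp mf (pair1_measurable (x, y))). Qed.

Let mF : measurable_fun [set: T1 * T2] (fun w => \int[m3]_z f w.1 w.2 z)%E.
Proof.
exact: (@measurable_fun_fubini_tonelli_F _ _ _ _ _ m3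
  (fun w : T1 * T2 * T3 => f w.1.1 w.1.2 w.2) mf (fun w => f0 _ _ _)).
Qed.

Lemma measurable_integral3 x : measurable_fun [set: T2] (fun y => \int[m3]_z f x y z)%E.
Proof. exact: (measurableT_comp mF (pair1_measurable x)). Qed.

Lemma measurable_integral23 :
  measurable_fun [set: T1] (fun x => \int[m2]_y \int[m3]_z f x y z)%E.
Proof.
apply: (@measurable_fun_fubini_tonelli_F _ _ _ _ _ m2
  (fun w => \int[m3]_z f w.1 w.2 z)%E mF) => w.
exact: integral_ge0.
Qed.

End sections.

Lemma triple_integralD f g : measurable_fun3 f -> (forall x y z, 0 <= f x y z)%E ->
  measurable_fun3 g -> (forall x y z, 0 <= g x y z)%E ->
  triple_integral (fun x y z => f x y z + g x y z)%E =
  (triple_integral f + triple_integral g)%E.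
Proof.
move=> mf f0 mg g0; rewrite /triple_integral.
have i3 (h : T1 -> T2 -> T3 -> \bar R) (h0 : forall x y z, (0 <= h x y z)%E) x y :
    (0 <= \int[m3]_z h x y z)%E by exact: integral_ge0.
have i23 (h : T1 -> T2 -> T3 -> \bar R) (h0 : forall x y z, (0 <= h x y z)%E) x :
    (0 <= \int[m2]_y \int[m3]_z h x y z)%E by apply: integral_ge0 => y _; exact: i3.
rewrite -(ge0_integralD _ measurableT (fun x _ => i23 f f0 x) (measurable_integral23 mf f0)
  (fun x _ => i23 g g0 x) (measurable_integral23 mg g0)).
apply: eq_integral => x _.
rewrite -(ge0_integralD _ measurableT (fun y _ => i3 f f0 x y) (measurable_integral3 mf f0 x)
  (fun y _ => i3 g g0 x y) (measurable_integral3 mg g0 x)).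
apply: eq_integral => y _.
exact: (ge0_integralD _ measurableT (fun z _ => f0 x y z) (measurable_section3 mf x y)
  (fun z _ => g0 x y z) (measurable_section3 mg x y)).
Qed.

Lemma le_triple_integral f g : measurable_fun3 f -> (forall x y z, 0 <= f x y z)%E ->
  measurable_fun3 g -> (forall x y z, f x y z <= g x y z)%E ->
  (triple_integral f <= triple_integral g)%E.
Proof.
move=> mf f0 mg fg.
have g0 x y z : (0 <= g x y z)%E by exact: le_trans (fg x y z).
have i3 x y : (0 <= \int[m3]_z f x y z)%E by exact: integral_ge0.
apply: (ge0_le_integral _ measurableT) => [x _| | |x _].
- by apply: integral_ge0.
- exact: measurable_integral23.
- exact: measurable_integral23.
apply: (ge0_le_integral _ measurableT) => [y _| | |y _] //.
- exact: measurable_integral3.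
- exact: measurable_integral3.
apply: (ge0_le_integral _ measurableT) => //; exact: measurable_section3.
Qed.

Lemma triple_integralM (g : T1 -> \bar R) (c : T2 -> T3 -> \bar R) :
  measurable_fun [set: T1] g -> (forall x, 0 <= g x)%E ->
  measurable_fun [set: T2 * T3] (fun w => c w.1 w.2) -> (forall y z, 0 <= c y z)%E ->
  triple_integral (fun x y z => g x * c y z)%E =
  ((\int[m1]_x g x) * \int[m2]_y \int[m3]_z c y z)%E.
Proof.
move=> mg g0 mc c0.
have ms y : measurable_fun [set: T3] (c y).
  exact: (measurableT_comp mc (pair1_measurable y)).
have mF : measurable_fun [set: T2] (fun y => \int[m3]_z c y z)%E.
  by apply: (@measurable_fun_fubini_tonelli_F _ _ _ _ _ m3 (fun w => c w.1 w.2)).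
have F0 y : (0 <= \int[m3]_z c y z)%E by exact: integral_ge0.
rewrite -(ge0_integralZr _ measurableT mg (fun x _ => g0 x)); last exact: integral_ge0.
apply: eq_integral => x _.
rewrite -(ge0_integralZl _ measurableT mF (fun x _ => F0 x) (g0 x)).
apply: eq_integral => y _.
exact: (ge0_integralZl _ measurableT (ms y) (fun x _ => c0 y x) (g0 x)).
Qed.

End triple_integral.

(** * Comparison of the biased and the unbiased law *)

Section cone_law_bias_le.
Context {R : realType} (p : R) (p0 : 0 < p) (m : nat).
Variable Q : probability (m.+1.-tuple R) R.
Hypothesis Qcone : forall A, measurable A -> A `<=` @lp_sphere R p m.+1 ->
  Q A = cone_measure p A.
Implicit Types (j : 'I_m.+1) (x u : m.+1.-tuple R).

Let a : R := m.+1%:R / p.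
Let b : R := 2 / p.
Let a0 : 0 < a. Proof. by rewrite divr_gt0// ltr0n. Qed.
Let b0 : 0 < b. Proof. by rewrite divr_gt0. Qed.
Let ex (t g : R) : R := expR (- (t + g)).

Let mex : measurable_fun [set: R * R] (fun w => ex w.1 w.2).
Proof.
by apply: measurableT_comp => //; apply: measurableT_comp => //; exact: measurable_funD.
Qed.

Lemma cone_law_sigma2 j : (\int[Q]_u (`|tnth u j| `^ 2)%:E = (sigma2 m.+1 p)%:E)%E.
Proof.
apply: (etrans (cone_law_moment p0 Qcone j (ler0n R 2))); congr (_%:E).
have -> : m.+1%:R + 2 = m.+3%:R :> R by rewrite -natrD addn2.
by have -> : 1 + 2 = 3 :> R by lra.
Qed.

Lemma integral_expR_power2 : (\int[power_measure a]_t \int[power_measure b]_g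
  (ex t g)%:E = (a * Gamma a * (b * Gamma b))%:E)%E.
Proof.
have me : measurable_fun [set: R] (fun t : R => (expR (- t))%:E).
  by apply/measurable_EFinP; apply: measurableT_comp.
have e0 (t : R) : (0 <= (expR (- t))%:E)%E by rewrite lee_fin expR_ge0.
transitivity (\int[power_measure a]_t ((expR (- t))%:E * power_gamma b))%E.
  apply: eq_integral => t _.
  rewrite -(ge0_integralZl _ measurableT me (fun y _ => e0 y) (e0 t)).
  by apply: eq_integral => g _; rewrite /ex opprD expRD.
have pg0 : (0 <= power_gamma b)%E by apply: integral_ge0.
rewrite (ge0_integralZr _ measurableT me (fun y _ => e0 y) pg0).
by rewrite -/(power_gamma a) power_gammaE// power_gammaE.
Qed.

(** With q = 1/p and base t/(t + g), [one_sub_powR_le] bounds 1 - r by max(1/p, 1) g/(t + g), whose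
    mean is given by [integral_power_ratio]. *)
Lemma integral_shrink_ratio_le :
  (\int[power_measure a]_t \int[power_measure b]_g (`|1 - shrink_ratio p t g| * ex t g)%:E <=
   (Num.max p^-1 1 * (2 / m.+1.+2%:R))%:E *
   \int[power_measure a]_t \int[power_measure b]_g (ex t g)%:E)%E.
Proof.
pose M := Num.max p^-1 1; have M0 : 0 <= M by rewrite le_max ler01 orbT.
pose f1 t g := `|1 - shrink_ratio p t g| * ex t g.
pose f2 t g := `|g| * `|t + g| `^ (-1) * ex t g.
have mn d (T : measurableType d) (f : T -> R) : measurable_fun [set: T] f ->
    measurable_fun [set: T] (fun y => `|f y|).
  by move=> mf; exact: (measurableT_comp (@normr_measurable R setT)).
have mf1 : measurable_fun [set: R * R] (fun w => (f1 w.1 w.2)%:E).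
  apply/measurable_EFinP; apply: measurable_funM => //; apply: mn.
  apply: measurable_funB => //; apply: measurable_fun_powR.
  by apply: measurable_fun_div => //; exact: measurable_funD.
have mf2 : measurable_fun [set: R * R] (fun w => (f2 w.1 w.2)%:E).
  apply/measurable_EFinP; apply: measurable_funM => //; apply: measurable_funM.
    exact: mn.
  by apply: measurable_fun_powR; apply: mn; exact: measurable_funD.
have f10 t g : (0 <= (f1 t g)%:E)%E by rewrite lee_fin mulr_ge0 ?expR_ge0.
have f20 t g : (0 <= (f2 t g)%:E)%E by rewrite lee_fin !mulr_ge0 ?expR_ge0 ?powR_ge0.
have f12 (t g : R) : 0 < t -> 0 < g -> f1 t g <= M * f2 t g.
  move=> t0 g0; have tg0 : 0 < t + g by exact: addr_gt0.
  rewrite /f1 /f2 mulrA ler_wpM2r ?expR_ge0// (gtr0_norm g0) (gtr0_norm tg0).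
  rewrite powR_inv1 ?(ltW tg0)//.
  have r01 : 0 <= t / (t + g) <= 1.
    rewrite divr_ge0 ?(ltW t0) ?(ltW tg0)//= ler_pdivrMr// mul1r lerDl; exact: ltW.
  have -> : g / (t + g) = 1 - t / (t + g) by field; rewrite gt_eqF.
  have : shrink_ratio p t g <= 1 `^ p^-1.
    case/andP: r01 => r0 r1.
    by apply: ge0_ler_powR; rewrite ?invr_ge0 ?(ltW p0) ?nnegrE.
  rewrite powR1 => r1; rewrite ger0_norm ?subr_ge0//.
  by apply: one_sub_powR_le; rewrite ?invr_gt0.
have s1 t : measurable_fun [set: R] (fun g => (f1 t g)%:E).
  exact: (measurableT_comp mf1 (pair1_measurable t)).
have s2 t : measurable_fun [set: R] (fun g => (f2 t g)%:E).
  exact: (measurableT_comp mf2 (pair1_measurable t)).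
have i20 t : (0 <= \int[power_measure b]_g (f2 t g)%:E)%E by exact: integral_ge0.
have I1 : measurable_fun [set: R] (fun t => \int[power_measure b]_g (f1 t g)%:E)%E.
  exact: (@measurable_fun_fubini_tonelli_F _ _ _ _ _ (power_measure b) _ mf1 (fun w => f10 _ _)).
have I2 : measurable_fun [set: R] (fun t => \int[power_measure b]_g (f2 t g)%:E)%E.
  exact: (@measurable_fun_fubini_tonelli_F _ _ _ _ _ (power_measure b) _ mf2 (fun w => f20 _ _)).
have ME : (0 <= M%:E)%E by rewrite lee_fin.
apply: (@le_trans _ _ (M%:E * \int[power_measure a]_t \int[power_measure b]_g (f2 t g)%:E)%E).
  rewrite -(ge0_integralZl _ measurableT I2 (fun y _ => i20 y) ME).
  have i10 t : (0 <= \int[power_measure b]_g (f1 t g)%:E)%E by exact: integral_ge0.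
  apply: le_power_integral => //.
  - exact: measurable_funeM.
  - by move=> t; apply: mule_ge0.
  move=> t t0.
  rewrite -(ge0_integralZl _ measurableT (s2 t) (fun y _ => f20 t y) ME).
  apply: (@le_power_integral _ _ (fun g => (f1 t g)%:E)) => //.
  - exact: measurable_funeM.
  - by move=> g; apply: mule_ge0.
  by move=> g g0; rewrite -EFinM lee_fin; exact: f12.
rewrite (etrans (integral_power_ratio a0 b0) (erefl _)) integral_expR_power2 -!EFinM.
(* The dimension is n = m.+1, so a = n/p, b = 2/p and m.+3 = n + 2. *)
rewrite lee_fin; have -> : b / (a + b) = 2 / m.+3%:R.
  rewrite /a /b -mulrDl -natrD addn2.
  by rewrite invf_div mulrA divfK// gt_eqF.
by rewrite (mulrA M).
Qed.

Variables (F F1 : R -> R) (L : R).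
Hypothesis F_derive : forall x : R, is_derive x 1 F (F1 x).
Hypothesis F1_ge0 : forall z : R, 0 <= F1 z.
Hypothesis F1_lip : forall z y : R, `|F1 z - F1 y| <= L * `|z - y|.
Hypothesis mF1 : measurable_fun [set: R] F1.

(** Under the bias the quotient sits at (w v, r s), with v the biased modulus. It is compared with
    F' at the unbiased point y = w u_j + s, at distance at most |w u_j| + |1 - r| |s| from r s. The
    four terms on the right come from F'(y), |w v|/2, |w u_j| and |1 - r| |s|. *)
Lemma cone_law_bias_le j (w : R) (S : m.-tuple R -> R) :
  measurable_fun [set: m.-tuple R] S ->
  (forall s y, S (tuple_scale s y) = s * S y) ->
  (\int[Q]_u (`|tnth u j| `^ 2 * symmetric_quotient F (w * tnth u j) (S (tuple_remove j u)))%:E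
   <= (sigma2 m.+1 p)%:E * \int[Q]_u (F1 (w * tnth u j + S (tuple_remove j u)))%:E
    + (L * (`|w| / 2))%:E * \int[Q]_u (`|tnth u j| `^ 3)%:E
    + (sigma2 m.+1 p * (L * `|w|))%:E * \int[Q]_u `|tnth u j|%:E
    + (sigma2 m.+1 p * (L * (Num.max p^-1 1 * (2 / m.+1.+2%:R))))%:E *
      \int[Q]_u `|S (tuple_remove j u)|%:E)%E.
Proof.
move=> mS Sscale.
have L0 : 0 <= L.
  by have := F1_lip 1 0; rewrite subr0 normr1 mulr1; exact: le_trans.
have [kappa kappa0 bias] := cone_law_bias p0 Qcone j.
have mF : measurable_fun [set: R] F.
  apply: continuous_measurable_fun => z; apply: differentiable_continuous.
  exact/derivable1_diffP/ex_derive.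
have mK : measurable_fun [set: R * R]
    (fun z => (symmetric_quotient F (w * z.1) z.2)%:E).
  apply/measurable_EFinP; apply: measurable_fun_div; last first.
    by do 2! apply: measurable_funM => //.
  apply: measurable_funB; apply: (measurableT_comp mF).
    by apply: measurable_funD => //; exact: measurable_funM.
  by apply: measurable_funB => //; exact: measurable_funM.
have mu1 : measurable_fun [set: m.+1.-tuple R] (fun u => tnth u j) by exact: measurable_tnth.
have mu : measurable_fun [set: m.+1.-tuple R] (fun u => `|tnth u j|).
  by apply: (measurableT_comp (@normr_measurable R setT)).
have mSr : measurable_fun [set: m.+1.-tuple R] (fun u => S (tuple_remove j u)).
  exact: (measurableT_comp mS (measurable_tuple_remove j)).
have mnSr : measurable_fun [set: m.+1.-tuple R] (fun u => `|S (tuple_remove j u)|).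
  exact: (measurableT_comp (@normr_measurable R setT) mSr).
have mF1w : measurable_fun [set: m.+1.-tuple R]
    (fun u => F1 (w * tnth u j + S (tuple_remove j u))).
  by apply: (measurableT_comp mF1); apply: measurable_funD => //; exact: measurable_funM.
pose C00 := (\int[power_measure a]_t \int[power_measure b]_g (ex t g)%:E)%E.
(* Testing the bias identity with K = 1 identifies kappa: the total mass of the biased law is the
   variance. *)
have eC : (kappa%:E * C00)%E = (sigma2 m.+1 p)%:E.
  rewrite -(cone_law_sigma2 j).
  have := bias S (fun _ _ => 1%E) mS Sscale (measurable_cst _) (fun _ _ => lee01).
  under eq_integral do rewrite mule1.
  move=> ->; congr (_ * _)%E.
  transitivity (\int[Q]_u (cst C00) u)%E.
    by rewrite integral_cst// -[RHS]/(C00 * Q setT)%E probability_setT mule1.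
  apply: eq_integral => u _; apply: eq_integral => t _; apply: eq_integral => g _.
  by rewrite mul1e.
move: (sigma2 m.+1 p) eC => s2 eC.
have ex0 t g : (0 <= (ex t g)%:E)%E by rewrite lee_fin expR_ge0.
have mexE : measurable_fun [set: R * R] (fun z => (ex z.1 z.2)%:E).
  exact/measurable_EFinP.
have C000 : (0 <= C00)%E.
  by apply: integral_ge0 => t _; apply: integral_ge0.
pose k := symmetric_quotient F.
have k0 := symmetric_quotient_ge0 F_derive F1_ge0.
pose T := triple_integral Q (power_measure a) (power_measure b).
pose f0 u t g := ((k (w * bias_coord p `|tnth u j| t g)
   (shrink_ratio p t g * S (tuple_remove j u)))%:E * (ex t g)%:E)%E.
pose f1 u t g := ((1 * F1 (w * tnth u j + S (tuple_remove j u)))%:E * (ex t g)%:E)%E.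
pose f2 u t g := ((L * (`|w| / 2) * `|bias_coord p `|tnth u j| t g|)%:E * (ex t g)%:E)%E.
pose f3 u t g := ((L * `|w| * `|tnth u j|)%:E * (ex t g)%:E)%E.
pose f4 u t g := ((L * `|S (tuple_remove j u)|)%:E *
  (`|1 - shrink_ratio p t g| * ex t g)%:E)%E.
have e0 : (\int[Q]_u (`|tnth u j| `^ 2 * k (w * tnth u j)%R (S (tuple_remove j u)))%:E =
    kappa%:E * T f0)%E.
  rewrite -(bias S (fun v s => (k (w * v) s)%:E)) //; last first.
    by move=> v s; rewrite lee_fin.
  apply: eq_integral => u _; rewrite -EFinM /k -symmetric_quotient_norm.
  by rewrite -[in RHS]symmetric_quotient_norm !normrM normr_id.
(* The bias identity read backwards: the mean of the biased modulus is E|u_j|^3. *)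
have e2 : (kappa%:E * T f2 = (L * (`|w| / 2))%:E * \int[Q]_u (`|tnth u j| `^ 3)%:E)%E.
  rewrite -(bias S (fun v s => (L * (`|w| / 2) * `|v|)%:E)) //; last 2 first.
  - apply/measurable_EFinP; apply: measurable_funM => //.
    exact: (measurableT_comp (@normr_measurable R setT)).
  - by move=> v s; rewrite lee_fin !mulr_ge0.
  have mu3 : measurable_fun [set: m.+1.-tuple R] (fun u => (`|tnth u j| `^ 3)%:E).
    by apply/measurable_EFinP; exact: measurable_fun_powR.
  have u30 u : setT u -> (0 <= (`|tnth u j| `^ 3)%:E)%E by rewrite lee_fin powR_ge0.
  have Lw0 : (0 <= (L * (`|w| / 2))%:E)%E by rewrite lee_fin !mulr_ge0.
  rewrite -(ge0_integralZl Q measurableT mu3 u30 Lw0).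
  apply: eq_integral => u _; rewrite -!EFinM normr_id mulrCA.
  by rewrite (powR_mulrn 2 (normr_ge0 _)) (powR_mulrn 3 (normr_ge0 _)) -exprSr.
have e1 (c : R) (h : m.+1.-tuple R -> R) : measurable_fun [set: m.+1.-tuple R] h ->
    (forall u, 0 <= h u) -> 0 <= c ->
    (kappa%:E * T (fun u t g => (c * h u)%:E * (ex t g)%:E) =
     (s2 * c)%:E * \int[Q]_u (h u)%:E)%E.
  move=> mh h0 c0; have mhE : measurable_fun [set: m.+1.-tuple R] (fun u => (h u)%:E).
    exact/measurable_EFinP.
  have mch : measurable_fun [set: m.+1.-tuple R] (fun u => (c * h u)%:E).
    by apply/measurable_EFinP; exact: measurable_funM.
  have ch0 u : (0 <= (c * h u)%:E)%E by rewrite lee_fin mulr_ge0.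
  rewrite /T (triple_integralM Q (power_measure a) (power_measure b) mch ch0 mexE ex0).
  rewrite -/C00 (muleC _ C00) muleA eC EFinM -muleA; congr (_ * _)%E.
  have hE0 u : setT u -> (0 <= (h u)%:E)%E by rewrite lee_fin.
  rewrite -(ge0_integralZl Q measurableT mhE hE0); last by rewrite lee_fin.
  by apply: eq_integral => u _; rewrite EFinM.
have mex1 : measurable_fun [set: R * R]
    (fun z => (`|1 - shrink_ratio p z.1 z.2| * ex z.1 z.2)%:E).
  apply/measurable_EFinP; apply: measurable_funM => //.
  apply: (measurableT_comp (@normr_measurable R setT)).
  apply: measurable_funB => //; apply: measurable_fun_powR.
  by apply: measurable_fun_div => //; exact: measurable_funD.
have ex10 t g : (0 <= (`|1 - shrink_ratio p t g| * ex t g)%:E)%E.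
  by rewrite lee_fin mulr_ge0 ?expR_ge0.
(* |1 - r| depends only on t and g, so the triple integral factors and the bound on E(1 - r)
   applies. *)
have e4 : (kappa%:E * T f4 <=
    (s2 * (L * (Num.max p^-1 1 * (2 / m.+1.+2%:R))))%:E *
    \int[Q]_u `|S (tuple_remove j u)|%:E)%E.
  have mh : measurable_fun [set: m.+1.-tuple R] (fun u => (L * `|S (tuple_remove j u)|)%:E).
    by apply/measurable_EFinP; exact: measurable_funM.
  have h0 u : (0 <= (L * `|S (tuple_remove j u)|)%:E)%E by rewrite lee_fin mulr_ge0.
  rewrite /T (triple_integralM Q (power_measure a) (power_measure b) mh h0 mex1 ex10).
  have mSE : measurable_fun [set: m.+1.-tuple R] (fun u => `|S (tuple_remove j u)|%:E).
    exact/measurable_EFinP.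
  have SE0 u : setT u -> (0 <= `|S (tuple_remove j u)|%:E)%E by rewrite lee_fin.
  have -> : (\int[Q]_u (L * `|S (tuple_remove j u)|)%:E =
      L%:E * \int[Q]_u `|S (tuple_remove j u)|%:E)%E.
    rewrite -(ge0_integralZl Q measurableT mSE SE0); last by rewrite lee_fin.
    by apply: eq_integral => u _; rewrite EFinM.
  set I := (\int[Q]_u _)%E; have I0 : (0 <= I)%E by exact: integral_ge0.
  apply: (@le_trans _ _ (kappa%:E * (L%:E * I * ((Num.max p^-1 1 * (2 / m.+3%:R))%:E * C00)))%E).
    apply: lee_wpmul2l; first by rewrite lee_fin ltW.
    apply: lee_wpmul2l; first by rewrite mule_ge0// lee_fin.
    exact: integral_shrink_ratio_le.
  rewrite (muleC _ C00) (muleCA (L%:E * I)%E) (muleA kappa%:E) eC.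
  by rewrite (muleAC L%:E) muleA (EFinM s2) (EFinM L).
have mS3 : measurable_fun [set: m.+1.-tuple R * R * R] (fun z => S (tuple_remove j z.1.1)).
  by apply: (measurableT_comp mSr); apply: measurableT_comp.
have mu3 : measurable_fun [set: m.+1.-tuple R * R * R] (fun z => tnth z.1.1 j).
  by apply: (measurableT_comp mu1); apply: measurableT_comp.
have mn d (D : measurableType d) (h : D -> R) : measurable_fun [set: D] h ->
    measurable_fun [set: D] (fun z => `|h z|).
  by move=> mh; exact: (measurableT_comp (@normr_measurable R setT)).
have mt3 : measurable_fun [set: m.+1.-tuple R * R * R] (fun z => z.1.2).
  exact: measurableT_comp.
have mex3 : measurable_fun [set: m.+1.-tuple R * R * R] (fun z => (ex z.1.2 z.2)%:E).
  apply/measurable_EFinP; apply: measurableT_comp => //; apply: measurableT_comp => //.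
  exact: measurable_funD.
have mb3 : measurable_fun [set: m.+1.-tuple R * R * R]
    (fun z => bias_coord p `|tnth z.1.1 j| z.1.2 z.2).
  apply: measurable_fun_powR; apply: measurable_fun_div; last exact: measurable_funD.
  apply: measurable_funD => //; apply: measurable_funM => //.
  by apply: measurable_fun_powR; exact: mn.
have mr3 : measurable_fun [set: m.+1.-tuple R * R * R]
    (fun z => shrink_ratio p z.1.2 z.2).
  apply: measurable_fun_powR; apply: measurable_fun_div => //; exact: measurable_funD.
have m0 : measurable_fun3 f0.
  apply: emeasurable_funM => //.
  have mpair : measurable_fun [set: m.+1.-tuple R * R * R] (fun z =>
      (bias_coord p `|tnth z.1.1 j| z.1.2 z.2,
       shrink_ratio p z.1.2 z.2 * S (tuple_remove j z.1.1))).
    by apply/measurable_fun_pairP; split => //; exact: measurable_funM.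
  exact: (measurableT_comp mK mpair).
have m1 : measurable_fun3 f1.
  apply: emeasurable_funM => //; apply/measurable_EFinP; apply: measurable_funM => //.
  apply: (measurableT_comp mF1).
  by apply: measurable_funD => //; exact: measurable_funM.
have m2 : measurable_fun3 f2.
  apply: emeasurable_funM => //; apply/measurable_EFinP; apply: measurable_funM => //.
  exact: mn.
have m3 : measurable_fun3 f3.
  apply: emeasurable_funM => //; apply/measurable_EFinP; apply: measurable_funM => //.
  exact: mn.
have m4 : measurable_fun3 f4.
  apply: emeasurable_funM; apply/measurable_EFinP; apply: measurable_funM => //.
  - exact: mn.
  - by apply: mn; exact: measurable_funB.
  - exact/measurable_EFinP.
have f00 u t g : (0 <= f0 u t g)%E by rewrite mule_ge0// lee_fin.
have f10 u t g : (0 <= f1 u t g)%E by rewrite mule_ge0// lee_fin mul1r.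
have f20 u t g : (0 <= f2 u t g)%E by rewrite mule_ge0// lee_fin !mulr_ge0.
have f30 u t g : (0 <= f3 u t g)%E by rewrite mule_ge0// lee_fin !mulr_ge0.
have f40 u t g : (0 <= f4 u t g)%E by rewrite mule_ge0// lee_fin !mulr_ge0.
have f34 u t g : (0 <= f3 u t g + f4 u t g)%E by exact: adde_ge0.
have f24 u t g : (0 <= f2 u t g + (f3 u t g + f4 u t g))%E by exact: adde_ge0.
have m34 : measurable_fun3 (fun u t g => f3 u t g + f4 u t g)%E by exact: emeasurable_funD.
have m24 : measurable_fun3 (fun u t g => f2 u t g + (f3 u t g + f4 u t g))%E.
  exact: emeasurable_funD.
have m14 : measurable_fun3 (fun u t g => f1 u t g + (f2 u t g + (f3 u t g + f4 u t g)))%E.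
  exact: emeasurable_funD.
have le0 : (T f0 <= T (fun u t g => f1 u t g + (f2 u t g + (f3 u t g + f4 u t g))))%E.
  apply: le_triple_integral => // u t g.
  rewrite /f0 /f1 /f2 /f3 /f4 mul1r -!EFinM -!EFinD lee_fin.
  set y := w * tnth u j + S _.
  have h := symmetric_quotient_le F_derive F1_ge0 F1_lip
    (w * bias_coord p `|tnth u j| t g) (shrink_ratio p t g * S (tuple_remove j u)) y.
  set r := shrink_ratio p t g in h *; set s := S _ in y h *.
  set v := bias_coord _ _ _ _ in h *.
  have n1 : `|r * s - y| <= `|w| * `|tnth u j| + `|1 - r| * `|s|.
    have -> : r * s - y = - (w * tnth u j + (1 - r) * s) by rewrite /y; ring.
    by rewrite normrN -!normrM ler_normD.
  have h' : k (w * v) (r * s) <= F1 y + (L * (`|w| / 2) * `|v| +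
      (L * `|w| * `|tnth u j| + L * `|s| * `|1 - r|)).
    apply: (le_trans h); rewrite lerD2l normrM.
    apply: (le_trans (ler_wpM2l L0 (lerD (lexx _) n1))).
    by rewrite le_eqVlt; apply/orP; left; apply/eqP; ring.
  apply: (le_trans (ler_wpM2r (expR_ge0 _) h')).
  by rewrite !mulrDl -!mulrA.
rewrite /T (triple_integralD Q (power_measure a) (power_measure b) m1 f10 m24 f24) in le0.
rewrite (triple_integralD Q (power_measure a) (power_measure b) m2 f20 m34 f34) in le0.
rewrite (triple_integralD Q (power_measure a) (power_measure b) m3 f30 m4 f40) in le0.
have k0E : (0 <= kappa%:E)%E by rewrite lee_fin ltW.
rewrite e0; apply: (le_trans (lee_wpmul2l k0E le0)).
have T0 f : (forall u t g, 0 <= f u t g)%E -> (0 <= T f)%E.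
  by move=> h; apply: integral_ge0 => u _; apply: integral_ge0 => t _; exact: integral_ge0.
rewrite -/T.
have [[[T1 T2] T3] T4] := (T0 f1 f10, T0 f2 f20, T0 f3 f30, T0 f4 f40).
have T34 := adde_ge0 T3 T4; have T24 := adde_ge0 T2 T34.
rewrite (ge0_muleDr _ T1 T24) (ge0_muleDr _ T2 T34) (ge0_muleDr _ T3 T4).
rewrite -!addeA; apply: leeD; first by rewrite (e1 1)// mulr1.
apply: leeD; first by rewrite e2.
by apply: leeD; [rewrite e1// mulr_ge0|exact: e4].
Qed.
End cone_law_bias_le.

Section bounded_expectation.
Context d (T : measurableType d) (R : realType) (Q : probability T R).
Variables (D : set T) (mD : measurable D) (QD : Q D = 1%E).
Implicit Types f g h : T -> R.

(** Bounded on a set D of probability 1 rather than everywhere: coordinates are bounded on the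
    sphere only. *)
Definition bounded_rv h :=
  measurable_fun [set: T] h /\ exists C, forall u, D u -> `|h u| <= C.

Lemma bounded_rv_integrable h : bounded_rv h -> Q.-integrable [set: T] (EFin \o h).
Proof.
move=> [mh [C hC]].
have mhE : measurable_fun [set: T] (EFin \o h) by exact/measurable_EFinP.
apply/integrableP; split=> //.
apply: (@le_lt_trans _ _ (\int[Q]_u (cst `|C|%:E) u)%E); last first.
  by rewrite integral_cst// -[ltLHS]/(`|C|%:E * Q setT)%E probability_setT mule1 ltry.
apply: ae_ge0_le_integral => //.
  exact: measurableT_comp.
  by move=> u _; rewrite lee_fin.
exists (~` D); split => //; first exact: measurableC.
  by apply: (etrans (probability_setC Q mD)); rewrite QD subee.
move=> u /= nh Du; apply: nh => _; rewrite lee_fin.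
exact: le_trans (hC u Du) (ler_norm _).
Qed.

Lemma bounded_rv_cst (c : R) : bounded_rv (fun=> c).
Proof. by split=> //; exists `|c| => u _. Qed.

Lemma bounded_rvD f g : bounded_rv f -> bounded_rv g -> bounded_rv (fun u => f u + g u).
Proof.
move=> [mf [C fC]] [mg [C' gC]]; split; first exact: measurable_funD.
exists (C + C') => u Du; apply: (le_trans (ler_normD _ _)).
by apply: lerD; [exact: fC|exact: gC].
Qed.

Lemma bounded_rvM f g : bounded_rv f -> bounded_rv g -> bounded_rv (fun u => f u * g u).
Proof.
move=> [mf [C fC]] [mg [C' gC]]; split; first exact: measurable_funM.
exists (C * C') => u Du; rewrite normrM.
by apply: ler_pM => //; [exact: fC|exact: gC].
Qed.

Lemma bounded_rv_norm f : bounded_rv f -> bounded_rv (fun u => `|f u|).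
Proof.
move=> [mf [C fC]]; split; first exact: (measurableT_comp (@normr_measurable R setT)).
by exists C => u Du; rewrite normr_id; exact: fC.
Qed.

Lemma bounded_rv_sum (I : Type) (r : seq I) (f : I -> T -> R) :
  (forall i, bounded_rv (f i)) -> bounded_rv (fun u => \sum_(i <- r) f i u).
Proof.
move=> bf; elim: r => [|i r IH].
  under eq_fun do rewrite big_nil; exact: bounded_rv_cst.
by under eq_fun do rewrite big_cons; exact: bounded_rvD.
Qed.

Lemma bounded_rv_homo (F : R -> R) f : measurable_fun [set: R] F ->
  {homo F : x y / x <= y} -> bounded_rv f -> bounded_rv (fun u => F (f u)).
Proof.
move=> mF hF [mf [C fC]]; split; first exact: measurableT_comp.
exists (`|F C| + `|F (- C)|) => u Du.
have := fC u Du; rewrite ler_norml => /andP[/hF h1 /hF h2].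
have n1 := ler_norm (F C); have n2 := ler_norm (- F (- C)); rewrite normrN in n2.
have n3 := normr_ge0 (F C); have n4 := normr_ge0 (F (- C)).
by rewrite ler_norml; apply/andP; split; lra.
Qed.

Lemma Rintegral_sum (I : Type) (r : seq I) (f : I -> T -> R) :
  (forall i, bounded_rv (f i)) ->
  \int[Q]_u (\sum_(i <- r) f i u) = \sum_(i <- r) \int[Q]_u f i u.
Proof.
move=> bf; elim: r => [|i r IH].
  by under eq_Rintegral do rewrite big_nil; rewrite Rintegral_cst// mul0r big_nil.
under eq_Rintegral do rewrite big_cons.
rewrite RintegralD// ?IH ?big_cons//; apply: bounded_rv_integrable => //.
exact: bounded_rv_sum.
Qed.

Lemma EFin_Rintegral h : bounded_rv h -> (\int[Q]_u h u)%:E = (\int[Q]_u (h u)%:E)%E.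
Proof.
by move=> bh; rewrite /Rintegral fineK//; apply: integrable_fin_num => //;
  exact: bounded_rv_integrable.
Qed.

Lemma bounded_rvZ (c : R) f : bounded_rv f -> bounded_rv (fun u => c * f u).
Proof. by move=> bf; apply: bounded_rvM => //; exact: bounded_rv_cst. Qed.

Lemma Rintegral_Zl (c : R) f : bounded_rv f ->
  \int[Q]_u (c * f u) = c * \int[Q]_u f u.
Proof. by move=> bf; rewrite RintegralZl//; exact: bounded_rv_integrable. Qed.

Lemma Rintegral_le f g : bounded_rv f -> bounded_rv g -> (forall u, f u <= g u) ->
  \int[Q]_u f u <= \int[Q]_u g u.
Proof.
by move=> bf bg fg; apply: le_Rintegral => //; exact: bounded_rv_integrable.
Qed.

Lemma Rintegral_add f g : bounded_rv f -> bounded_rv g ->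
  \int[Q]_u (f u + g u) = \int[Q]_u f u + \int[Q]_u g u.
Proof. by move=> bf bg; rewrite RintegralD//; exact: bounded_rv_integrable. Qed.

End bounded_expectation.

Lemma measurable_lp_sphere (R : realType) (p : R) n : measurable (@lp_sphere R p n).
Proof.
rewrite -[X in measurable X]setTI; apply: (@measurable_lp_pow R p n measurableT [set 1]).
exact: measurable_set1.
Qed.

(** * Linear forms under the cone law *)

Section cone_law_projection.
Context {R : realType} (p : R) (p0 : 0 < p) (m : nat).
Variable Q : probability (m.+1.-tuple R) R.
Hypothesis Qcone : forall A, measurable A -> A `<=` @lp_sphere R p m.+1 ->
  Q A = cone_measure p A.
Variable w : 'I_m.+1 -> R.
Implicit Types (j : 'I_m.+1) (u : m.+1.-tuple R).

Let sphere := @lp_sphere R p m.+1.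
Let sphere1 : Q sphere = 1%E. Proof. exact: (cone_law_sphere p0 (ltn0Sn m) Qcone). Qed.
Let msphere : measurable sphere := @measurable_lp_sphere R p m.+1.
Let bnd (h : m.+1.-tuple R -> R) : Prop := bounded_rv sphere h.

Definition linear_form u : R := \sum_(i < m.+1) w i * tnth u i.
Let W := linear_form.
Definition linear_form_rest j (y : m.-tuple R) : R :=
  \sum_(k < m) w (lift j k) * tnth y k.
Let S j u := linear_form_rest j (tuple_remove j u).

Lemma linear_formE j u :
  W u = w j * tnth u j + linear_form_rest j (tuple_remove j u).
Proof.
rewrite /W /linear_form (bigD1_ord j)//=; congr (_ + _).
by apply: eq_bigr => k _; rewrite tnth_remove.
Qed.

Lemma linear_form_flip j u :
  W (tuple_flip j u) = linear_form_rest j (tuple_remove j u) - w j * tnth u j.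
Proof.
rewrite (linear_formE j) tnth_flip eqxx mulrN addrC; congr (linear_form_rest j _ - _).
apply: eq_from_tnth => k; rewrite !tnth_remove tnth_flip.
by rewrite eq_sym (negbTE (neq_lift _ _)).
Qed.

Lemma linear_form_rest_scale j s y :
  linear_form_rest j (tuple_scale s y) = s * linear_form_rest j y.
Proof.
rewrite /linear_form_rest mulr_sumr; apply: eq_bigr => k _.
by rewrite tnth_scale mulrCA.
Qed.

Lemma measurable_linear_form_rest j : measurable_fun [set: m.-tuple R] (linear_form_rest j).
Proof.
by apply: measurable_sum => k; apply: measurable_funM => //; exact: measurable_tnth.
Qed.

Lemma bounded_rv_coord j : bnd (fun u => tnth u j).
Proof.
split; first exact: measurable_tnth.
exists 1 => u Su; apply: (lp_coord_le1 p0); rewrite /lp_pow; move: Su => /= ->//.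
Qed.

Lemma bounded_rv_linear_form : bnd W.
Proof. by apply: bounded_rv_sum => i; apply: bounded_rvZ; exact: bounded_rv_coord. Qed.

Lemma bounded_rv_linear_form_rest j : bnd (S j).
Proof.
have -> : S j = (fun u => W u + (- w j) * tnth u j).
  by apply/funext => u; rewrite (linear_formE j) mulNr addrAC subrr add0r.
apply: bounded_rvD; first exact: bounded_rv_linear_form.
by apply: bounded_rvZ; exact: bounded_rv_coord.
Qed.

Lemma Rintegral_cone_law_flip j (h : m.+1.-tuple R -> R) :
  measurable_fun [set: m.+1.-tuple R] h ->
  \int[Q]_u h (tuple_flip j u) = \int[Q]_u h u.
Proof.
move=> mh; rewrite /Rintegral; congr fine.
have mhE : measurable_fun [set: m.+1.-tuple R] (EFin \o h) by exact/measurable_EFinP.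
rewrite integralE [RHS]integralE; congr (_ - _)%E.
  transitivity (\int[Q]_u (EFin \o h)^\+ (tuple_flip j u))%E.
    by apply: eq_integral => u _; rewrite !funeposE.
  exact: (ge0_integral_cone_law_flip p0 Qcone j (measurable_funepos mhE)
    (fun u => funepos_ge0 _ u)).
transitivity (\int[Q]_u (EFin \o h)^\- (tuple_flip j u))%E.
  by apply: eq_integral => u _; rewrite !funenegE.
exact: (ge0_integral_cone_law_flip p0 Qcone j (measurable_funeneg mhE)
  (fun u => funeneg_ge0 _ u)).
Qed.

(** The flip preserves Q and changes the sign of u_j, so E[u_j F(W)] also equals -E[u_j F(W')], with
    W' the flipped form; the right-hand side is the average of the two. *)
Lemma Rintegral_coord_flip j (F : R -> R) : measurable_fun [set: R] F ->
  bnd (fun u => F (W u)) -> bnd (fun u => F (W (tuple_flip j u))) ->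
  \int[Q]_u (tnth u j * F (W u)) =
  2^-1 * \int[Q]_u (tnth u j * (F (W u) - F (W (tuple_flip j u)))).
Proof.
move=> mF bF bFf; have bu := bounded_rv_coord j.
have b1 := bounded_rvM bu bF; have b2 := bounded_rvM bu bFf.
have e : \int[Q]_u (- 1 * (tnth u j * F (W (tuple_flip j u)))) =
    \int[Q]_u (tnth u j * F (W u)).
  rewrite -[RHS](Rintegral_cone_law_flip j (proj1 b1)).
  by apply: eq_Rintegral => u _; rewrite tnth_flip eqxx mulN1r mulNr.
rewrite (_ : \int[Q]_u (tnth u j * (F (W u) - _)) = \int[Q]_u (tnth u j * F (W u)
    + - 1 * (tnth u j * F (W (tuple_flip j u))))); last first.
  by apply: eq_Rintegral => u _; rewrite mulrBr mulN1r.
rewrite (Rintegral_add msphere sphere1 b1 (bounded_rvZ _ b2)) e; lra.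
Qed.

Lemma Rintegral_coord2 j : \int[Q]_u (tnth u j ^+ 2) = sigma2 m.+1 p.
Proof.
have := cone_law_sigma2 p0 Qcone j.
rewrite /Rintegral (_ : \int[Q]_u _ = \int[Q]_u (tnth u j ^+ 2)%:E)%E; first by move=> ->.
apply: eq_integral => u _.
by rewrite (powR_mulrn 2 (normr_ge0 _)) -normrX ger0_norm// sqr_ge0.
Qed.

Lemma cone_law_norm3 j :
  (\int[Q]_u (`|tnth u j| `^ 3)%:E = (m_np m.+1 p * sigma2 m.+1 p)%:E)%E.
Proof.
apply: (etrans (cone_law_moment p0 Qcone j (ler0n R 3))); congr (_%:E).
have -> : m.+1%:R + 3 = m.+1.+3%:R :> R by rewrite -natrD addn3.
have -> : 1 + 3 = 4 :> R by lra.
rewrite /m_np /sigma2.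
have g1 : Gamma (3 / p) != 0 by rewrite gt_eqF// Gamma_gt0// divr_gt0.
have g2 : Gamma (m.+3%:R / p) != 0 by rewrite gt_eqF// Gamma_gt0// divr_gt0// ltr0n.
have g3 : Gamma (1 / p) != 0 by rewrite gt_eqF// Gamma_gt0// divr_gt0.
have g4 : Gamma (m.+1.+3%:R / p) != 0 by rewrite gt_eqF// Gamma_gt0// divr_gt0// ltr0n.
move: (Gamma (3 / p)) (Gamma (m.+3%:R / p)) (Gamma (1 / p)) (Gamma (m.+1.+3%:R / p))
  (Gamma (4 / p)) (Gamma (m.+1%:R / p)) g1 g2 g3 g4 => a b c d e f a0 b0 c0 d0.
by field; rewrite a0 b0 c0 d0.
Qed.

Lemma Rintegral_norm3 j : \int[Q]_u (`|tnth u j| ^+ 3) = m_np m.+1 p * sigma2 m.+1 p.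
Proof.
have := cone_law_norm3 j.
rewrite /Rintegral (_ : \int[Q]_u _ = \int[Q]_u (`|tnth u j| ^+ 3)%:E)%E; first by move=> ->.
by apply: eq_integral => u _; rewrite (powR_mulrn 3 (normr_ge0 _)).
Qed.

Lemma sigma2_gt0 : 0 < sigma2 m.+1 p.
Proof.
by rewrite /sigma2 divr_gt0// mulr_gt0// Gamma_gt0// divr_gt0// ltr0n.
Qed.

Let bflip j : bnd (fun u => W (tuple_flip j u)).
Proof.
under eq_fun do rewrite (linear_form_flip j) -mulNr.
apply: bounded_rvD; first exact: bounded_rv_linear_form_rest.
by apply: bounded_rvZ; exact: bounded_rv_coord.
Qed.

(* Expanding (v - s)^2 (v + s) >= 0 with s^2 = E v^2. *)
Lemma sigma2_norm_le j :
  sigma2 m.+1 p * \int[Q]_u `|tnth u j| <= m_np m.+1 p * sigma2 m.+1 p.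
Proof.
have s0 : 0 < sigma m.+1 p by rewrite sqrtr_gt0 sigma2_gt0.
have s2 : sigma m.+1 p ^+ 2 = sigma2 m.+1 p by rewrite sqr_sqrtr// ltW// sigma2_gt0.
set s := sigma m.+1 p in s0 s2 *.
have bu := bounded_rv_coord j; have bn := bounded_rv_norm bu.
have b2 : bnd (fun u => tnth u j ^+ 2) by exact: (bounded_rvM bu bu).
have b3 : bnd (fun u => `|tnth u j| ^+ 3).
  under eq_fun do rewrite exprS expr2.
  by apply: bounded_rvM => //; apply: bounded_rvM.
have bs := bounded_rvZ s b2; have bn' := bounded_rvZ (s ^+ 2) bn.
have := Rintegral_le msphere sphere1 (bounded_rvD bs bn')
  (bounded_rvD b3 (bounded_rv_cst _ (s ^+ 3))).
rewrite (Rintegral_add msphere sphere1 bs bn').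
rewrite (Rintegral_add msphere sphere1 b3 (bounded_rv_cst _ _)).
rewrite (Rintegral_Zl msphere sphere1 _ b2) (Rintegral_Zl msphere sphere1 _ bn).
rewrite Rintegral_coord2 Rintegral_norm3 Rintegral_cst//.
have -> : fine (Q setT) = 1 by rewrite probability_setT.
rewrite -s2 mulr1 => h; suff : s * s ^+ 2 + s ^+ 2 * \int[Q]_u `|tnth u j| <=
  m_np m.+1 p * s ^+ 2 + s ^+ 3 by rewrite -exprS addrC lerD2r.
apply: h => u; rewrite -[tnth u j ^+ 2]real_normK ?num_real//.
have := normr_ge0 (tnth u j); move: (`|tnth u j| : R) => v v0.
have : 0 <= (v - s) ^+ 2 * (v + s) by rewrite mulr_ge0 ?sqr_ge0 ?addr_ge0// ltW.
move=> h0; rewrite -subr_ge0; apply: (le_trans h0).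
by rewrite le_eqVlt; apply/orP; left; apply/eqP; ring.
Qed.

(** Flipping with F = id leaves W - W' = 2 w_j u_j, so the mixed terms disappear by symmetry. *)
Lemma Rintegral_linear_form2 : \int[Q]_u (W u ^+ 2) =
  \sum_(j < m.+1) w j ^+ 2 * sigma2 m.+1 p.
Proof.
have bW := bounded_rv_linear_form.
have bj j := bounded_rvM (bounded_rv_coord j) bW.
have -> : \int[Q]_u (W u ^+ 2) = \int[Q]_u (\sum_(j < m.+1) w j * (tnth u j * W u)).
  apply: eq_Rintegral => u _; rewrite expr2 {1}/W /linear_form mulr_suml.
  by apply: eq_bigr => j _; rewrite mulrA.
rewrite (Rintegral_sum msphere sphere1 _ (fun j => bounded_rvZ (w j) (bj j))).
apply: eq_bigr => j _; rewrite (Rintegral_Zl msphere sphere1 _ (bj j)).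
rewrite (Rintegral_coord_flip (F := id) _ bW (bflip j))//.
have b2 : bnd (fun u => tnth u j ^+ 2).
  by exact: (bounded_rvM (bounded_rv_coord j) (bounded_rv_coord j)).
have -> : \int[Q]_u (tnth u j * (W u - W (tuple_flip j u))) =
    \int[Q]_u (2 * w j * tnth u j ^+ 2).
  apply: eq_Rintegral => u _; rewrite linear_form_flip (linear_formE j); ring.
by rewrite (Rintegral_Zl msphere sphere1 _ b2) Rintegral_coord2; field.
Qed.

Hypothesis w_norm : \sum_(j < m.+1) w j ^+ 2 * sigma2 m.+1 p = 1.

(** 2 S_j is the sum of W and its flip, which have the same law; hence E|S_j| <= E|W| <= (1 + E
    W^2)/2 = 1. *)
Lemma Rintegral_rest_le1 j : \int[Q]_u `|S j u| <= 1.
Proof.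
have bW := bounded_rv_linear_form; have bn := bounded_rv_norm bW.
have bf := bounded_rv_norm (bflip j).
have bS := bounded_rv_norm (bounded_rv_linear_form_rest j).
have b2 : bnd (fun u => W u ^+ 2) by exact: (bounded_rvM bW bW).
have ef : \int[Q]_u `|W (tuple_flip j u)| = \int[Q]_u `|W u|.
  exact: (Rintegral_cone_law_flip j (proj1 bn)).
have h1 : \int[Q]_u (2 * `|S j u|) <= \int[Q]_u (`|W u| + `|W (tuple_flip j u)|).
  apply: (Rintegral_le msphere sphere1) => [||u].
  - exact: bounded_rvZ.
  - exact: bounded_rvD.
  have -> : 2 * `|S j u| = `|W u + W (tuple_flip j u)|.
    rewrite linear_form_flip (linear_formE j) /S.
    rewrite -[in LHS](gtr0_norm (ltr0n R 2)) -normrM; congr `|_|; ring.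
  exact: ler_normD.
have h2 : \int[Q]_u (2 * `|W u|) <= \int[Q]_u (1 + W u ^+ 2).
  apply: (Rintegral_le msphere sphere1) => [||u].
  - exact: bounded_rvZ.
  - by apply: bounded_rvD => //; exact: bounded_rv_cst.
  rewrite -[W u ^+ 2]real_normK ?num_real//; move: (`|W u| : R) => v.
  rewrite -subr_ge0; apply: (le_trans (sqr_ge0 (v - 1))).
  by rewrite le_eqVlt; apply/orP; left; apply/eqP; ring.
rewrite (Rintegral_Zl msphere sphere1 _ bS) (Rintegral_add msphere sphere1 bn bf) ef in h1.
rewrite (Rintegral_Zl msphere sphere1 _ bn) in h2.
rewrite (Rintegral_add msphere sphere1 (bounded_rv_cst _ 1) b2) in h2.
rewrite Rintegral_cst// Rintegral_linear_form2 w_norm in h2.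
have e1 : fine (Q setT) = 1 by rewrite probability_setT.
by rewrite e1 in h2; lra.
Qed.

Variables (F F1 : R -> R) (L : R).
Hypothesis F_derive : forall z : R, is_derive z 1 F (F1 z).
Hypothesis F1_ge0 : forall z : R, 0 <= F1 z.
Hypothesis F1_lip : forall z y : R, `|F1 z - F1 y| <= L * `|z - y|.
Hypothesis mF1 : measurable_fun [set: R] F1.

Let M : R := Num.max p^-1 1 * (2 / m.+1.+2%:R).
Let m3 : R := m_np m.+1 p * sigma2 m.+1 p.

Let L0 : 0 <= L.
Proof. by have := F1_lip 1 0; rewrite subr0 normr1 mulr1; exact: le_trans. Qed.

Let mF : measurable_fun [set: R] F.
Proof.
apply: continuous_measurable_fun => z; apply: differentiable_continuous.
exact/derivable1_diffP/ex_derive.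
Qed.

Let homoF : {homo F : x y / x <= y} := is_derive_homo F_derive F1_ge0.

Let bF : bnd (fun u => F (W u)).
Proof. exact: bounded_rv_homo (bounded_rv_linear_form). Qed.

Let bFf j : bnd (fun u => F (W (tuple_flip j u))).
Proof. exact: bounded_rv_homo (bflip j). Qed.

Let bF1 : bnd (fun u => F1 (W u)).
Proof.
have [mW [C hC]] := bounded_rv_linear_form; split; first exact: measurableT_comp.
exists (`|F1 0| + L * C) => u Du.
rewrite -[F1 (W u)](subrK (F1 0)) addrC; apply: (le_trans (ler_normD _ _)).
rewrite lerD2l; apply: (le_trans (F1_lip _ _)); rewrite subr0.
exact: ler_wpM2l (hC u Du).
Qed.

Lemma linear_form_coord_le j :
  w j * \int[Q]_u (tnth u j * F (W u)) <=
  w j ^+ 2 * (sigma2 m.+1 p * \int[Q]_u F1 (W u)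
    + 3 / 2 * L * `|w j| * m3 + sigma2 m.+1 p * (L * M)).
Proof.
have bu := bounded_rv_coord j; have bn := bounded_rv_norm bu.
have bS := bounded_rv_norm (bounded_rv_linear_form_rest j).
have bd : bnd (fun u => F (W u) - F (W (tuple_flip j u))).
  under eq_fun do rewrite -mulN1r.
  exact: (bounded_rvD bF (bounded_rvZ (-1) (bFf j))).
have bud := bounded_rvM bu bd.
pose k u := symmetric_quotient F (w j * tnth u j) (S j u).
have k0 u : 0 <= k u by exact: symmetric_quotient_ge0.
have eW u : w j * tnth u j + S j u = W u by rewrite -linear_formE.
(* This symmetrized form of w_j u_j F(W) also holds for w_j = 0 or u_j = 0, when both sides
   vanish. *)
have e1 u : w j ^+ 2 * (`|tnth u j| `^ 2 * k u) =
    w j / 2 * (tnth u j * (F (W u) - F (W (tuple_flip j u)))).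
  rewrite (powR_mulrn 2 (normr_ge0 _)) real_normK ?num_real//.
  rewrite linear_form_flip -eW /k /symmetric_quotient [S j u + _]addrC /S.
  move: (linear_form_rest _ _) (tnth u j) (w j) => s x a.
  have [->|a0] := eqVneq a 0; first by rewrite expr0n/= !mul0r.
  have [->|x0] := eqVneq x 0; first by rewrite expr0n/= !mul0r !mulr0.
  by field; rewrite a0 x0.
have bk : bnd (fun u => w j ^+ 2 * (`|tnth u j| `^ 2 * k u)).
  under eq_fun do rewrite e1; exact: bounded_rvZ.
have eL : w j * \int[Q]_u (tnth u j * F (W u)) =
    \int[Q]_u (w j ^+ 2 * (`|tnth u j| `^ 2 * k u)).
  rewrite (Rintegral_coord_flip mF bF (bFf j)) mulrA -(Rintegral_Zl msphere sphere1 _ bud).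
  by apply: eq_Rintegral => u _; rewrite e1.
rewrite eL -lee_fin (EFin_Rintegral msphere sphere1 bk).
have mk : measurable_fun [set: m.+1.-tuple R] (fun u => (`|tnth u j| `^ 2 * k u)%:E).
  apply/measurable_EFinP; apply: measurable_funM.
    by apply: measurable_fun_powR; case: bn.
  apply: measurable_fun_div.
    apply: measurable_funB; apply: (measurableT_comp mF).
      apply: measurable_funD; first exact: proj1 (bounded_rv_linear_form_rest j).
      by apply: measurable_funM => //; case: bu.
    apply: measurable_funB; first exact: proj1 (bounded_rv_linear_form_rest j).
    by apply: measurable_funM => //; case: bu.
  by apply: measurable_funM => //; apply: measurable_funM => //; case: bu.
have -> : (\int[Q]_u (w j ^+ 2 * (`|tnth u j| `^ 2 * k u))%:E =
    (w j ^+ 2)%:E * \int[Q]_u (`|tnth u j| `^ 2 * k u)%:E)%E.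
  rewrite -(ge0_integralZl Q measurableT mk); last by rewrite lee_fin sqr_ge0.
    by apply: eq_integral => u _; rewrite EFinM.
  by move=> u _; rewrite lee_fin mulr_ge0 ?powR_ge0.
rewrite [leRHS]EFinM; apply: lee_wpmul2l; first by rewrite lee_fin sqr_ge0.
apply: (le_trans (cone_law_bias_le p0 Qcone F_derive F1_ge0 F1_lip mF1 j (w j)
  (measurable_linear_form_rest j) (@linear_form_rest_scale j))).
under eq_integral do rewrite eW.
rewrite -(EFin_Rintegral msphere sphere1 bF1) -(EFin_Rintegral msphere sphere1 bn).
rewrite -(EFin_Rintegral msphere sphere1 bS) cone_law_norm3 -/m3 -!EFinM -!EFinD lee_fin.
have h1 := sigma2_norm_le j; have h2 := Rintegral_rest_le1 j.
have Lw0 : 0 <= L * `|w j| by rewrite mulr_ge0.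
have M0 : 0 <= sigma2 m.+1 p * (L * M).
  by rewrite mulr_ge0 ?(ltW sigma2_gt0)// mulr_ge0// mulr_ge0// ?le_max ?ler01 ?orbT.
have h3 := ler_wpM2l Lw0 h1; have h4 := ler_wpM2l M0 h2.
rewrite mulr1 -/(S j _) in h4; rewrite -/m3 in h3.
rewrite -!addrA lerD2l addrA; apply: lerD => //.
(* The 3/2 is 1/2, from the width of the interval, plus 1, from E u_j^2 E|u_j| <= E|u_j|^3. *)
apply: (@le_trans _ _ (L * (`|w j| / 2) * m3 + L * `|w j| * m3)).
  rewrite lerD2l; apply: le_trans h3.
  by rewrite le_eqVlt; apply/orP; left; apply/eqP; ring.
by rewrite le_eqVlt; apply/orP; left; apply/eqP; field.
Qed.

(** The weights w_j^2 E u_j^2 sum to 1, so the terms common to all j are averaged, not added up. *)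
Lemma linear_form_stein_le :
  \int[Q]_u (W u * F (W u)) <= \int[Q]_u F1 (W u)
    + 3 / 2 * L * m3 * \sum_(j < m.+1) `|w j| ^+ 3 + L * M.
Proof.
have bj j := bounded_rvM (bounded_rv_coord j) bF.
have -> : \int[Q]_u (W u * F (W u)) =
    \int[Q]_u (\sum_(j < m.+1) w j * (tnth u j * F (W u))).
  apply: eq_Rintegral => u _; rewrite {1}/W /linear_form mulr_suml.
  by apply: eq_bigr => j _; rewrite mulrA.
rewrite (Rintegral_sum msphere sphere1 _ (fun j => bounded_rvZ (w j) (bj j))).
apply: (@le_trans _ _ (\sum_(j < m.+1) (w j ^+ 2 * sigma2 m.+1 p *
   (\int[Q]_u F1 (W u) + L * M) + 3 / 2 * L * m3 * `|w j| ^+ 3))).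
  apply: ler_sum => j _; rewrite (Rintegral_Zl msphere sphere1 _ (bj j)).
  apply: (le_trans (linear_form_coord_le j)).
  rewrite (exprSr _ 2) real_normK ?num_real//.
  by rewrite le_eqVlt; apply/orP; left; apply/eqP; ring.
rewrite big_split/= -mulr_suml w_norm mul1r -mulr_sumr.
by rewrite addrAC lexx.
Qed.

End cone_law_projection.

(** * The Stein equation *)

Section stein_monotone.
Context {R : realType} (K : R) (K0 : 0 < K).
Implicit Types (g H G : R -> R) (c w x y e : R).

Definition gauss x : R := K * expR (- (x * x / 2)).

Lemma gauss_gt0 x : 0 < gauss x.
Proof. by rewrite mulr_gt0// expR_gt0. Qed.

Lemma gaussN x : gauss (- x) = gauss x.
Proof. by rewrite /gauss mulrNN. Qed.

Lemma is_derive_gauss (x : R) : is_derive x 1 gauss (- x * gauss x).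
Proof.
have di := is_derive_ident x; have dc c := is_derive_const c x.
have d1 := is_derive_mul (is_derive_mul di di) (dc (- 2^-1)).
have d2 := @is_derive_comp1 _ expR _ x _ _ (is_derive_expR _) d1.
have d3 := is_derive_mul (dc K) d2.
have -> : gauss = (fun y => K * expR (y * y * - 2^-1)).
  by apply/funext => y; rewrite /gauss mulrN.
by apply: (is_derive_val d3); rewrite /gauss; field.
Qed.

(** Convergence to 0 at +oo. The behaviour at -oo is expressed through x |-> g (- x), since
    statements on the left are obtained by reflection. *)
Definition vanishes g := forall e, 0 < e -> exists a, forall x, a <= x -> `|g x| < e.

Lemma vanishesD g1 g2 : vanishes g1 -> vanishes g2 -> vanishes (fun x => g1 x + g2 x).
Proof.
move=> v1 v2 e e0; have e2 : 0 < e / 2 by rewrite divr_gt0.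
have [a1 h1] := v1 _ e2; have [a2 h2] := v2 _ e2.
exists (Num.max a1 a2) => x; rewrite ge_max => /andP[/h1 x1 /h2 x2].
by apply: (le_lt_trans (ler_normD _ _)); lra.
Qed.

Lemma vanishesM g b (C : R) : vanishes g -> (forall x, `|b x| <= C) ->
  vanishes (fun x => b x * g x).
Proof.
move=> vg bC e e0.
have C0 : 0 <= C by exact: le_trans (bC 0).
have eC : 0 < e / (C + 1) by rewrite divr_gt0// ltr_wpDl.
have [a h] := vg _ eC; exists a => x /h gx; rewrite normrM.
apply: (@le_lt_trans _ _ (C * `|g x|)); first by rewrite ler_wpM2r.
have : `|g x| * (C + 1) < e by rewrite -ltr_pdivlMr// ltr_wpDl.
by apply: le_lt_trans; rewrite mulrDr mulr1 mulrC lerDl.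
Qed.

Lemma vanishes_gauss : vanishes gauss.
Proof.
(* For x >= 1, exp(x^2/2) >= 1 + x/2, which exceeds K/e once x >= 2K/e. *)
move=> e e0; exists (Num.max 1 (2 * (K / e))) => x; rewrite ge_max => /andP[x1 xK].
rewrite gtr0_norm ?gauss_gt0// /gauss expRN.
rewrite ltr_pdivrMr ?expR_gt0// -ltr_pdivrMl//.
have h : 1 + x * x / 2 <= expR (x * x / 2) by exact: expR_ge1Dx.
apply: lt_le_trans h; rewrite mulrC.
have : x <= x * x by rewrite ler_peMl// (le_trans _ x1).
lra.
Qed.

Lemma vanishes_le0 g w : vanishes g -> (forall x, w <= x -> g w <= g x) -> g w <= 0.
Proof.
move=> vg gw; rewrite leNgt; apply/negP => g0.
have [a h] := vg _ g0; pose x := Num.max a w.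
have /h : a <= x by rewrite le_max lexx.
have /gw : w <= x by rewrite le_max lexx orbT.
by move=> h1 h2; have := le_lt_trans h1 (le_lt_trans (ler_norm _) h2); rewrite ltxx.
Qed.

Lemma is_derive_ge0 (f df : R -> R) (a b : R) : a <= b ->
  (forall x : R, is_derive x 1 f (df x)) -> (forall x, a < x < b -> 0 <= df x) ->
  f a <= f b.
Proof.
move=> ab fdf df0; rewrite -lerN2.
apply: (@is_derive_le0 _ (fun z => - f z) (fun z => - df z)) => // z zab.
by rewrite oppr_le0 df0.
Qed.

Lemma is_derive_inv g x (a : R) : g x != 0 -> is_derive x 1 g a ->
  is_derive x 1 (fun y => (g y)^-1) (- (g x ^- 2 * a)).
Proof.
move=> gx dg; apply: (is_derive_val (@is_deriveV _ _ _ _ _ gx dg)).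
by rewrite /GRing.scale/= mulNr.
Qed.

Section monotone_right.
Variables (H G : R -> R) (c : R).
Hypothesis H_homo : {homo H : x y / x <= y}.
Hypothesis G_derive : forall x : R, is_derive x 1 G ((H x - c) * gauss x).
Hypothesis G_vanishes : vanishes G.

(** To the right of w the derivative of G is nonnegative, so G increases there to its limit 0. *)
Lemma stein_right_le0 w : c <= H w -> G w <= 0.
Proof.
move=> cw; apply: vanishes_le0 => // x wx.
apply: (is_derive_ge0 wx G_derive) => y /andP[wy _].
rewrite mulr_ge0// ?(ltW (gauss_gt0 y))// subr_ge0 (le_trans cw)//.
by apply: H_homo; exact: ltW.
Qed.

(* x phi(x) / (1 + x^2) is the Mills lower bound for the Gaussian tail. *)
Lemma stein_right_mills w : 0 <= w -> c <= H w ->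
  (1 + w * w) * G w + w * ((H w - c) * gauss w) <= 0.
Proof.
move=> w0 cw; pose q x : R := x / (1 + x * x).
have x20 x : 0 < 1 + x * x by rewrite ltr_wpDr// -expr2 sqr_ge0.
pose g x := G x + (H w - c) * (q x * gauss x).
have dq (x : R) : is_derive x 1 q ((1 + x * x)^-1 - 2 * x * x / (1 + x * x) ^+ 2).
  have di := is_derive_ident x; have dc c := is_derive_const c x.
  have d1 := is_derive_add (dc 1) (is_derive_mul di di).
  have nz : 1 + x * x != 0 by rewrite gt_eqF.
  have d2 := @is_derive_inv (fun y => 1 + y * y) x _ nz d1.
  apply: (is_derive_val (is_derive_mul di d2)).
  by field.
have dg (x : R) : is_derive x 1 g ((H x - c) * gauss x + (H w - c) *
    ((2 / (1 + x * x) ^+ 2 - 1) * gauss x)).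
  have d3 := is_derive_mul (dq x) (is_derive_gauss x).
  have d4 := is_derive_add (G_derive x) (is_derive_mul (is_derive_const (H w - c) x) d3).
  apply: (is_derive_val d4); rewrite /q.
  have nz : 1 + x * x != 0 by rewrite gt_eqF.
  by field.
have vg : vanishes g.
  apply: vanishesD => //; apply: (@vanishesM _ _ `|H w - c|) => //.
  apply: (@vanishesM _ _ 1) => [|x]; first exact: vanishes_gauss.
  rewrite /q normrM normfV (gtr0_norm (x20 x)) ler_pdivrMr// mul1r.
  have := sqr_ge0 (`|x| - 1); have := real_normK (num_real x); rewrite !expr2; nra.
have : g w <= 0.
  (* The derivative of x/(1 + x^2) times [gauss] is (2/(1 + x^2)^2 - 1) times [gauss], hence at
     least -[gauss]. As H y >= H w, [g] increases on the right of w to 0. *)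
  apply: vanishes_le0 => // x wx; apply: (is_derive_ge0 wx dg) => y /andP[wy _].
  have hy : H w <= H y by apply: H_homo; exact: ltW.
  have e : 0 <= (H w - c) * (2 / (1 + y * y) ^+ 2).
    by rewrite mulr_ge0 ?subr_ge0// divr_ge0// sqr_ge0.
  rewrite (mulrA (H w - c)) -mulrDl; apply: mulr_ge0; last exact: ltW (gauss_gt0 y).
  rewrite mulrBr mulr1; lra.
rewrite /g /q -(pmulr_rle0 _ (x20 w)) mulrDr => h; apply: le_trans h.
have nz : 1 + w * w != 0 by rewrite gt_eqF.
by rewrite le_eqVlt; apply/orP; left; apply/eqP; field.
Qed.

End monotone_right.

Section monotone.
Variables (H G : R -> R) (c : R).
Hypothesis H_homo : {homo H : x y / x <= y}.
Hypothesis G_derive : forall x : R, is_derive x 1 G ((H x - c) * gauss x).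
Hypothesis G_vanishes : vanishes G.
Hypothesis GN_vanishes : vanishes (fun x => G (- x)).

(** The reflection x |-> -x preserves the setting, with -H(-x), -c and G(-x) for H, c and G; it
    reduces the left half-line to the right one. *)
Let HN x := - H (- x).
Let HN_homo : {homo HN : x y / x <= y}.
Proof. by move=> x y xy; rewrite lerN2; apply: H_homo; rewrite lerN2. Qed.

Let GN_derive (x : R) : is_derive x 1 (fun y => G (- y)) ((HN x - - c) * gauss x).
Proof.
have dN : is_derive x 1 (fun y : R => - y) (- 1).
  have := is_derive_sub (is_derive_const 0 x) (is_derive_ident x).
  by rewrite sub0r; under eq_fun do rewrite sub0r.
have d := @is_derive_comp1 _ G (fun y => - y) x _ _ (G_derive (- x)) dN.
by apply: (is_derive_val d); rewrite gaussN /HN; ring.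
Qed.

Lemma stein_le0 w : G w <= 0.
Proof.
have [cw|cw] := leP c (H w); first exact: (stein_right_le0 H_homo G_derive G_vanishes).
rewrite -[w]opprK; apply: (stein_right_le0 HN_homo GN_derive GN_vanishes).
by rewrite /HN opprK lerN2 ltW.
Qed.

(** The left-hand side is, up to the factor [gauss], the derivative of x G(x)/[gauss] x. If w and H
    w - c have opposite signs, both summands are nonpositive; otherwise the bound on the right or
    its reflection applies. *)
Lemma stein_mills w : (1 + w * w) * G w + w * ((H w - c) * gauss w) <= 0.
Proof.
have w20 : 0 <= 1 + w * w by rewrite addr_ge0// -expr2 sqr_ge0.
have gw := ltW (gauss_gt0 w).
have a0 : (1 + w * w) * G w <= 0 by rewrite mulr_ge0_le0// stein_le0.
have [w0|w0] := leP 0 w.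
  have [cw|cw] := leP c (H w).
    exact: (stein_right_mills H_homo G_derive G_vanishes).
  suff : w * ((H w - c) * gauss w) <= 0 by lra.
  by rewrite mulr_ge0_le0// mulr_le0_ge0// subr_le0 ltW.
have [cw|cw] := leP (H w) c.
  have wN : 0 <= - w by rewrite oppr_ge0 ltW.
  have cwN : - c <= HN (- w) by rewrite /HN opprK lerN2.
  have := stein_right_mills HN_homo GN_derive GN_vanishes wN cwN.
  rewrite /HN opprK gaussN mulrNN; apply: le_trans.
  by rewrite le_eqVlt; apply/orP; left; apply/eqP; ring.
suff : w * ((H w - c) * gauss w) <= 0 by lra.
by rewrite mulr_le0_ge0 ?(ltW w0)// mulr_ge0// subr_ge0 ltW.
Qed.

Lemma stein_xf_homo : {homo (fun x => x * (G x / gauss x)) : x y /~ x <= y}.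
Proof.
move=> y x xy.
apply: (@is_derive_le0 _ (fun z => z * (G z / gauss z))
    (fun z => ((1 + z * z) * G z + z * ((H z - c) * gauss z)) / gauss z)) => //.
  move=> z; have nz : gauss z != 0 by rewrite gt_eqF ?gauss_gt0.
  have d1 := is_derive_mul (G_derive z) (is_derive_inv nz (is_derive_gauss z)).
  apply: (is_derive_val (is_derive_mul (is_derive_ident z) d1)).
  by field.
by move=> z _; rewrite mulr_le0_ge0 ?stein_mills// invr_ge0 ltW// gauss_gt0.
Qed.

End monotone.

(** * The Stein solution for a Lipschitz test function *)

Section lipschitz.
Variables (h G : R -> R) (c : R).
Hypothesis h_lip : forall x y, `|h x - h y| <= `|x - y|.
Hypothesis G_derive : forall x : R, is_derive x 1 G ((h x - c) * gauss x).
Hypothesis G_vanishes : vanishes G.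
Hypothesis GN_vanishes : vanishes (fun x => G (- x)).

(** The solution of f'(x) - x f(x) = h(x) - c that stays bounded when G vanishes at both ends. *)
Definition stein_sol x : R := G x / gauss x.
Definition stein_sol' x : R := x * stein_sol x + (h x - c).
Let f := stein_sol.

Let plus_homo : {homo (fun x => x + h x) : x y / x <= y}.
Proof.
move=> x y xy; have := le_trans (ler_norm _) (h_lip x y).
rewrite distrC (ger0_norm (_ : 0 <= y - x)) ?subr_ge0//; lra.
Qed.

Let minus_homo : {homo (fun x => x - h x) : x y / x <= y}.
Proof.
move=> x y xy; have := le_trans (ler_norm _) (h_lip y x).
rewrite (ger0_norm (_ : 0 <= y - x)) ?subr_ge0//; lra.
Qed.

Let vN g : vanishes g -> vanishes (fun x => - g x).
Proof. by move=> vg e /vg[a ha]; exists a => x /ha; rewrite normrN. Qed.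

Let gauss_vanishesN : vanishes (fun x => gauss (- x)).
Proof. by under eq_fun do rewrite gaussN; exact: vanishes_gauss. Qed.

Let plus_derive (x : R) : is_derive x 1 (fun x => G x - gauss x)
  ((x + h x - c) * gauss x).
Proof.
by apply: (is_derive_val (is_derive_sub (G_derive x) (is_derive_gauss x))); ring.
Qed.

Let minus_derive (x : R) : is_derive x 1 (fun x => - G x - gauss x)
  ((x - h x - - c) * gauss x).
Proof.
have d := is_derive_sub (is_derive_sub (is_derive_const 0 x) (G_derive x))
  (is_derive_gauss x).
under [fun x => _]eq_fun do rewrite -sub0r.
by apply: (is_derive_val d); ring.
Qed.

Let pv : vanishes (fun x => G x - gauss x).
Proof. by apply: vanishesD => //; apply: vN; exact: vanishes_gauss. Qed.
Let pvN : vanishes (fun x => G (- x) - gauss (- x)).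
Proof. by apply: vanishesD => //; apply: vN. Qed.
Let mv : vanishes (fun x => - G x - gauss x).
Proof. by apply: vanishesD; apply: vN => //; exact: vanishes_gauss. Qed.
Let mvN : vanishes (fun x => - G (- x) - gauss (- x)).
Proof. by apply: vanishesD; apply: vN. Qed.

(** For h 1-Lipschitz, x + h and x - h are both nondecreasing. As x [gauss] x has primitive
    -[gauss], the monotone case gives G <= [gauss] and -G <= [gauss]. The same two functions give
    the Lipschitz bound for x f(x). *)
Lemma stein_sol_le1 x : `|f x| <= 1.
Proof.
have g0 := gauss_gt0 x.
rewrite /f /stein_sol normrM normfV (gtr0_norm g0) ler_pdivrMr// mul1r.
have := stein_le0 plus_homo plus_derive pv pvN x.
have := stein_le0 minus_homo minus_derive mv mvN x.
by rewrite ler_norml => h1 h2; apply/andP; split; lra.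
Qed.

Lemma stein_xf_lip x y : `|x * f x - y * f y| <= `|x - y|.
Proof.
wlog xy : x y / x <= y.
  move=> hw; have [xy|/ltW yx] := leP x y; first exact: hw.
  by rewrite distrC [leRHS]distrC; exact: hw.
have gx := gauss_gt0 x; have gy := gauss_gt0 y.
have := stein_xf_homo plus_homo plus_derive pv pvN xy.
have := stein_xf_homo minus_homo minus_derive mv mvN xy.
rewrite !mulrBl !mulNr !divff ?gt_eqF// -!/(stein_sol _) -!/(f _) !mulrBr !mulr1 !mulrN.
rewrite (distrC x) (ger0_norm (_ : 0 <= y - x)) ?subr_ge0// ler_norml => h1 h2.
by apply/andP; split; lra.
Qed.

Lemma stein_sol_derive (x : R) : is_derive x 1 f (stein_sol' x).
Proof.
have nz : gauss x != 0 by rewrite gt_eqF ?gauss_gt0.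
apply: (is_derive_val (is_derive_mul (G_derive x) (is_derive_inv nz (is_derive_gauss x)))).
by rewrite /stein_sol' /stein_sol; field.
Qed.

Lemma stein_sol'_lip x y : `|stein_sol' x - stein_sol' y| <= 2 * `|x - y|.
Proof.
have -> : stein_sol' x - stein_sol' y = (x * f x - y * f y) + (h x - h y).
  by rewrite /stein_sol' -/f; ring.
apply: (le_trans (ler_normD _ _)).
by have := stein_xf_lip x y; have := h_lip x y; lra.
Qed.

(** As |f| <= 1, the mean value theorem on [x, x + 1] finds a point where |f'| <= 2; moving from
    there to x costs at most 2 more. *)
Lemma stein_sol'_le4 x : `|stein_sol' x| <= 4.
Proof.
have cf : {within `[x, x + 1], continuous f}.
  by apply: derivable_within_continuous => z _; apply: ex_derive; exact: stein_sol_derive.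
have xx : x < x + 1 by rewrite ltrDl.
have [z zin e] := MVT xx (fun z _ => stein_sol_derive z) cf.
move: e; rewrite addrAC subrr add0r mulr1 => e.
have h1 : `|stein_sol' z| <= 2.
  rewrite -e; apply: (le_trans (ler_normB _ _)).
  have := stein_sol_le1 (x + 1); have := stein_sol_le1 x; lra.
have h2 : `|x - z| <= 1.
  move: zin; rewrite in_itv/= => /andP[z1 z2].
  by rewrite ler_norml; apply/andP; split; lra.
rewrite -(subrK (stein_sol' z) (stein_sol' x)); apply: (le_trans (ler_normD _ _)).
have := stein_sol'_lip x z; lra.
Qed.

End lipschitz.
End stein_monotone.

Lemma probability_tail (R : realType) (P : probability (measurableTypeR R) R) (e : R) :
  0 < e -> exists a : R, forall x, a <= x -> (P [set y | (x <= `|y|)%R] < e%:E)%E.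
Proof.
move=> e0; pose F (n : nat) : set R := [set y | n%:R <= `|y|].
have mF (a : R) : measurable [set y : R | a <= `|y|].
  exact: (@measurable_set_ler _ (measurableTypeR R) R (cst a) Num.norm (measurable_cst a)
    (@normr_measurable R setT)).
have F0 : \bigcap_n F n = set0.
  rewrite -subset0 => t /(_ (Num.bound `|t|) I).
  by rewrite /F /= leNgt => /negP; apply; exact: archi_boundP.
have : P \o F @ \oo --> 0%E.
  rewrite -(measure0 P) -F0; apply: nonincreasing_cvg_mu => //.
  - exact: le_lt_trans (probability_le1 P (mF _)) (ltry _).
  - by move=> i; exact: mF.
  - by rewrite F0.
  - move=> m n mn; apply/subsetPset => y /=; apply: le_trans.
    by rewrite ler_nat.
move=> /fine_cvgP[_ /cvgr0_norm_lt/(_ _ e0)] [n _ hn].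
exists n%:R => x nx; have := hn n (leqnn n) => /= h.
have fin : P (F n) \is a fin_num by exact: fin_num_measure P _ (mF _).
apply: (@le_lt_trans _ _ (P (F n))).
  apply: le_measure; rewrite ?inE; [exact: mF|exact: mF|].
  by move=> y /=; apply: le_trans.
rewrite -(fineK fin) lte_fin; exact: le_lt_trans (ler_norm _) h.
Qed.

(** * The primitive of the centred test function against the normal density *)

Section stein_solution.
Context {R : realType}.
Local Notation mu := (@lebesgue_measure R).
Let pdf : R -> R := normal_pdf 0 1.
Variables (h : R -> R) (B : R).
Hypothesis h_lip : forall x y, `|h x - h y| <= `|x - y|.
Hypothesis h_bnd : forall x, `|h x| <= B.

Definition gauss_mean : R := \int[mu]_x (h x * pdf x).
Let c := gauss_mean.

Lemma normal_pdf_gauss x : pdf x = gauss (normal_peak 1) x.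
Proof.
rewrite /pdf normal_pdfE ?oner_eq0// /gauss /normal_fun; congr (_ * expR _).
by rewrite subr0 expr1n mulNr expr2.
Qed.

Let peak0 : 0 < normal_peak (1 : R).
Proof. by apply: normal_peak_gt0; exact: oner_neq0. Qed.

Let N : probability (measurableTypeR R) R := normal_prob 0 1.

Let mpdf : measurable_fun [set: R] pdf.
Proof. exact: measurable_normal_pdf. Qed.

Lemma lipschitz_continuous : continuous h.
Proof.
move=> x; apply/cvgrPdist_lt => e e0; near=> y.
by apply: (le_lt_trans (h_lip x y)); near: y; exact: cvgr_dist_lt.
Unshelve. all: by end_near. Qed.

Let mh : measurable_fun [set: R] h.
Proof. exact: continuous_measurable_fun lipschitz_continuous. Qed.

Lemma integrable_bounded_pdf (g : R -> R) (C : R) : measurable_fun [set: R] g ->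
  (forall x, `|g x| <= C) -> mu.-integrable [set: R] (fun x => (g x * pdf x)%:E).
Proof.
move=> mg gC.
have mgp : measurable_fun [set: R] (fun x => (g x * pdf x)%:E).
  by apply/measurable_EFinP; exact: measurable_funM.
apply: (@le_integrable _ _ R mu setT measurableT _ (fun x => (C%:E * (pdf x)%:E)%E)).
- exact: mgp.
- move=> x _; rewrite -EFinM !abse_EFin lee_fin !normrM ler_wpM2r//.
  exact: le_trans (gC x) (ler_norm _).
apply: integrableZl => //; exact: integrable_normal_pdf.
Qed.

Let Bc : forall x, `|h x - c| <= B + `|c|.
Proof. by move=> x; apply: (le_trans (ler_normB _ _)); rewrite lerD2r. Qed.

Let g x : R := (h x - c) * pdf x.
Let ig : mu.-integrable [set: R] (EFin \o g).
Proof. by apply: (integrable_bounded_pdf _ Bc); exact: measurable_funB. Qed.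

Definition gauss_primitive (w : R) : R := \int[mu]_(x in `]-oo, w]) g x.

Lemma gauss_primitive_derive (x : R) :
  is_derive x 1 gauss_primitive ((h x - c) * gauss (normal_peak 1) x).
Proof.
have xx : x < x + 1 by rewrite ltrDl.
have ig1 : mu.-integrable `]-oo, x + 1] (EFin \o g).
  exact: (integrableS measurableT).
have cg : {for x, continuous g}.
  apply: continuousM; last by apply: continuous_normal_pdf; exact: oner_neq0.
  by apply: continuousB; [exact: lipschitz_continuous|exact: cst_continuous].
have [d e] := @continuous_FTC1 R g (BInfty _ true) x (x + 1) xx ig1 (ltNyr _) cg.
apply: (is_derive_val (derivableP d)).
by rewrite -derive1E e /g normal_pdf_gauss.
Qed.

Lemma integral_gauss_centered : \int[mu]_x g x = 0.
Proof.
have i1 : mu.-integrable [set: R] (fun x => (h x * pdf x)%:E).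
  exact: (integrable_bounded_pdf mh h_bnd).
have i2 : mu.-integrable [set: R] (fun x => (c * pdf x)%:E).
  by apply: (@integrable_bounded_pdf (fun=> c) `|c|) => //.
have -> : \int[mu]_x g x = \int[mu]_x (h x * pdf x - c * pdf x).
  by apply: eq_Rintegral => x _; rewrite /g mulrBl.
rewrite RintegralB// RintegralZl//; last exact: integrable_normal_pdf.
have -> : \int[mu]_x pdf x = 1 by rewrite /Rintegral integral_normal_pdf.
by rewrite mulr1 subrr.
Qed.

Let norm_le (A : set R) : measurable A ->
  `|\int[mu]_(x in A) g x| <= (B + `|c|) * fine (N A).
Proof.
move=> mA.
have iA : mu.-integrable A (EFin \o g) by exact: (integrableS measurableT).
apply: (@le_trans _ _ (\int[mu]_(x in A) `|g x|)); first exact: le_normr_Rintegral.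
have ip : mu.-integrable A (EFin \o pdf).
  by apply: (integrableS measurableT) => //; exact: integrable_normal_pdf.
rewrite -[fine _]/(\int[mu]_(x in A) pdf x) -RintegralZl//.
apply: le_Rintegral => //.
- exact: integrable_norm.
- exact: (@integrableZl _ _ _ mu A mA (B + `|c|) _ ip).
move=> x _; rewrite normrM (ger0_norm (normal_pdf_ge0 _ _ _)) ler_wpM2r//.
exact: normal_pdf_ge0.
Qed.

(** The integral over A is at most (B + |c|) times the normal probability of A, and these sets
    escape to infinity. *)
Let vanishes_prob (A : R -> set R) : (forall x, measurable (A x)) ->
  (forall x, A x `<=` [set y | x <= `|y|]) ->
  vanishes (fun x => \int[mu]_(y in A x) g y).
Proof.
move=> mA hA e e0; have C0 : 0 <= B + `|c| by exact: le_trans (Bc 0).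
have eC : 0 < e / (B + `|c| + 1) by rewrite divr_gt0// ltr_wpDl.
have [a ha] := probability_tail N eC; exists a => x ax.
apply: (le_lt_trans (norm_le (mA x))).
have : fine (N (A x)) < e / (B + `|c| + 1).
  have fin : N (A x) \is a fin_num by exact: (@fin_num_measure _ _ _ N _ (mA x)).
  rewrite -lte_fin fineK//; apply: le_lt_trans (ha x ax).
  apply: le_measure; rewrite ?inE; [exact: mA| |exact: hA].
  exact: (@measurable_set_ler _ (measurableTypeR R) R (cst x) Num.norm (measurable_cst x)
    (@normr_measurable R setT)).
have p0 : 0 <= fine (N (A x)) by exact: fine_ge0.
rewrite ltr_pdivlMr ?ltr_wpDl//; apply: le_lt_trans.
by rewrite mulrC ler_wpM2l// lerDl.
Qed.

Lemma gauss_primitive_vanishesN : vanishes (fun x => gauss_primitive (- x)).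
Proof.
apply: vanishes_prob => // x y /=; rewrite in_itv/= => yx.
by rewrite -normrN (le_trans _ (ler_norm _))// lerNr.
Qed.

(** Centring h by its normal mean makes the left primitive equal to minus the right tail
    integral. *)
Lemma gauss_primitive_vanishes : vanishes gauss_primitive.
Proof.
have e x : gauss_primitive x = - \int[mu]_(y in `]x, +oo[) g y.
  apply/eqP; rewrite -addr_eq0 -integral_gauss_centered -(itv_setU_setT false x).
  apply/eqP; symmetry; apply: Rintegral_setU => //; first by rewrite itv_setU_setT.
  by rewrite -setCitvl; apply/disj_setPCl.
have v : vanishes (fun x => \int[mu]_(y in `]x, +oo[) g y).
  apply: vanishes_prob => // x y /=; rewrite in_itv/= andbT => yx.
  by rewrite (le_trans _ (ler_norm _))// ltW.
by move=> eps /v[a ha]; exists a => x /ha; rewrite e normrN.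
Qed.

End stein_solution.

Lemma cone_law_stein_bound {R : realType} (p : R) (p0 : 0 < p) (m : nat)
    (Q : probability (m.+1.-tuple R) R)
    (Qcone : forall A, measurable A -> A `<=` @lp_sphere R p m.+1 ->
      Q A = cone_measure p A)
    (w : 'I_m.+1 -> R) (w_norm : \sum_(j < m.+1) w j ^+ 2 * sigma2 m.+1 p = 1)
    (h : R -> R) (B : R) :
  (forall x y, `|h x - h y| <= `|x - y|) -> (forall x, `|h x| <= B) ->
  gauss_mean h - \int[Q]_u h (linear_form w u) <=
  3 * (m_np m.+1 p * sigma2 m.+1 p) * \sum_(j < m.+1) `|w j| ^+ 3
    + 2 * (Num.max p^-1 1 * (2 / m.+1.+2%:R)).
Proof.
move=> h_lip h_bnd; set c := gauss_mean h; pose W u := linear_form w u.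
have peak0 : 0 < normal_peak (1 : R) by apply: normal_peak_gt0; exact: oner_neq0.
pose G := gauss_primitive h.
have dG := gauss_primitive_derive h_lip h_bnd.
have vG := gauss_primitive_vanishes h_lip h_bnd.
have vGN := gauss_primitive_vanishesN h_lip h_bnd.
pose f := stein_sol (normal_peak 1) G.
pose f' := stein_sol' (normal_peak 1) h G c.
have df := stein_sol_derive peak0 dG.
have lf := stein_sol'_lip peak0 h_lip dG vG vGN.
have f4 := stein_sol'_le4 peak0 h_lip dG vG vGN.
(* The bound |f'| <= 4 makes F' nonnegative, as the bias estimate requires; the Lipschitz constant 2
   of f' is unchanged. *)
pose F z := f z + 4 * z; pose F1 z := f' z + 4.
have dF (z : R) : is_derive z 1 F (F1 z).
  have d := is_derive_mul (is_derive_const 4 z) (is_derive_ident z).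
  by apply: (is_derive_val (is_derive_add (df z) d)); rewrite mulr1 mulr0 addr0.
have F10 z : 0 <= F1 z.
  by have := f4 z; rewrite ler_norml -/(f' z) /F1 => /andP[? _]; lra.
have F1l z y : `|F1 z - F1 y| <= 2 * `|z - y|.
  by rewrite /F1 opprD addrACA subrr addr0; exact: lf.
have mF1 : measurable_fun [set: R] F1.
  apply: continuous_measurable_fun => z; apply/cvgrPdist_lt => e e0; near=> y.
  apply: (le_lt_trans (F1l z y)); rewrite -ltr_pdivlMl// mulrC.
  by near: y; apply: cvgr_dist_lt => //; rewrite divr_gt0.
have sphere1 := cone_law_sphere p0 (ltn0Sn m) Qcone.
have msphere := @measurable_lp_sphere R p m.+1.
have bW := bounded_rv_linear_form p0 w.
have mh : measurable_fun [set: R] h.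
  exact: continuous_measurable_fun (lipschitz_continuous h_lip).
have bh : bounded_rv (@lp_sphere R p m.+1) (fun u => h (W u)).
  split; last by exists B => u _; exact: h_bnd.
  exact: (measurableT_comp mh (proj1 bW)).
have bF1 : bounded_rv (@lp_sphere R p m.+1) (fun u => F1 (W u)).
  split; first exact: (measurableT_comp mF1 (proj1 bW)).
  exists 8 => u _; apply: (le_trans (ler_normD _ _)).
  by have := f4 (W u); rewrite -/(f' _) (gtr0_norm (ltr0n R 4)); lra.
have bW2 : bounded_rv (@lp_sphere R p m.+1) (fun u => 4 * W u ^+ 2).
  by apply: bounded_rvZ; exact: (bounded_rvM bW bW).
have bhN := bounded_rvZ (-1) bh.
have bc := bounded_rv_cst (@lp_sphere R p m.+1) (c - 4).
have := linear_form_stein_le p0 Qcone w_norm dF F10 F1l mF1.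
(* By the Stein equation W F(W) = F'(W) + 4 W^2 - h(W) + c - 4, and the two terms with 4 cancel in
   expectation. *)
have -> : \int[Q]_u (linear_form w u * F (linear_form w u)) =
    \int[Q]_u ((F1 (W u) + 4 * W u ^+ 2) + (- 1 * h (W u) + (c - 4))).
  by apply: eq_Rintegral => u _; rewrite /F1 /f' /stein_sol' -/f -/(W u) /F; ring.
rewrite (Rintegral_add msphere sphere1 (bounded_rvD bF1 bW2) (bounded_rvD bhN bc)).
rewrite (Rintegral_add msphere sphere1 bF1 bW2) (Rintegral_add msphere sphere1 bhN bc).
rewrite (Rintegral_Zl msphere sphere1 _ bh).
rewrite (Rintegral_Zl msphere sphere1 _ (bounded_rvM bW bW)).
rewrite (Rintegral_linear_form2 p0 Qcone) w_norm Rintegral_cst//.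
have -> : fine (Q setT) = 1 by rewrite probability_setT.
rewrite /W; move: (\int[Q]_u F1 _) (\int[Q]_u h _) => a b.
move: (Num.max _ _ * _) (m_np _ _ * _) (\sum_(j < _) _) => x y z; lra.
Unshelve. all: by end_near. Qed.

(** * The L1 distance *)

Section half_line_superposition.
Context {R : realType}.
Local Notation mu := (@lebesgue_measure R).
Variable s : R -> R.
Hypothesis ms : measurable_fun [set: R] s.
Hypothesis int_s : mu.-integrable [set: R] (EFin \o s).

Definition half_line (z x : R) : R := (z < x)%R%:R.

(** A primitive of s, written as a mixture of half-line indicators: its expectation then involves
    only the tails P(X > z), and |s| <= 1 makes it 1-Lipschitz. *)
Definition superposition (x : R) : R := \int[mu]_z (s z * half_line z x).

Lemma measurable_half_line d (T : measurableType d) (f g : T -> R) :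
  measurable_fun [set: T] f -> measurable_fun [set: T] g ->
  measurable_fun [set: T] (fun t => half_line (f t) (g t)).
Proof.
move=> mf mg.
apply: (eq_measurable_fun (\1_[set t | f t < g t] : T -> R)).
  by move=> t _; rewrite indicE /half_line mem_setE; congr (_%:R).
by apply: measurable_indic; exact: measurable_set_ltr.
Qed.

Lemma half_line_norm_le1 z x : `|half_line z x| <= 1.
Proof. by rewrite /half_line; case: (z < x)%R; rewrite ?normr1 ?normr0. Qed.

Let ih (x : R) : mu.-integrable [set: R] (fun z => (s z * half_line z x)%:E).
Proof.
apply: (@le_integrable _ _ R mu setT measurableT _ (EFin \o s)) => //.
  apply/measurable_EFinP; apply: measurable_funM => //.
  exact: measurable_half_line.
move=> z _; rewrite /= lee_fin normrM ler_piMr//.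
exact: half_line_norm_le1.
Qed.

Let is1 : mu.-integrable [set: R] (fun z => `|s z|%:E).
Proof. exact: integrable_norm. Qed.

Lemma superposition_bounded x : `|superposition x| <= \int[mu]_z `|s z|.
Proof.
rewrite /superposition.
apply: (@le_trans _ _ (\int[mu]_z `|s z * half_line z x|)).
  by apply: le_normr_Rintegral => //; exact: ih.
apply: le_Rintegral => //; first exact: (integrable_norm (ih x)).
by move=> z _; rewrite normrM ler_piMr// half_line_norm_le1.
Qed.

Lemma superposition_lip : (forall z, `|s z| <= 1) ->
  forall x y, `|superposition x - superposition y| <= `|x - y|.
Proof.
move=> s1 x y.
wlog yx : x y / y <= x.
  move=> hw; have [yx|/ltW xy] := leP y x; first exact: hw.
  by rewrite distrC [leRHS]distrC; exact: hw.
rewrite (ger0_norm (_ : 0 <= x - y)) ?subr_ge0//.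
have ed z : s z * half_line z x - s z * half_line z y = s z * \1_(`[y, x[) z.
  rewrite -mulrBr; congr (_ * _); rewrite /half_line indicE mem_setE in_itv/=.
  case: (ltP z y) => zy; first by rewrite (lt_le_trans zy yx) subrr.
  by rewrite subr0.
rewrite /superposition -(RintegralB measurableT (ih x) (ih y)).
have iB := integrableB measurableT (ih x) (ih y).
have ii : mu.-integrable [set: R] (EFin \o (\1_(`[y, x[) : R -> R)).
  exact: integrable_indic_itv.
apply: (@le_trans _ _ (\int[mu]_z `|s z * half_line z x - s z * half_line z y|)).
  by apply: le_normr_Rintegral => //; exact: iB.
apply: (@le_trans _ _ (\int[mu]_z \1_(`[y, x[) z)).
  apply: le_Rintegral => //; first exact: (integrable_norm iB).
  move=> z _; have i0 : 0 <= \1_(`[y, x[) z :> R by rewrite indicE ler0n.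
  by rewrite ed normrM (ger0_norm i0) ler_piMl.
have e : (\int[mu]_z (\1_(`[y, x[) z)%:E = lebesgue_measure (`[y, x[ : set R))%E.
  by rewrite integral_indic// setIT.
by rewrite /Rintegral e lebesgue_measure_itv/=; case: ifP => // _; rewrite /= subr_ge0.
Qed.

(** Fubini, with |s| k as dominating function. The density k lets one statement serve both laws: Q
    with k = 1, and Lebesgue measure with the normal density. *)
Lemma superposition_integral d (T : measurableType d)
    (nu : {sigma_finite_measure set T -> \bar R}) (X k : T -> R) :
  measurable_fun [set: T] X -> measurable_fun [set: T] k -> (forall t, 0 <= k t) ->
  nu.-integrable [set: T] (EFin \o k) ->
  \int[nu]_t (superposition (X t) * k t) =
  \int[mu]_z (s z * \int[nu]_t (half_line z (X t) * k t)).
Proof.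
move=> mX mk k0 ik.
pose Phi (w : T * measurableTypeR R) : \bar R := (s w.2 * half_line w.2 (X w.1) * k w.1)%:E.
have mPhi : measurable_fun [set: T * measurableTypeR R] Phi.
  apply/measurable_EFinP; apply: measurable_funM; last exact: measurableT_comp.
  apply: measurable_funM; first exact: (measurableT_comp ms measurable_snd).
  by apply: measurable_half_line; [exact: measurable_snd|exact: measurableT_comp].
have iPhi : (nu \x mu)%E.-integrable [set: T * measurableTypeR R] Phi.
  apply/(integrable12ltyP nu (@lebesgue_measure R) mPhi).
  have k0E t : [set: T] t -> (0 <= (k t)%:E)%E by rewrite lee_fin.
  have mkE : measurable_fun [set: T] (fun t => (k t)%:E) by exact/measurable_EFinP.
  have I0 : (0 <= \int[mu]_z `|s z|%:E)%E by apply: integral_ge0 => z _; rewrite lee_fin.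
  apply: (@le_lt_trans _ _ (\int[nu]_t ((k t)%:E * \int[mu]_z `|s z|%:E))%E).
    apply: ge0_le_integral => //.
    - by move=> t _; apply: integral_ge0.
    - apply: (@measurable_fun_fubini_tonelli_F _ _ _ _ _ (@lebesgue_measure R)
        (abse \o Phi)) => [|w]; last exact: abse_ge0.
      exact: measurableT_comp.
    - exact: emeasurable_funM.
    move=> t _.
    have msE : measurable_fun [set: measurableTypeR R] (fun z => `|s z|%:E).
      by apply/measurable_EFinP; exact: measurableT_comp.
    have sE0 z : [set: measurableTypeR R] z -> (0 <= `|s z|%:E)%E by rewrite lee_fin.
    rewrite -(ge0_integralZl (@lebesgue_measure R) measurableT msE sE0 (k0E t I)).
    apply: ge0_le_integral => //.
    - apply: measurableT_comp => //; exact: (measurableT_comp mPhi (pair1_measurable t)).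
    - exact: emeasurable_funM.
    move=> z _; rewrite /= -EFinM lee_fin normrM (ger0_norm (k0 t)) mulrC ler_wpM2l//.
    by rewrite normrM ler_piMr// half_line_norm_le1.
  rewrite ge0_integralZr//; apply: lte_mul_pinfty.
  - exact: integral_ge0.
  - by have := integrable_fin_num measurableT ik.
  - by rewrite -ge0_fin_numE//; exact: integrable_fin_num is1.
have e1 := integral12_prod_meas1 iPhi; have e2 := integral21_prod_meas1 iPhi.
rewrite /Rintegral; congr fine.
transitivity (\int[nu]_t \int[mu]_z Phi (t, z))%E.
  apply: eq_integral => t _; rewrite EFinM muleC.
  rewrite fineK; last exact: integrable_fin_num.
  rewrite -integralZl//.
  by apply: eq_integral => z _; rewrite -EFinM mulrC.
transitivity (\int[mu]_z \int[nu]_t Phi (t, z))%E; first exact: etrans e1 (esym e2).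
apply: eq_integral => z _; rewrite EFinM.
have ihk : nu.-integrable [set: T] (fun t => (half_line z (X t) * k t)%:E).
  apply: (@le_integrable _ _ R nu setT measurableT _ (EFin \o k)) => //.
    by apply/measurable_EFinP; apply: measurable_funM => //; exact: measurable_half_line.
  move=> t _; rewrite /= lee_fin normrM ler_piMl//.
  exact: half_line_norm_le1.
rewrite fineK; last exact: integrable_fin_num.
rewrite -integralZl//.
by apply: eq_integral => t _; rewrite -EFinM mulrA.
Qed.

End half_line_superposition.

Section tails.
Context {R : realType}.
Local Notation mu := (@lebesgue_measure R).

Lemma Rintegral_half_line d (T : measurableType d) (Q : probability T R) (X : T -> R) z :
  measurable_fun [set: T] X ->
  \int[Q]_t (half_line z (X t) * 1) = 1 - fine (Q [set t | X t <= z]).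
Proof.
move=> mX; have mA : measurable [set t | X t <= z].
  exact: (measurable_set_ler mX (measurable_cst z)).
rewrite -[1 - _]/(fine 1%E - _) -fineB//; last exact: fin_num_measure.
rewrite -(probability_setC Q mA) /Rintegral; congr fine.
transitivity (\int[Q]_t (\1_(~` [set t | X t <= z]) t)%:E)%E; last first.
  by rewrite integral_indic// ?setIT//; exact: measurableC.
apply: eq_integral => t _; rewrite mulr1 indicE /half_line; congr (_%:R%:E).
by rewrite in_setC mem_setE -ltNge.
Qed.

Lemma Rintegral_half_line_normal (z : R) :
  \int[mu]_x (half_line z x * normal_pdf 0 1 x) = 1 - fine (std_normal_cdf z).
Proof.
pose N : probability (measurableTypeR R) R := normal_prob 0 1.
rewrite -[1 - _]/(fine 1%E - fine (N [set` `]-oo, z]])) -fineB//; last exact: fin_num_measure.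
rewrite -(probability_setC N) // setCitvl.
rewrite -[RHS]/(\int[mu]_(x in `]z, +oo[) normal_pdf 0 1 x) [RHS]Rintegral_mkcond.
apply: eq_Rintegral => x _; rewrite patchE mem_setE in_itv/= andbT /half_line.
by case: (z < x)%R; rewrite ?mul1r ?mul0r.
Qed.

Lemma measurable_std_normal_cdf :
  measurable_fun [set: R] (fun z : R => fine (std_normal_cdf z)).
Proof.
pose N : probability (measurableTypeR R) R := normal_prob 0 1.
apply: nondecreasing_measurable => //= r s rs.
apply: fine_le; [exact: (@fin_num_measure _ _ _ N)|exact: (@fin_num_measure _ _ _ N)|].
by apply: (@le_measure _ _ _ N); rewrite ?inE//; exact: subitvPr.
Qed.

(* Take for s the sign of F - G on [-N, N]. *)
Lemma L1_dist_le (F G : R -> R) (b : R) : measurable_fun [set: R] F ->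
  measurable_fun [set: R] G -> (forall z, `|F z - G z| <= 1) ->
  (forall (s : R -> R), measurable_fun [set: R] s ->
    mu.-integrable [set: R] (EFin \o s) -> (forall z, `|s z| <= 1) ->
    \int[mu]_z (s z * (F z - G z)) <= b) ->
  (\int[mu]_z `|(F z)%:E - (G z)%:E| <= b%:E)%E.
Proof.
move=> mF mG D1 hs.
pose D z := F z - G z.
have mD : measurable_fun [set: R] D by exact: measurable_funB.
have mnD : measurable_fun [set: R] (fun z => `|D z|%:E).
  by apply/measurable_EFinP; exact: measurableT_comp.
pose A (N : nat) : set R := [set` `[- N%:R, N%:R]].
have -> : (\int[mu]_z `|(F z)%:E - (G z)%:E| = \int[mu]_(z in \bigcup_N A N) `|D z|%:E)%E.
  have -> : \bigcup_N A N = setT.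
    rewrite -subTset => z _; exists (Num.bound `|z|) => //.
    by rewrite /A /= in_itv/= -ler_norml ltW// archi_boundP.
  by apply: eq_integral.
(* The cut-off keeps s integrable; monotone convergence removes it. *)
have cv : (\int[mu]_(z in A N) `|D z|%:E)%E @[N --> \oo] -->
    (\int[mu]_(z in \bigcup_N A N) `|D z|%:E)%E.
  apply: ge0_nondecreasing_set_cvg_integral.
  - move=> N M NM; apply/subsetPset => z; rewrite /A /= !in_itv/= => /andP[z1 z2].
    have h : N%:R <= M%:R :> R by rewrite ler_nat.
    by rewrite (le_trans _ z1) ?lerN2//= (le_trans z2).
  - by move=> N; exact: measurable_itv.
  - by move=> N; apply: measurable_funTS.
  - by move=> N z _; rewrite lee_fin.
rewrite -(cvg_lim _ cv)//; apply: lime_le; first by apply/cvg_ex; eexists; exact: cv.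
apply: nearW => N.
pose s z : R := (half_line 0 (D z) - half_line (D z) 0) * \1_(A N) z.
have mA : measurable (A N) by exact: measurable_itv.
have ms : measurable_fun [set: R] s.
  apply: measurable_funM; last exact: measurable_indic.
  by apply: measurable_funB; exact: measurable_half_line.
have s1 z : `|s z| <= \1_(A N) z.
  have i0 : 0 <= \1_(A N) z :> R by rewrite indicE ler0n.
  rewrite /s normrM (ger0_norm i0) ler_piMl// /half_line.
  by case: ltgtP => _; rewrite ?subr0 ?sub0r ?subrr ?normrN ?normr1 ?normr0.
have iA : mu.-integrable [set: R] (EFin \o (\1_(A N) : R -> R)).
  exact: integrable_indic_itv.
have iN z : \1_(A N) z <= 1 :> R by rewrite indicE; case: (_ \in _).
have int_s : mu.-integrable [set: R] (EFin \o s).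
  apply: (@le_integrable _ _ R mu setT measurableT _ _ _ _ iA); first exact/measurable_EFinP.
  by move=> z _; rewrite /= lee_fin (le_trans (s1 z))// ler_norm.
have int_sD : mu.-integrable [set: R] (fun z => (s z * D z)%:E).
  apply: (@le_integrable _ _ R mu setT measurableT _ _ _ _ iA).
    by apply/measurable_EFinP; exact: measurable_funM.
  move=> z _; rewrite /= lee_fin normrM; apply: (@le_trans _ _ (\1_(A N) z * 1)).
    by apply: ler_pM => //; exact: D1.
  by rewrite mulr1 ler_norm.
have eD : (\int[mu]_(z in A N) `|D z|%:E = (\int[mu]_z (s z * D z))%:E)%E.
  rewrite /Rintegral fineK; last exact: integrable_fin_num int_sD.
  rewrite [LHS]integral_mkcond; apply: eq_integral => z _; rewrite patchE /s indicE.
  case: (z \in A N); last by rewrite mulr0 mul0r.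
  rewrite mulr1 /half_line; congr (_%:E).
  by case: ltgtP => [d|d|<-]; rewrite ?subr0 ?sub0r ?subrr ?mul1r ?mulN1r ?mul0r
    ?normr0 ?(gtr0_norm d) ?(ltr0_norm d).
by rewrite eD lee_fin; apply: hs => // z; exact: le_trans (s1 z) (iN z).
Qed.

End tails.

(** * From the cone law back to the random vector *)

Section cone_law_rv.
Context {R : realType} (p : R) (p0 : 0 < p) (m : nat).
Context d (T : measurableType d) (P : probability T R).
Variables (X : {RV P >-> m.+1.-tuple R}) (hX : has_cone_measure p X).
Implicit Types j : 'I_m.+1.

Let Q : probability (m.+1.-tuple R) R := distribution P X.
Let Qcone : forall A, measurable A -> A `<=` @lp_sphere R p m.+1 ->
  Q A = cone_measure p A := hX.

Let sphere1 : Q (@lp_sphere R p m.+1) = 1%E.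
Proof. exact: (cone_law_sphere p0 (ltn0Sn m) Qcone). Qed.

Let XD := X @^-1` (@lp_sphere R p m.+1).
Let mXD : measurable XD.
Proof.
by rewrite -[XD]setTI; apply: measurable_funPT => //; exact: measurable_lp_sphere.
Qed.
Let XD1 : P XD = 1%E. Proof. exact: sphere1. Qed.

Lemma bounded_rv_comp (h : m.+1.-tuple R -> R) :
  bounded_rv (@lp_sphere R p m.+1) h -> bounded_rv XD (h \o X).
Proof.
move=> [mh [C hC]]; split; first exact: (measurableT_comp mh).
by exists C => t /hC.
Qed.

Lemma integral_comp (h : m.+1.-tuple R -> R) :
  bounded_rv (@lp_sphere R p m.+1) h ->
  (\int[P]_t (h (X t))%:E = (\int[Q]_u h u)%:E)%E.
Proof.
move=> bh; rewrite (EFin_Rintegral (@measurable_lp_sphere R p m.+1) sphere1 bh).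
have mh : measurable_fun [set: m.+1.-tuple R] (EFin \o h).
  by apply/measurable_EFinP; exact: proj1 bh.
have ih := bounded_rv_integrable mXD XD1 (bounded_rv_comp bh).
exact: esym (integral_distribution mh ih).
Qed.

Let bcoord j := bounded_rv_coord p0 j.

Lemma Rintegral_coord0 j : \int[Q]_u tnth u j = 0.
Proof.
have h := Rintegral_cone_law_flip p0 Qcone j (proj1 (bcoord j)).
have e : \int[Q]_u (- 1 * tnth u j) = \int[Q]_u tnth u j.
  by rewrite -[RHS]h; apply: eq_Rintegral => u _; rewrite tnth_flip eqxx mulN1r.
by move: e; rewrite (Rintegral_Zl (@measurable_lp_sphere R p m.+1) sphere1 _ (bcoord j)); lra.
Qed.

Lemma variance_coord j : ('V_P[coord_RV X j] = (sigma2 m.+1 p)%:E)%E.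
Proof.
have E0 : ('E_P[coord_RV X j] = 0)%E.
  by rewrite unlock; apply: (etrans (integral_comp (bcoord j))); rewrite Rintegral_coord0.
rewrite /variance unlock E0 unlock /=.
transitivity (\int[P]_t (tnth (X t) j ^+ 2)%:E)%E.
  apply: eq_integral => t _.
  by rewrite -[LHS]/(((tnth (X t) j - 0) * (tnth (X t) j - 0))%:E) subr0 -expr2.
apply: (etrans (integral_comp (bounded_rvM (bcoord j) (bcoord j)))).
by rewrite -(Rintegral_coord2 p0 Qcone j).
Qed.

(** The bias relation for f(x) = |x| turns E|X_j|^3 into the variance times the mean sought. *)
Lemma square_bias_norm j d' (T' : measurableType d') (P' : probability T' R)
    (X1 : {RV P' >-> R}) : has_square_bias_of (coord_RV X j : {RV P >-> R}) X1 ->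
  ('E_P'[fun w => `|X1 w|%R] = (m_np m.+1 p)%:E)%E.
Proof.
have b3 : bounded_rv (@lp_sphere R p m.+1) (fun u => tnth u j ^+ 2 * `|tnth u j|).
  apply: bounded_rvM; first exact: (bounded_rvM (bcoord j) (bcoord j)).
  exact: (bounded_rv_norm (bcoord j)).
have ib := bounded_rv_integrable mXD XD1 (bounded_rv_comp b3).
move=> hb; have := hb (fun x => `|x|) (@normr_measurable R setT) ib.
rewrite variance_coord [in LHS]unlock => e.
have e1 : (\int[P]_t (tnth (X t) j ^+ 2 * `|tnth (X t) j|)%:E =
    (m_np m.+1 p * sigma2 m.+1 p)%:E)%E.
  apply: (etrans (integral_comp b3)); congr (_%:E).
  rewrite -(Rintegral_norm3 p0 Qcone j); apply: eq_Rintegral => u _.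
  by rewrite [RHS]exprSr real_normK ?num_real.
have {}e := etrans (esym e) e1.
have s0 : sigma2 m.+1 p != 0 by rewrite gt_eqF// sigma2_gt0.
rewrite -[LHS]mul1e -(mulVf s0) EFinM -muleA.
by rewrite [X in (_ * X)%E]e -EFinM mulrCA mulVf// mulr1.
Qed.

Lemma L1_dist_cone_law (theta : m.+1.-tuple R) : euclidean_norm theta = 1 ->
  (L1_dist (cdf (scale_mfun (sigma m.+1 p)^-1 (projection X theta) : {RV P >-> R}))
     (@std_normal_cdf R)
   <= (3 * (m_np m.+1 p / sigma m.+1 p) * (\sum_(i < m.+1) `|tnth theta i| ^+ 3)
       + Num.max (1 / p) 1 * (4 / m.+3%:R))%:E)%E.
Proof.
move=> htheta.
have s0 : 0 < sigma m.+1 p by rewrite sqrtr_gt0 sigma2_gt0.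
have s2 : sigma m.+1 p ^+ 2 = sigma2 m.+1 p by rewrite sqr_sqrtr// ltW// sigma2_gt0.
set sg := sigma m.+1 p in s0 s2 *.
pose W : {RV P >-> R} := scale_mfun sg^-1 (projection X theta); rewrite -/W.
have sg0 : sg != 0 by rewrite gt_eqF.
pose w j := tnth theta j / sg.
have w_norm : \sum_(j < m.+1) w j ^+ 2 * sigma2 m.+1 p = 1.
  have e : \sum_(j < m.+1) tnth theta j ^+ 2 = 1.
    have n0 : 0 <= \sum_(j < m.+1) tnth theta j ^+ 2 by apply: sumr_ge0 => j _; exact: sqr_ge0.
    by rewrite -(sqr_sqrtr n0) -[Num.sqrt _]/(euclidean_norm theta) htheta expr1n.
  by rewrite -s2 -e; apply: eq_bigr => j _; rewrite /w exprMn exprVn divfK// expf_neq0.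
have eW t : W t = linear_form w (X t).
  rewrite /W /= /projection mulr_suml; apply: eq_bigr => j _.
  by rewrite /w /coord_RV mulrAC.
pose F z := fine (cdf W z); pose G z := fine (std_normal_cdf z : \bar R).
pose N : probability (measurableTypeR R) R := normal_prob 0 1.
have fF z : cdf W z \is a fin_num by exact: fin_num_measure.
have fG (z : R) : std_normal_cdf z \is a fin_num.
  by rewrite -[std_normal_cdf z]/(N [set` `]-oo, z]]); exact: fin_num_measure.
have mF : measurable_fun [set: R] F.
  apply: nondecreasing_measurable => // r s rs.
  by apply: fine_le => //; exact: cdf_nondecreasing.
have F01 (z : R) : 0 <= F z <= 1.
  rewrite fine_ge0//= -lee_fin fineK//; exact: cdf_le1.
have G01 (z : R) : 0 <= G z <= 1.
  rewrite fine_ge0 ?(measure_ge0 N)//= -lee_fin fineK//; exact: (probability_le1 N (measurable_itv `]-oo, z])).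
rewrite /L1_dist; have -> : (\int[lebesgue_measure]_t `|cdf W t - std_normal_cdf t| =
    \int[lebesgue_measure]_t `|(F t)%:E - (G t)%:E|)%E.
  by apply: eq_integral => z _; rewrite /F /G !fineK.
apply: L1_dist_le => //; first exact: measurable_std_normal_cdf.
  move=> z; have /andP[F0 F1] := F01 z; have /andP[G0 G1] := G01 z.
  by rewrite ler_norml; apply/andP; split; lra.
move=> s ms int_s s1.
have bW := bounded_rv_linear_form p0 w.
pose h := superposition s.
have := cone_law_stein_bound p0 Qcone w_norm (superposition_lip ms int_s s1)
  (superposition_bounded ms int_s).
(* Both expectations of h become integrals of s against the tails 1 - G and 1 - F, so their
   difference is the integral of s (F - G). *)
have -> : gauss_mean h = \int[lebesgue_measure]_z (s z * (1 - G z)).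
  rewrite /gauss_mean.
  rewrite (superposition_integral ms int_s (nu := lebesgue_measure) (X := id)
    (k := normal_pdf 0 1))//.
  - by apply: eq_Rintegral => z _; rewrite Rintegral_half_line_normal.
  - exact: measurable_normal_pdf.
  - by move=> t; exact: normal_pdf_ge0.
  - exact: integrable_normal_pdf.
have -> : \int[Q]_u h (linear_form w u) = \int[lebesgue_measure]_z (s z * (1 - F z)).
  transitivity (\int[Q]_u (h (linear_form w u) * 1)).
    by apply: eq_Rintegral => u _; rewrite mulr1.
  rewrite (superposition_integral ms int_s (nu := Q) (X := linear_form w) (k := fun=> 1))//.
  - apply: eq_Rintegral => z _; rewrite (Rintegral_half_line Q z (proj1 bW)).
    congr (_ * (_ - fine _)).
    rewrite /cdf /Q /distribution /pushforward; congr (P _).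
    by apply/seteqP; split => t /=; rewrite in_itv/= -eW.
  - exact: (proj1 bW).
  - exact: (bounded_rv_integrable (@measurable_lp_sphere R p m.+1) sphere1 (bounded_rv_cst _ 1)).
have int1 (H : R -> R) : measurable_fun [set: R] H -> (forall z, 0 <= H z <= 1) ->
    lebesgue_measure.-integrable [set: R] (EFin \o (fun z => s z * (1 - H z))).
  move=> mH H01; apply: (@le_integrable _ _ R lebesgue_measure setT measurableT _ _ _ _ int_s).
    by apply/measurable_EFinP; apply: measurable_funM => //; exact: measurable_funB.
  move=> z _; rewrite /= lee_fin normrM ler_piMr// ler_norml.
  by have /andP[? ?] := H01 z; apply/andP; split; lra.
rewrite -(RintegralB measurableT (int1 G measurable_std_normal_cdf G01) (int1 F mF F01)).
have -> : \int[lebesgue_measure]_x (s x * (1 - G x) - s x * (1 - F x)) =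
    \int[lebesgue_measure]_x (s x * (F x - G x)).
  by apply: eq_Rintegral => z _; ring.
move=> h1; apply: (le_trans h1).
have -> : \sum_(j < m.+1) `|w j| ^+ 3 = (\sum_(j < m.+1) `|tnth theta j| ^+ 3) / sg ^+ 3.
  rewrite mulr_suml; apply: eq_bigr => j _.
  by rewrite /w normrM normfV (gtr0_norm s0) exprMn exprVn.
(* The weights theta_j / sigma bring sigma^-3, which meets the variance sigma^2 and leaves m /
   sigma. *)
rewrite -s2 div1r le_eqVlt; apply/orP; left; apply/eqP.
have n0 : m.+3%:R != 0 :> R by rewrite pnatr_eq0.
move: (Num.max _ _) (\sum_(j < _) _) (m_np _ _) (m.+3%:R : R) n0 => a b c e e0.
by field; rewrite e0 sg0.
Qed.

End cone_law_rv.

Theorem theorem4p1 (R : realType) (p : R) (hp : 0 < p)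
    (n : nat) (hn : (0 < n)%N)
    (d : measure_display) (T : measurableType d) (P : probability T R)
    (X : {RV P >-> n.-tuple R}) (hX : has_cone_measure p X)
    (theta : n.-tuple R) (htheta : euclidean_norm theta = 1) :
  let X1 : {RV P >-> R} := coord_RV X (Ordinal hn) in
  let Y : {RV P >-> R} := projection X theta in
  let W : {RV P >-> R} := scale_mfun (sigma n p)^-1 Y in
  [/\ ('V_P[X1] = (sigma2 n p)%:E)%E,
      forall (d' : measure_display) (T' : measurableType d')
             (P' : probability T' R) (X11 : {RV P' >-> R}),
        has_square_bias_of X1 X11 ->
        ('E_P'[fun w => `|X11 w|%R] = (m_np n p)%:E)%E
    & (L1_dist (cdf W) (@std_normal_cdf R)
       <= (3 * (m_np n p / sigma n p) * (\sum_(i < n) `|tnth theta i| ^+ 3)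
           + Num.max (1 / p) 1 * (4 / n.+2%:R))%:E)%E ].
Proof.
move: n hn X hX theta htheta => [//|m] hn X hX theta htheta X1 Y W; split.
- exact: variance_coord.
- by move=> d' T' P' X11; exact: square_bias_norm.
- exact: L1_dist_cone_law.
Qed.
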